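(* Let $N\ge 3$, let $\Omega\subset\mathbb{R}^N$ be a bounded domain with smooth boundary, and let $p_1,p_2,q:\overline\Omega\to(1,\infty)$ be continuous. Put $m(x)=\max\{p_1(x),p_2(x)\}$ for $x\in\overline\Omega$. Assume that $m(x)<q(x)<m^\star(x)$ for every $x\in\overline\Omega$, that $m^+<q^-$, and that $q^+<\frac{N m^-}{N-m^-}$ (the right-hand side being read as $+\infty$ if $m^-\ge N$). Then there exists $\lambda^\star>0$ such that for every $\lambda\ge\lambda^\star$ the problem $$\begin{cases}-\mathrm{div}\big((|\nabla u|^{p_1(x)-2}+|\nabla u|^{p_2(x)-2})\nabla u\big)=\lambda|u|^{m(x)-2}u-|u|^{q(x)-2}u, & x\in\Omega,\\ u=0, & x\in\partial\Omega,\end{cases}$$ has a nontrivial (i.e. not identically zero) weak solution $u\in W_0^{1,m(x)}(\Omega)$.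
   Context: For a continuous function $h:\overline\Omega\to(1,\infty)$ write $h^+=\sup_{x\in\Omega}h(x)$ and $h^-=\inf_{x\in\Omega}h(x)$, and let $h^\star(x)=\frac{N h(x)}{N-h(x)}$ if $h(x)<N$ and $h^\star(x)=+\infty$ if $h(x)\ge N$. The variable exponent Lebesgue space $L^{h(x)}(\Omega)$ is the space of measurable $u:\Omega\to\mathbb{R}$ (modulo equality a.e.) with $\int_\Omega|u(x)|^{h(x)}\,dx<\infty$, with the Luxemburg norm $|u|_{h(x)}=\inf\{\mu>0:\int_\Omega|u(x)/\mu|^{h(x)}\,dx\le 1\}$. The space $W_0^{1,h(x)}(\Omega)$ is the closure (completion) of $C_0^\infty(\Omega)$ (smooth functions with compact support in $\Omega$) under the norm $\|u\|_{h(x)}=|\nabla u|_{h(x)}$, where $|\nabla u|_{h(x)}$ is the Luxemburg norm of $x\mapsto|\nabla u(x)|$. A weak solution of the problem is a function $u\in W_0^{1,m(x)}(\Omega)$ such that for all $v\in W_0^{1,m(x)}(\Omega)$, $$\int_\Omega(|\nabla u|^{p_1(x)-2}+|\nabla u|^{p_2(x)-2})\nabla u\cdot\nabla v\,dx-\lambda\int_\Omega|u|^{m(x)-2}uv\,dx+\int_\Omega|u|^{q(x)-2}uv\,dx=0.$$ *)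

(* Defs.v *)
From HB Require Import structures.
From mathcomp Require Import all_boot all_order all_algebra.
From mathcomp Require Import all_classical all_reals all_analysis.

Set Implicit Arguments.
Unset Strict Implicit.
Unset Printing Implicit Defensive.
Import Order.TTheory GRing.Theory Num.Theory.
Import numFieldNormedType.Exports.

Local Open Scope classical_set_scope.
Local Open Scope ring_scope.

Definition measure_rV_display : measure_display -> measure_display.
Proof. exact. Qed.

(* Row vectors carry the sigma-algebra generated by the coordinates, as
   [n.-tuple T] does in the library; for T = R it is the Borel one. *)
Section measurable_rV.
Context {d} {T : measurableType d}.
Variable n : nat.

Let coors : 'I_n -> 'rV[T]_n -> T := fun i x => x ord0 i.

Let rV_set0 : g_sigma_preimage coors set0.
Proof. exact: sigma_algebra0. Qed.

Let rV_setC A : g_sigma_preimage coors A -> g_sigma_preimage coors (~` A).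
Proof. exact: sigma_algebraC. Qed.

Let rV_bigcup (F : _^nat) : (forall i, g_sigma_preimage coors (F i)) ->
  g_sigma_preimage coors (\bigcup_i (F i)).
Proof. exact: sigma_algebra_bigcup. Qed.

HB.instance Definition _ := @isMeasurable.Build (measure_rV_display d)
  'rV[T]_n (g_sigma_preimage coors) rV_set0 rV_setC rV_bigcup.

End measurable_rV.

Lemma measurable_coord d (T : measurableType d) n (i : 'I_n) :
  measurable_fun [set: 'rV[T]_n] (fun x : 'rV[T]_n => x ord0 i).
Proof.
move=> _ Y mY; rewrite setTI; apply: sub_sigma_algebra => /=.
rewrite -bigcup_seq/=; exists i => /=; first by rewrite mem_index_enum.
by exists Y => //; rewrite setTI.
Qed.

Lemma measurable_fun_rVP d1 d2 (T1 : measurableType d1) (T2 : measurableType d2)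
    n (f : T1 -> 'rV[T2]_n) :
  (forall i, measurable_fun [set: T1] (fun x => f x ord0 i)) ->
  measurable_fun [set: T1] f.
Proof.
move=> mf _ A mA; rewrite setTI.
pose C := [set B : set 'rV[T2]_n | measurable (f @^-1` B)].
apply: (_ : <<s \big[setU/set0]_(i < n) preimage_set_system setT
  (fun x : 'rV[T2]_n => x ord0 i) measurable >> `<=` C) mA.
apply: smallest_sub.
  split; rewrite /C/=.
  - by rewrite preimage_set0.
  - by move=> B mB; rewrite setTD preimage_setC; exact: measurableC.
  - by move=> F mF; rewrite preimage_bigcup; exact: bigcupT_measurable.
move=> B; rewrite -bigcup_seq/= => -[i _ [Y mY <-]].
by rewrite /C/= setTI; have := mf i measurableT _ mY; rewrite setTI.
Qed.

Definition rV_cons (T : Type) n (x : T * 'rV[T]_n) : 'rV[T]_n.+1 :=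
  \row_(i < n.+1) oapp (x.2 ord0) x.1 (unlift ord0 i).

Lemma measurable_rV_cons d (T : measurableType d) n :
  measurable_fun [set: T * 'rV[T]_n] (@rV_cons T n).
Proof.
apply: measurable_fun_rVP => i.
rewrite (_ : (fun x => _) = fun x : T * 'rV[T]_n =>
  oapp (x.2 ord0) x.1 (unlift ord0 i)); last by apply/funext => x; rewrite mxE.
case: (unlift ord0 i) => [j|] /=; last exact: measurable_fst.
by apply: (measurableT_comp (measurable_coord j)); exact: measurable_snd.
Qed.

Section lebesgue_rV.
Context {R : realType}.

Section step.
Variables (n : nat) (mu : {measure set 'rV[R]_n -> \bar R}).

Definition lebesgue_rV_step : set 'rV[R]_n.+1 -> \bar R :=
  pushforward (lebesgue_measure \x^ mu)%E (@rV_cons R n).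

Let mcons : measurable_fun [set: R * 'rV[R]_n] (@rV_cons R n).
Proof. exact: measurable_rV_cons. Qed.

Let step0 : lebesgue_rV_step set0 = 0%E.
Proof. exact: measure0. Qed.

Let step_ge0 A : (0 <= lebesgue_rV_step A)%E.
Proof. exact: measure_ge0. Qed.

Let step_sigma_additive : semi_sigma_additive lebesgue_rV_step.
Proof. exact: measure_semi_sigma_additive. Qed.

HB.instance Definition _ := isMeasure.Build _ _ _ lebesgue_rV_step
  step0 step_ge0 step_sigma_additive.
End step.

Fixpoint lebesgue_rV (n : nat) : {measure set 'rV[R]_n -> \bar R} :=
  match n with
  | 0%N => [the measure _ _ of @dirac _ 'rV[R]_0 0 R]
  | n'.+1 => [the measure _ _ of lebesgue_rV_step (lebesgue_rV n')]
  end.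

Lemma lebesgue_rV_box n (A : 'I_n -> set R) :
  (forall i, measurable (A i)) ->
  lebesgue_rV n [set x | forall i, A i (x ord0 i)] =
  (\prod_(i < n) lebesgue_measure (A i))%E.
Proof.
elim: n A => [|n ih] A mA.
  by rewrite big_ord0 /= diracE mem_set// => -[].
rewrite big_ord_recl -ih; last by move=> i; exact: mA.
have mB : measurable [set x : 'rV[R]_n | forall i, A (lift ord0 i) (x ord0 i)].
  rewrite [X in measurable X](_ : _ = \bigcap_(i in [set: 'I_n])
    ((fun x : 'rV[R]_n => x ord0 i) @^-1` A (lift ord0 i))); last first.
    by apply/seteqP; split=> x /= Ax i; [move=> _|]; exact: Ax.
  apply: fin_bigcap_measurable => // i _.
  by rewrite -[X in measurable X]setTI; exact: measurable_coord.
rewrite /= /lebesgue_rV_step /pushforward -product_measure2E//; last exact: (mA ord0).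
congr (product_measure2 _ _ _); apply/seteqP; split=> -[t x] /=.
  move=> Ax; split; first by have := Ax ord0; rewrite mxE unlift_none.
  by move=> i; have := Ax (lift ord0 i); rewrite mxE liftK.
by move=> [At Ax] i; rewrite mxE; case: unliftP => [j ->|->]//; exact: Ax.
Qed.

End lebesgue_rV.

Section euclidean.
Context {R : realType} {N : nat}.
Implicit Types (x y : 'rV[R]_N) (f : 'rV[R]_N -> R).

(* The library norm on 'rV[R]_N is the sup norm. *)
Definition dot x y : R := \sum_(i < N) x ord0 i * y ord0 i.
Definition enorm x : R := Num.sqrt (dot x x).

Definition grad f x : 'rV[R]_N := \row_(i < N) 'D_(delta_mx ord0 i) f x.

Fixpoint Ck (k : nat) f : Prop :=
  match k with
  | 0%N => continuous f
  | k'.+1 => (forall x, differentiable f x) /\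
             (forall i : 'I_N, Ck k' ('D_(delta_mx ord0 i) f))
  end.

Definition smooth f : Prop := forall k, Ck k f.

Definition test_function (Omega : set 'rV[R]_N) f : Prop :=
  let K := closure [set x | f x != 0] in
  [/\ smooth f, compact K & K `<=` Omega].

End euclidean.

(* Near each boundary point, up to relabelling and reflecting the axes, the
   open set [Omega] is the region above the graph of a smooth function [g] of
   the remaining coordinates. *)
Definition smooth_boundary (R : realType) (N : nat) (Omega : set 'rV[R]_N) :=
  forall x0, (closure Omega `\` Omega) x0 ->
    exists (i : 'I_N) (s : bool) (g : 'rV[R]_N.-1 -> R) (r : R),
      [/\ smooth g, 0 < r &
        forall x, ball x0 r x ->
          (Omega x <-> g (col' i x) < (-1) ^+ s * x ord0 i)].

Definition smooth_bounded_domain (R : realType) (N : nat)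
    (Omega : set 'rV[R]_N) :=
  [/\ open Omega, connected Omega, Omega !=set0, bounded_set Omega &
      smooth_boundary Omega].

(* Functions on [Omega] are represented by total functions on R^N, of which
   only the values on [Omega] (on its closure, for exponents) matter. *)

Section variable_exponent.
Context {R : realType} {N : nat}.
Variable Omega : set 'rV[R]_N.
Implicit Types (h p m q u v : 'rV[R]_N -> R) (G H : 'rV[R]_N -> 'rV[R]_N).
Local Open Scope ereal_scope.

Local Notation leb := (lebesgue_rV N).

Definition exponent h : Prop :=
  {within closure Omega, continuous h} /\
  (forall x, closure Omega x -> (1 < h x)%R).

Definition exp_sup h : R := sup [set h x | x in Omega].
Definition exp_inf h : R := inf [set h x | x in Omega].

Definition modular h u : \bar R :=
  \int[leb]_(x in Omega) (`|u x| `^ h x)%:E.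

Definition Lvar h u : Prop := measurable_fun Omega u /\ modular h u < +oo.

(* [+oo] when no [mu] is admissible. *)
Definition luxemburg h u : \bar R :=
  ereal_inf [set mu%:E | mu in
    [set mu : R | (0 < mu)%R /\ modular h (fun x => u x / mu)%R <= 1]].

(* Completion of the test functions for the norm [luxemburg h |grad f|],
   realized as a space of functions: by Poincare's inequality a sequence of
   test functions that is Cauchy for this norm converges in L^h to some [u],
   while its gradients converge in L^h to some [G].  [W01 h u G] says that [u]
   is the element obtained in this way and that [G], which is determined by [u]
   almost everywhere (it is its weak gradient), is the gradient of [u]. *)
Definition W01 h u G : Prop :=
  [/\ Lvar h u, measurable_fun Omega G, Lvar h (fun x => enorm (G x)) &
    exists f : ('rV[R]_N -> R)^nat,
      [/\ forall n, test_function Omega (f n),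
          luxemburg h (fun x => f n x - u x)%R @[n --> \oo] --> 0 &
          luxemburg h (fun x => enorm (grad (f n) x - G x)) @[n --> \oo] --> 0]].

(* The integrals are extended-real valued.  As [lambda != 0] wherever this is
   used, their combination can only be equal to [0] if all three integrands are
   integrable. *)
Definition weak_eq p1 p2 m q (lambda : R) u G v H : Prop :=
  \int[leb]_(x in Omega)
     ((enorm (G x) `^ (p1 x - 2) + enorm (G x) `^ (p2 x - 2))
        * dot (G x) (H x))%:E
  - lambda%:E * \int[leb]_(x in Omega) (`|u x| `^ (m x - 2) * u x * v x)%:E
  + \int[leb]_(x in Omega) (`|u x| `^ (q x - 2) * u x * v x)%:E = 0.

Definition weak_solution p1 p2 q (lambda : R) u : Prop :=
  let m x := Num.max (p1 x) (p2 x) in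
  exists2 G, W01 m u G &
    forall v H, W01 m v H -> weak_eq p1 p2 m q lambda u G v H.

Definition nontrivial u : Prop := ~ {ae leb, forall x, Omega x -> u x = 0%R}.

End variable_exponent.

Definition sobolev_conj (R : realType) (N : nat) (s : R) : \bar R :=
  if s < N%:R then (N%:R * s / (N%:R - s))%:E else +oo%E.

(* Main.v *)
(* Weak solutions are critical points of
     J(u) = int |grad u|^p1 / p1 + |grad u|^p2 / p2 - lambda |u|^m / m + |u|^q / q.
   Choose M with lambda <= M^(q - m).  The potential increases beyond M in
   absolute value, so truncation at level M does not increase J, and J may be
   minimized over the test functions bounded by M; truncations, maxima and minima
   are smoothed by means of sqrt(t^2 + e^2), so that they remain test functions.
   Compactness comes from order instead of the Rellich theorem: max(f, g) and
   min(f, g) together have the same energy as f and g, so that they are almost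
   minimal if f and g are.  Hence, for a minimizing sequence (z_n) along which
   int z_n is asymptotically as large as possible,
     int |z_n - z_k| = 2 int max(z_n, z_k) - int z_n - int z_k -> 0,
   and then the gradients are Cauchy for the modular of m by uniform convexity.
   The Euler-Lagrange equation for the limit (w, G) follows by differentiating J
   along test functions, and by density for all directions.  For lambda large, J is
   negative at a bump function, so that w is not zero. *)
Require Import Defs.
From HB Require Import structures.
From mathcomp Require Import all_boot all_order all_algebra.
From mathcomp Require Import all_classical all_reals all_analysis.
From mathcomp Require Import measurable_realfun ring lra.

Set Implicit Arguments.
Unset Strict Implicit.
Unset Printing Implicit Defensive.
Import Order.TTheory GRing.Theory Num.Theory.
Import numFieldNormedType.Exports.

Local Open Scope classical_set_scope.
Local Open Scope ring_scope.

(** * Pointwise inequalities *)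

(** The term in -lambda is concave, so that convexity alone does not make a minimizing sequence
    converge. On [-M, M], however, the potential is Lipschitz and hence controlled by the L^1
    distance: once the sequence is Cauchy in L^1, only the convex gradient part is left. The
    extremal choice of the integrals serves this purpose. The supremum of int f over the almost
    minimizers decreases to a limit as the tolerance shrinks, and the maximum of two members of the
    sequence, again almost minimal, cannot exceed that limit by much. The constraint |f| <= M does
    not disturb the Euler-Lagrange equation: as truncation is nearly free, the infimum under the
    constraint bounds J on all test functions, and w may be varied in every direction. All exponents
    lie in one interval [p0, P] with p0 > 1. The pointwise inequalities have constants depending on
    the exponent only through p0 and P, and can therefore be integrated. Convergence is measured by
    modulars and translated into Luxemburg norms at the end. The variational part concerns an
    abstract class of pairs (function, gradient) on a set of finite measure. *)

Section euclidean_norm.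
Context {R : realType} {N : nat}.
Implicit Types (x y z : 'rV[R]_N) (a b : R).

Lemma dotC x y : dot x y = dot y x.
Proof. by apply: eq_bigr => i _; rewrite mulrC. Qed.

Lemma dotDl x y z : dot (x + y) z = dot x z + dot y z.
Proof. by rewrite /dot -big_split; apply: eq_bigr => i _ /=; rewrite mxE mulrDl. Qed.

Lemma dotDr x y z : dot x (y + z) = dot x y + dot x z.
Proof. by rewrite dotC dotDl !(dotC x). Qed.

Lemma dotZl a x y : dot (a *: x) y = a * dot x y.
Proof. by rewrite /dot mulr_sumr; apply: eq_bigr => i _; rewrite mxE mulrA. Qed.

Lemma dotZr a x y : dot x (a *: y) = a * dot x y.
Proof. by rewrite dotC dotZl dotC. Qed.

Lemma dotNl x y : dot (- x) y = - dot x y.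
Proof. by rewrite -scaleN1r dotZl mulN1r. Qed.

Lemma dotNr x y : dot x (- y) = - dot x y.
Proof. by rewrite dotC dotNl dotC. Qed.

Lemma dot0l y : dot 0 y = 0.
Proof. by rewrite -(scale0r y) dotZl mul0r. Qed.

Lemma dot_ge0 x : 0 <= dot x x.
Proof. by apply: sumr_ge0 => i _; rewrite -expr2 sqr_ge0. Qed.

Lemma enorm_ge0 x : 0 <= enorm x.
Proof. exact: sqrtr_ge0. Qed.

Lemma sqr_enorm x : enorm x ^+ 2 = dot x x.
Proof. by rewrite sqr_sqrtr // dot_ge0. Qed.

Lemma enorm0 : enorm (0 : 'rV[R]_N) = 0.
Proof. by rewrite /enorm dot0l sqrtr0. Qed.

Lemma enormZ a x : enorm (a *: x) = `|a| * enorm x.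
Proof. by rewrite /enorm dotZl dotZr mulrA -expr2 sqrtrM ?sqr_ge0// sqrtr_sqr. Qed.

Lemma enormN x : enorm (- x) = enorm x.
Proof. by rewrite -scaleN1r enormZ normrN1 mul1r. Qed.

Lemma enormB x y : enorm (x - y) = enorm (y - x).
Proof. by rewrite -enormN opprB. Qed.

Lemma ler_norm_enorm x i : `|x ord0 i| <= enorm x.
Proof.
rewrite -sqrtr_sqr ler_sqrt ?dot_ge0// /dot (bigD1 i)//= -expr2 lerDl.
by apply: sumr_ge0 => j _; rewrite -expr2 sqr_ge0.
Qed.

Lemma enorm_eq0 x : (enorm x == 0) = (x == 0).
Proof.
apply/eqP/eqP => [x0|->]; last exact: enorm0.
apply/rowP => i; rewrite mxE; apply/eqP; rewrite -normr_le0 -x0.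
exact: ler_norm_enorm.
Qed.

Lemma dot_le_enorm x y : dot x y <= enorm x * enorm y.
Proof.
have [->|y0] := eqVneq y 0; first by rewrite dotC dot0l enorm0 mulr0.
have C0 : 0 < enorm y by rewrite lt_def enorm_eq0 y0 enorm_ge0.
have : 0 <= enorm y ^+ 2 * ((enorm x * enorm y) ^+ 2 - dot x y ^+ 2).
  have := dot_ge0 (enorm y ^+ 2 *: x - dot x y *: y).
  rewrite dotDl !dotDr !(dotNl, dotNr, dotZl, dotZr) (dotC y x) -!sqr_enorm.
  by move/le_trans; apply; rewrite le_eqVlt; apply/orP; left; apply/eqP; ring.
rewrite pmulr_rge0 ?exprn_gt0// subr_ge0 -[_ ^+ 2]real_normK ?num_real// => h.
apply: le_trans (ler_norm _) _.
by rewrite -(@ler_pXn2r _ 2) ?nnegrE ?mulr_ge0 ?enorm_ge0.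
Qed.

Lemma norm_dot_le x y : `|dot x y| <= enorm x * enorm y.
Proof.
by rewrite ler_norml dot_le_enorm andbT lerNl -dotNl -(enormN x) dot_le_enorm.
Qed.

Lemma sqr_enormD x y :
  enorm (x + y) ^+ 2 = enorm x ^+ 2 + 2 * dot x y + enorm y ^+ 2.
Proof. by rewrite !sqr_enorm dotDl !dotDr (dotC y x); ring. Qed.

Lemma enormD x y : enorm (x + y) <= enorm x + enorm y.
Proof.
rewrite -(@ler_pXn2r _ 2) ?nnegrE ?addr_ge0 ?enorm_ge0// sqr_enormD.
have := dot_le_enorm x y; nra.
Qed.

Lemma enorm_le_sum x : enorm x <= \sum_(i < N) `|x ord0 i|.
Proof.
have s0 : 0 <= \sum_(i < N) `|x ord0 i| by apply: sumr_ge0.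
rewrite -(@ler_pXn2r _ 2) ?nnegrE ?enorm_ge0// sqr_enorm expr2 mulr_suml.
apply: ler_sum => i _; rewrite (le_trans (ler_norm _))// normrM ler_wpM2l//.
by rewrite (bigD1 i)//= lerDl sumr_ge0.
Qed.

(** This ties the norm of the midpoint to that of the difference. Together with the triangle
    inequality it is all that the scalar form of uniform convexity knows about vectors. *)
Lemma parallelogram x y :
  enorm (2^-1 *: (x + y)) ^+ 2 + (enorm (x - y) / 2) ^+ 2
  = (enorm x ^+ 2 + enorm y ^+ 2) / 2.
Proof.
rewrite enormZ ger0_norm ?invr_ge0// !exprMn exprVn !sqr_enormD enormN dotNr.
by field.
Qed.

End euclidean_norm.

(** * Scalar inequalities for powers, uniform in the exponent *)

Section power_inequalities.
Context {R : realType}.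
Implicit Types (x y p P t r u : R).

Lemma powR1l x : 1 `^ x = 1 :> R.
Proof. by rewrite powR1. Qed.

(** Young's inequality for x and [y ^ (p - 1)] with the conjugate exponents p and p / (p - 1),
    rearranged. It includes y = 0, and the convexity statements below derive from it. *)
Lemma powR_tangent p x y : 1 < p -> 0 <= x -> 0 <= y ->
  y `^ p + p * y `^ (p - 1) * (x - y) <= x `^ p.
Proof.
move=> p1 x0 y0; have p0 : 0 < p by lra.
have r0 : 0 < p - 1 by lra.
have := @conjugate_powR R x (y `^ (p - 1)) p (p / (p - 1)) x0 (powR_ge0 _ _) p0.
rewrite divr_gt0// => /(_ isT).
have -> : p^-1 + (p / (p - 1))^-1 = 1 by field; rewrite gt_eqF//= gt_eqF.
move=> /(_ erefl); rewrite -powRrM (mulrC (p - 1)) divfK ?gt_eqF//.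
rewrite -(ler_pM2l p0) => h.
have e := mulr_powRB1 y0 p0.
have E : p * (x `^ p / p + y `^ p / (p / (p - 1))) = x `^ p + (p - 1) * y `^ p.
  by field; rewrite gt_eqF//= gt_eqF.
rewrite [X in _ <= X]E in h; rewrite -e in h *; lra.
Qed.

(** After division by p the tangent at |x| has slope at most [A ^ (p - 1)]; since 1 <= A, the
    exponent may be raised to make the constant independent of p. *)
Lemma powR_norm_lipschitz p P A x y : 1 < p <= P -> 1 <= A ->
  `|x| <= A -> `|y| <= A ->
  `|x| `^ p / p - `|y| `^ p / p <= A `^ (P - 1) * `|x - y|.
Proof.
move=> /andP[p1 pP] A1 xA yA; have p0 : 0 < p by lra.
have := @powR_tangent p `|y| `|x| p1 (normr_ge0 _) (normr_ge0 _) => h.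
have xy : `|x| - `|y| <= `|x - y| by exact: lerB_dist.
have b : `|x| `^ (p - 1) <= A `^ (P - 1).
  apply: le_trans (_ : A `^ (p - 1) <= _); last by rewrite ler_powR// lerD2r.
  by rewrite ge0_ler_powR ?nnegrE//; lra.
have b0 := powR_ge0 `|x| (p - 1).
rewrite -mulrBl ler_pdivrMr//.
have h2 : `|x| `^ (p - 1) * (`|x| - `|y|) <= A `^ (P - 1) * `|x - y|.
  apply: le_trans (_ : `|x| `^ (p - 1) * `|x - y| <= _).
    by rewrite ler_wpM2l.
  by rewrite ler_wpM2r.
have := ler_wpM2l (ltW p0) h2; lra.
Qed.

Lemma powR_bernoulli r u : 1 <= r -> 1 <= u -> 1 + r * (u - 1) <= u `^ r.
Proof.
rewrite le_eqVlt => /predU1P[<-|r1] u1; first by rewrite powRr1; lra.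
have := @powR_tangent r u 1 r1; rewrite !powR1; lra.
Qed.

(** With t = r M, Bernoulli's inequality for r^m and the exponent q / m gives (r^m - 1) / m <= (r^q
    - 1) / q. Combined with lam M^m <= M^q, this compares the increments of the two terms between M
    and t. *)
Lemma energy_increasing (m q lam M t : R) : 0 < m -> m <= q -> 1 <= M ->
  lam <= M `^ (q - m) -> M <= t ->
  - lam * (M `^ m / m) + M `^ q / q <= - lam * (t `^ m / m) + t `^ q / q.
Proof.
move=> m0 mq M1 lM Mt.
have q0 : 0 < q by lra.
have M0 : 0 < M by lra.
have [r r1 ->] : exists2 r, 1 <= r & t = r * M.
  by exists (t / M); rewrite ?divfK ?gt_eqF// ler_pdivlMr// mul1r.
rewrite !powRM; try lra.
have y1 : 1 <= r `^ m by rewrite -(powRr0 r) ler_powR; lra.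
have := @powR_bernoulli (q / m) (r `^ m); rewrite -powRrM (mulrC m) divfK ?gt_eqF//.
rewrite ler_pdivlMr// mul1r mq => /(_ isT y1) h.
have Mm := powR_gt0 m M0.
have MqE : M `^ q = M `^ (q - m) * M `^ m.
  by rewrite -powRD ?subrK// gt_eqF ?implybT.
have h1 : (r `^ m - 1) / m <= (r `^ q - 1) / q.
  have h' : (1 + q / m * (r `^ m - 1)) * m <= r `^ q * m by rewrite ler_wpM2r// ltW.
  have E : (1 + (q / m) * (r `^ m - 1)) * m = m + q * (r `^ m - 1).
    by field; rewrite gt_eqF.
  rewrite E in h'.
  by rewrite ler_pdivrMr// mulrAC ler_pdivlMr//; lra.
have h0 : 0 <= (r `^ m - 1) / m by rewrite divr_ge0; lra.
have h2 : lam * M `^ m <= M `^ q by rewrite MqE ler_wpM2r// powR_ge0.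
have h3 : lam * M `^ m * ((r `^ m - 1) / m) <= M `^ q * ((r `^ q - 1) / q).
  apply: le_trans (_ : M `^ q * ((r `^ m - 1) / m) <= _).
    by rewrite ler_wpM2r.
  by rewrite ler_wpM2l// powR_ge0.
have -> : - lam * (r `^ m * M `^ m / m) + r `^ q * M `^ q / q =
  - lam * (M `^ m / m) + M `^ q / q +
  (M `^ q * ((r `^ q - 1) / q) - lam * M `^ m * ((r `^ m - 1) / m)).
  by field; rewrite !gt_eqF.
by rewrite lerDl subr_ge0.
Qed.

(** A weighted Young inequality, obtained by comparing e with s A, which keeps the constants uniform
    in p. It makes the gradient part of the weak equation small for directions of small modular. *)
Lemma powR_mul_small (p P A e s : R) : 1 <= p <= P -> 0 <= A -> 0 <= e ->
  0 < s <= 1 -> A `^ (p - 1) * e <= s * A `^ p + s `^ (1 - P) * e `^ p.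
Proof.
move=> /andP[p1 pP] A0 e0 /andP[s0 s1].
have p0 : 0 < p by lra.
have [h|h] := leP e (s * A).
  apply: (@le_trans _ _ (s * A `^ p)); last first.
    by rewrite lerDl mulr_ge0// powR_ge0.
  rewrite -(mulr_powRB1 A0 p0) mulrA mulrC ler_wpM2r// powR_ge0//.
apply: (@le_trans _ _ (s `^ (1 - P) * e `^ p)); last first.
  by rewrite lerDr mulr_ge0 ?powR_ge0//; lra.
have e1 : A <= e / s by rewrite ler_pdivlMr// mulrC ltW.
apply: (@le_trans _ _ ((e / s) `^ (p - 1) * e)).
  by rewrite ler_wpM2r// ge0_ler_powR ?nnegrE ?divr_ge0; lra.
rewrite powRM ?invr_ge0; try lra.
rewrite mulrAC (mulrC _ e) mulr_powRB1// mulrC ler_wpM2r ?powR_ge0//.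
rewrite -powR_inv1; last lra.
rewrite -powRrM ger_powR ?s0//; lra.
Qed.

(** Up to s the power is at most s; beyond it, t = s u with 1 <= u, and the exponent may be raised
    to m at the cost of [s ^ (- m)]. In this way smallness of the modular of m passes to lower
    exponents. *)
Lemma powR_small (p m P s t : R) : 1 <= p -> p <= m <= P -> 0 < s <= 1 -> 0 <= t ->
  t `^ p <= s + s `^ (- P) * t `^ m.
Proof.
move=> p1 /andP[pm mP] /andP[s0 s1] t0.
have h0 : 0 <= s `^ (- P) * t `^ m by rewrite mulr_ge0 ?powR_ge0.
have [ts|st] := leP t s.
  apply: (@le_trans _ _ s); last by rewrite lerDl.
  apply: (@le_trans _ _ (s `^ p)); first by rewrite ge0_ler_powR ?nnegrE; lra.
  by rewrite ge1r_powR// s0.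
apply: (@le_trans _ _ (s `^ (- P) * t `^ m)); last by rewrite lerDr ltW.
have [u u1 ->] : exists2 u, 1 <= u & t = s * u.
  by exists (t / s); rewrite ?(mulrC s) ?divfK ?gt_eqF// ler_pdivlMr// mul1r ltW.
rewrite !powRM; [|lra|lra|lra|lra].
apply: (@le_trans _ _ (u `^ m)).
  apply: (@le_trans _ _ (u `^ p)); last by rewrite ler_powR.
  by rewrite ler_piMl ?powR_ge0// -[leRHS](powRr0 s) ger_powR ?s0//; lra.
rewrite mulrA -powRD; last by rewrite (gt_eqF s0) implybT.
rewrite ler_peMl ?powR_ge0// -[leLHS](powRr0 s) ger_powR ?s0//; lra.
Qed.

Lemma powRD_le (c t m P : R) : 1 <= c -> 0 <= t -> 1 <= m <= P ->
  (c + t) `^ m <= (2 * c) `^ P * (1 + t `^ m).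
Proof.
move=> c1 t0 /andP[m1 mP].
have cP : (2 * c) `^ m <= (2 * c) `^ P by rewrite ler_powR//; lra.
have tm := powR_ge0 t m.
have [t1|t1] := leP t 1.
  apply: (@le_trans _ _ ((2 * c) `^ m)).
    by rewrite ge0_ler_powR ?nnegrE; lra.
  by apply: le_trans cP _; rewrite ler_peMr ?powR_ge0// lerDl.
apply: (@le_trans _ _ ((2 * c * t) `^ m)).
  have tc : 1 * t <= c * t by rewrite ler_wpM2r.
  have ct : c * 1 <= c * t by rewrite ler_wpM2l//; lra.
  by rewrite ge0_ler_powR ?nnegrE; lra.
rewrite powRM; [|lra|lra].
apply: ler_pM; rewrite ?powR_ge0//; lra.
Qed.

Lemma powR_norm_tangent (p x y : R) : 1 < p ->
  `|x| `^ p + p * (`|x| `^ (p - 2) * x * (y - x)) <= `|y| `^ p.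
Proof.
move=> p1; apply: le_trans (powR_tangent p1 (normr_ge0 y) (normr_ge0 x)).
rewrite lerD2l -[leRHS]mulrA ler_pM2l; last lra.
(* At 0 the factor x annihilates [|x| ^ (p - 2)], whatever value that power has there. *)
have [->|x0] := eqVneq x 0.
  by rewrite mulr0 mul0r mulr_ge0 ?powR_ge0// normr0 subr0.
have -> : `|x| `^ (p - 1) = `|x| `^ (p - 2) * `|x|.
  rewrite -[X in _ * X]powRr1// -powRD; last by rewrite normr_eq0 x0 implybT.
  by congr (_ `^ _); ring.
rewrite -!mulrA ler_wpM2l ?powR_ge0// !mulrBr -!expr2 real_normK ?num_real//.
by rewrite lerD2r -normrM ler_norm.
Qed.

Lemma norm_powR_mul_le (p P A x : R) : 1 < p <= P -> 1 <= A -> `|x| <= A ->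
  `| `|x| `^ (p - 2) * x | <= A `^ (P - 1).
Proof.
move=> /andP[p1 pP] A1 xA; rewrite normrM (ger0_norm (powR_ge0 _ _)).
have [->|x0] := eqVneq x 0; first by rewrite normr0 mulr0 powR_ge0.
rewrite -[X in _ * X]powRr1// -powRD; last by rewrite normr_eq0 x0 implybT.
apply: (@le_trans _ _ (A `^ (p - 1))); last by rewrite ler_powR//; lra.
rewrite (_ : p - 2 + 1 = p - 1); last by ring.
by rewrite ge0_ler_powR ?nnegrE ?normr_ge0//; lra.
Qed.

(** Factor out X^p, which is at least X^P because X <= 1; and (Y / X)^p <= Y / X because 1 <= p. *)
Lemma powR_gap (X Y p P : R) : 0 <= Y -> Y < X -> X <= 1 -> 1 <= p <= P ->
  X `^ P * (1 - Y / X) <= X `^ p - Y `^ p.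
Proof.
move=> Y0 YX X1 /andP[p1 pP]; have X0 : 0 < X by lra.
have -> : X `^ p - Y `^ p = X `^ p * (1 - (Y / X) `^ p).
  have e : Y `^ p = X `^ p * (Y / X) `^ p.
    by rewrite -powRM ?divr_ge0 ?(ltW X0)// (mulrC X) divfK ?gt_eqF.
  by rewrite mulrBr mulr1 -e.
have YX1 : Y / X <= 1 by rewrite ler_pdivrMr// mul1r ltW.
apply: ler_pM; rewrite ?powR_ge0 ?subr_ge0//.
  by rewrite ger_powR// X0.
rewrite lerD2l lerN2; have [->|Yn0] := eqVneq Y 0.
  by rewrite mul0r powR0//; lra.
by rewrite ge1r_powR// YX1 divr_gt0// lt_def Yn0.
Qed.


(** The tangent at the midpoint, evaluated at a and at b, has opposite linear terms. *)
Lemma powR_midpoint p a b : 1 < p -> 0 <= a -> 0 <= b ->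
  ((a + b) / 2) `^ p <= (a `^ p + b `^ p) / 2.
Proof.
move=> p1 a0 b0; have c0 : 0 <= (a + b) / 2 by lra.
have := powR_tangent p1 a0 c0; have := powR_tangent p1 b0 c0.
set c := (a + b) / 2; have -> : a - c = - (b - c) by rewrite /c; lra.
set k := p * _; lra.
Qed.

(* The tangent inequality is applied twice, at 1 and at the intermediate point
   [1 + x0 / 2], to gain a definite amount over Bernoulli's inequality. *)
Lemma powR_bernoulli_gap p0 p x0 u : 1 < p0 <= p -> 0 <= x0 -> 1 + x0 <= u ->
  x0 / 2 * ((1 + x0 / 2) `^ (p0 - 1) - 1) <= u `^ p - 1 - p * (u - 1).
Proof.
move=> /andP[p01 p0p] x00 xu; have p1 : 1 < p by lra.
pose v := (1 + u) / 2; have v1 : 1 <= v by rewrite /v; lra.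
have h1 := @powR_tangent p u v p1 ltac:(lra) ltac:(lra).
have h2 := @powR_bernoulli p v (ltW p1) v1.
have h3 : (1 + x0 / 2) `^ (p0 - 1) <= v `^ (p - 1).
  apply: (@le_trans _ _ (v `^ (p0 - 1))).
    by rewrite ge0_ler_powR ?nnegrE /v; lra.
  by rewrite ler_powR//; lra.
have h4 : 1 <= (1 + x0 / 2) `^ (p0 - 1).
  by rewrite -[leLHS](powRr0 (1 + x0 / 2)) ler_powR; lra.
have uv : u - v = (u - 1) / 2 by rewrite /v; lra.
have vu : v - 1 = (u - 1) / 2 by rewrite /v; lra.
rewrite uv in h1; rewrite vu in h2.
have h5 : x0 / 2 * ((1 + x0 / 2) `^ (p0 - 1) - 1) <=
  p * ((u - 1) / 2) * (v `^ (p - 1) - 1).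
  apply: ler_pM; try lra.
  have : 1 * (u - 1) <= p * (u - 1) by rewrite ler_wpM2r; lra.
  lra.
have -> : u `^ p - 1 - p * (u - 1) =
  p * ((u - 1) / 2) * (v `^ (p - 1) - 1)
  + (u `^ p - (v `^ p + p * v `^ (p - 1) * ((u - 1) / 2)))
  + (v `^ p - (1 + p * ((u - 1) / 2))) by field.
lra.
Qed.

(** Scaling by c carries the excess at 1 / c over the tangent at 1 into the excess at 1 over the
    tangent at c. The gap of [powR_bernoulli_gap] thus becomes available at base points c < 1. *)
Lemma powR_bregman_homogeneous (c p : R) : 0 < c -> 0 < p ->
  c `^ p * (c^-1 `^ p - 1 - p * (c^-1 - 1)) = 1 - c `^ p - p * c `^ (p - 1) * (1 - c).
Proof.
move=> c0 p0; have ec := mulr_powRB1 (ltW c0) p0.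
have eV : c `^ p * c^-1 `^ p = 1.
  by rewrite -powRM ?invr_ge0 ?ltW// mulfV ?gt_eqF// powR1l.
rewrite 2!mulrBr eV mulr1 mulrCA mulrBr mulr1 -{2}ec mulrAC mulfV ?gt_eqF// mul1r.
by rewrite -ec; ring.
Qed.

(** Strict convexity of the power, for norms 1 and b that differ. The tangent at c = (1 + b) / 2 is
    used plainly at b and with a gap at 1. The gap comes from 1 / c >= 1 + x0, which holds because
    (1 + x0) (1 - x0) <= 1. *)
Lemma midpoint_gap_far (p0 p P x0 b s : R) : 1 < p0 <= p -> p <= P -> 0 <= x0 ->
  0 <= b -> b <= 1 - 2 * x0 -> 0 <= s <= (1 + b) / 2 ->
  2^-1 `^ P * (x0 / 2 * ((1 + x0 / 2) `^ (p0 - 1) - 1)) / 2 <=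
  (1 + b `^ p) / 2 - s `^ p.
Proof.
move=> /andP[p01 p0p] pP x00 b0 bx /andP[s0 sb]; have p1 : 1 < p by lra.
have [c cE] : exists c, c = (1 + b) / 2 by exists ((1 + b) / 2).
have c0 : 2^-1 <= c by lra.
have sc : s `^ p <= c `^ p by rewrite ge0_ler_powR ?nnegrE; lra.
have tb := @powR_tangent p b c p1 b0 ltac:(lra).
have bc : b - c = - (1 - c) by lra.
rewrite bc in tb.
have cV : 1 + x0 <= c^-1.
  rewrite -[leRHS]mul1r ler_pdivlMr; last lra.
  have h1 : 1 + b <= 2 * (1 - x0) by lra.
  have := ler_wpM2l (addr_ge0 ler01 x00) h1; have := sqr_ge0 x0; rewrite cE expr2; lra.
have := @powR_bernoulli_gap p0 p x0 c^-1.
rewrite p01 p0p => /(_ isT x00 cV) KL.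
have cP : 2^-1 `^ P <= c `^ p.
  apply: (@le_trans _ _ (2^-1 `^ p)); first by rewrite ger_powR//; lra.
  by rewrite ge0_ler_powR ?nnegrE; lra.
have K0 : 0 <= x0 / 2 * ((1 + x0 / 2) `^ (p0 - 1) - 1).
  apply: mulr_ge0; first lra.
  by rewrite subr_ge0 -[leLHS](powRr0 (1 + x0 / 2)) ler_powR; lra.
have := ler_pM (powR_ge0 _ _) K0 cP KL.
rewrite powR_bregman_homogeneous; lra.
Qed.

(** The complementary case of nearly equal norms: strictness now comes from s, the norm of the
    midpoint, which stays below X. *)
Lemma midpoint_gap_near (p P X Y b s : R) : 1 <= p <= P -> 0 <= Y -> Y < X ->
  X <= b <= 1 -> 0 <= s <= Y ->
  X `^ P * (1 - Y / X) <= (1 + b `^ p) / 2 - s `^ p.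
Proof.
move=> pP Y0 YX /andP[Xb b1] /andP[s0 sY]; have /andP[p1 _] := pP.
have p0 : 0 <= p by lra.
have bp : X `^ p <= b `^ p by rewrite ge0_ler_powR ?nnegrE; lra.
have sp : s `^ p <= Y `^ p by rewrite ge0_ler_powR ?nnegrE.
have b1p : b `^ p <= 1 by rewrite -[leRHS](powR1l p) ge0_ler_powR ?nnegrE; lra.
apply: le_trans (powR_gap Y0 YX (le_trans Xb b1) pP) _; lra.
Qed.

(** Here 1 and b are the norms of two vectors, s bears on their midpoint and t on their difference.
    If t >= eps, then either b is far from 1 or the parallelogram identity makes s small. *)
Lemma unif_convex_scalar p0 P eps : 1 < p0 -> 0 < eps <= 1 ->
  exists2 d : R, 0 < d & forall p b s t, p0 <= p <= P ->
    0 <= b <= 1 -> 0 <= s <= (1 + b) / 2 -> eps <= t ->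
    s ^+ 2 + (t / 2) ^+ 2 = (1 + b ^+ 2) / 2 ->
    d <= (1 + b `^ p) / 2 - s `^ p.
Proof.
move=> p01 /andP[e0 e1].
(* [Y] will bound s, since b <= 1 and eps <= t give s^2 <= 1 - eps^2 / 4; [X], strictly between Y
   and 1, separates the two cases for b. *)
have [X [Y [YX X1 Y0 Y2]]] : exists X Y, [/\ Y < X, X < 1, 0 <= Y &
    Y ^+ 2 = 1 - eps ^+ 2 / 4].
  have e2 : eps ^+ 2 <= 1 by rewrite expr_le1 // ltW.
  have e20 : 0 < eps ^+ 2 by rewrite exprn_gt0.
  exists (Num.sqrt (1 - eps ^+ 2 / 8)), (Num.sqrt (1 - eps ^+ 2 / 4)).
  split; [| |exact: sqrtr_ge0|by rewrite sqr_sqrtr//; lra].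
    by rewrite ltr_sqrt; lra.
  by rewrite -[ltRHS]sqrtr1 ltr_sqrt//; lra.
pose x0 := (1 - X) / 2; have x00 : 0 < x0 by rewrite divr_gt0// subr_gt0.
pose d1 := 2^-1 `^ P * (x0 / 2 * ((1 + x0 / 2) `^ (p0 - 1) - 1)) / 2.
pose d2 := X `^ P * (1 - Y / X).
have X0 : 0 < X by exact: le_lt_trans YX.
have d20 : 0 < d2.
  by rewrite mulr_gt0 ?powR_gt0// subr_gt0 ltr_pdivrMr ?mul1r.
have x02 : 0 < x0 / 2 by rewrite divr_gt0.
have d10 : 0 < d1.
  rewrite divr_gt0// mulr_gt0 ?powR_gt0// mulr_gt0// subr_gt0.
  rewrite -[ltLHS](powR1l (p0 - 1)) gt0_ltr_powR ?nnegrE ?subr_gt0 ?ltrDl//.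
  by rewrite addr_ge0// ltW.
exists (Num.min d1 d2); first by rewrite lt_min d10.
move=> p b s t /andP[p0p pP] /andP[b0 b1] s0b et st.
have [bX|Xb] := leP b X.
  rewrite ge_min; apply/orP; left.
  apply: midpoint_gap_far => //; [by rewrite p01|exact: ltW|].
  by rewrite (_ : 1 - 2 * x0 = X)// /x0; field.
have /andP[s0 sb] := s0b.
rewrite ge_min; apply/orP; right; apply: midpoint_gap_near => //.
- by rewrite (le_trans (ltW p01)).
- by rewrite (ltW Xb).
rewrite s0 -(@ler_pXn2r _ 2) ?nnegrE// Y2.
have et2 : eps ^+ 2 <= t ^+ 2.
  by rewrite ler_pXn2r ?nnegrE//; [exact: ltW|exact: le_trans (ltW e0) et].
have b2 : b ^+ 2 <= 1 by rewrite expr_le1.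
clear - et2 b2 st; rewrite exprMn in st; lra.
Qed.

(** If t <= eps r, then t^p <= eps r^p. Otherwise division by r leads to the scalar case: the defect
    is at least d r^p, and t^p <= (2 r)^p is at most 2^P / d times that. *)
Lemma unif_convex_homogeneous p0 P eps : 1 < p0 -> 0 < eps <= 1 ->
  exists2 C : R, 0 <= C & forall p r b s t, p0 <= p <= P ->
    0 <= b <= r -> 0 <= s <= (r + b) / 2 -> 0 <= t <= r + b ->
    s ^+ 2 + (t / 2) ^+ 2 = (r ^+ 2 + b ^+ 2) / 2 ->
    t `^ p <= eps * (r `^ p + b `^ p) + C * ((r `^ p + b `^ p) / 2 - s `^ p).
Proof.
move=> p01 /andP[e0 e1].
have [d d0 hd] : exists2 d : R, 0 < d & forall p b s t, p0 <= p <= P ->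
    0 <= b <= 1 -> 0 <= s <= (1 + b) / 2 -> eps <= t ->
    s ^+ 2 + (t / 2) ^+ 2 = (1 + b ^+ 2) / 2 ->
    d <= (1 + b `^ p) / 2 - s `^ p.
  by apply: unif_convex_scalar => //; rewrite e0.
exists (2 `^ P / d) => [|p r b s t]; first by rewrite divr_ge0 ?powR_ge0 ?ltW.
move=> p0P /andP[b0 br] /andP[s0 sb] /andP[t0 tr] st.
have /andP[p0p pP] := p0P; have p1 : 1 < p by exact: lt_le_trans p0p.
have pge1 := ltW p1; have pge0 : 0 <= p by exact: le_trans pge1.
have r0 : 0 <= r by exact: le_trans br.
have D0 : s `^ p <= (r `^ p + b `^ p) / 2.
  apply: le_trans (powR_midpoint p1 r0 b0).
  by rewrite ge0_ler_powR ?nnegrE// divr_ge0// addr_ge0.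
have C0 : 0 <= 2 `^ P / d by rewrite divr_ge0 ?powR_ge0 ?ltW.
have [te|te] := leP t (eps * r).
  apply: (@le_trans _ _ (eps * (r `^ p + b `^ p))); last first.
    by rewrite lerDl mulr_ge0// subr_ge0.
  apply: (@le_trans _ _ ((eps * r) `^ p)).
    by rewrite ge0_ler_powR ?nnegrE ?mulr_ge0// ltW.
  rewrite powRM// ?(ltW e0)//.
  apply: (@le_trans _ _ (eps * r `^ p)).
    by rewrite ler_wpM2r ?powR_ge0// ge1r_powR// e0.
  by rewrite ler_wpM2l ?(ltW e0)// lerDl powR_ge0.
have rgt0 : 0 < r.
  rewrite lt_def r0 andbT; apply/negP => /eqP rz.
  have bz : b = 0 by apply/eqP; rewrite eq_le b0 andbT -rz.
  by move: te; rewrite rz mulr0 => /lt_le_trans/(_ tr); rewrite rz bz addr0 ltxx.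
have rr : r != 0 by rewrite gt_eqF.
have rp := powR_gt0 p rgt0.
have sc z : 0 <= z -> (z / r) `^ p = z `^ p / r `^ p.
  move=> z0; apply: (mulIf (lt0r_neq0 rp)); rewrite -powRM ?r0 ?divfK ?gt_eqF//.
  exact: divr_ge0.
have dD : d <= (1 + (b / r) `^ p) / 2 - (s / r) `^ p.
  apply: hd (t / r) p0P _ _ _ _.
  - by rewrite divr_ge0//= ler_pdivrMr// mul1r.
  - rewrite divr_ge0//= ler_pdivrMr// (_ : _ * r = (r + b) / 2)//.
    by field.
  - by rewrite ler_pdivlMr// ltW.
  - have -> : (s / r) ^+ 2 + (t / r / 2) ^+ 2 = (s ^+ 2 + (t / 2) ^+ 2) / r ^+ 2.
      by field.
    by rewrite st; field.
rewrite !sc// in dD.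
have dD' : d * r `^ p <= (r `^ p + b `^ p) / 2 - s `^ p.
  rewrite -(ler_pM2r rp) in dD; apply: le_trans dD _.
  by rewrite le_eqVlt; apply/orP; left; apply/eqP; field; rewrite gt_eqF.
apply: (@le_trans _ _ (2 `^ P / d * (d * r `^ p))); last first.
  apply: (@le_trans _ _ (2 `^ P / d * ((r `^ p + b `^ p) / 2 - s `^ p))).
    by rewrite ler_wpM2l.
  by rewrite lerDr mulr_ge0 ?addr_ge0 ?powR_ge0// ltW.
rewrite mulrA divfK ?gt_eqF//.
apply: (@le_trans _ _ ((2 * r) `^ p)).
  rewrite ge0_ler_powR ?nnegrE ?mulr_ge0//.
  by apply: le_trans tr _; rewrite mulr_natl mulr2n lerD2l.
by rewrite powRM// ler_wpM2r ?powR_ge0// ler_powR// ler1n.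
Qed.

End power_inequalities.

(** * Inequalities for powers of the Euclidean norm *)

Section power_of_norm.
Context {R : realType} {N : nat}.
Implicit Types (x y : 'rV[R]_N) (p : R).

Lemma enorm_midpoint_powR p x y : 1 < p ->
  enorm (2^-1 *: (x + y)) `^ p <= (enorm x `^ p + enorm y `^ p) / 2.
Proof.
move=> p1; apply: le_trans (powR_midpoint p1 (enorm_ge0 x) (enorm_ge0 y)).
rewrite ge0_ler_powR ?nnegrE ?enorm_ge0 ?divr_ge0 ?addr_ge0 ?enorm_ge0//; first lra.
by rewrite enormZ ger0_norm ?invr_ge0// mulrC ler_wpM2r ?invr_ge0// enormD.
Qed.

(** One constant serves all exponents in [p0, P], so that the inequality can be integrated with a
    variable exponent. In the application the first term is small because the energies are bounded,
    the second because the defect is small. *)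
Lemma enorm_unif_convex (p0 P eps : R) : 1 < p0 -> 0 < eps <= 1 ->
  exists2 C, 0 <= C & forall p x y, p0 <= p <= P ->
    enorm (x - y) `^ p <= eps * (enorm x `^ p + enorm y `^ p) +
      C * ((enorm x `^ p + enorm y `^ p) / 2 - enorm (2^-1 *: (x + y)) `^ p).
Proof.
move=> p01 e01; have [C C0 hC] := unif_convex_homogeneous P p01 e01.
exists C => // p x y p0P.
have main u v : enorm v <= enorm u ->
    enorm (u - v) `^ p <= eps * (enorm u `^ p + enorm v `^ p) +
      C * ((enorm u `^ p + enorm v `^ p) / 2 - enorm (2^-1 *: (u + v)) `^ p).
  move=> vu; apply: hC => //.
  - by rewrite enorm_ge0.
  - rewrite enorm_ge0 enormZ ger0_norm ?invr_ge0//= mulrC.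
    by rewrite ler_wpM2r ?invr_ge0// enormD.
  - by rewrite enorm_ge0/= -[in leRHS](enormN v) enormD.
  - exact: parallelogram.
have [/main//|/ltW/main h] := leP (enorm y) (enorm x).
by rewrite enormB (addrC (_ `^ _)) (addrC x).
Qed.

Lemma enorm_powR_tangent p x y : 1 < p ->
  enorm x `^ p + p * (enorm x `^ (p - 2) * dot x (y - x)) <= enorm y `^ p.
Proof.
move=> p1; apply: le_trans (powR_tangent p1 (enorm_ge0 y) (enorm_ge0 x)).
rewrite lerD2l -mulrA ler_pM2l; last lra.
have [->|x0] := eqVneq x 0.
  by rewrite dot0l mulr0 mulr_ge0 ?powR_ge0// enorm0 subr0 enorm_ge0.
have ex : enorm x != 0 by rewrite enorm_eq0.
have -> : enorm x `^ (p - 1) = enorm x `^ (p - 2) * enorm x.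
  rewrite -[X in _ * X]powRr1 ?enorm_ge0// -powRD; last by rewrite ex implybT.
  by congr (_ `^ _); ring.
rewrite -mulrA ler_wpM2l ?powR_ge0// dotDr dotNr -sqr_enorm.
by rewrite mulrBr -expr2 lerD2r dot_le_enorm.
Qed.

(* Convexity of [t `^ p] along [x + y = (1 - s) (x / (1 - s)) + s (y / s)]. *)
Lemma enormD_powR_le p P s x y : 1 < p <= P -> 0 < s < 1 ->
  enorm (x + y) `^ p <=
  (1 - s) `^ (1 - P) * enorm x `^ p + s `^ (1 - P) * enorm y `^ p.
Proof.
move=> /andP[p1 pP] /andP[s0 s1].
have x0 := enorm_ge0 x; have y0 := enorm_ge0 y.
have xp0 := powR_ge0 (enorm x) p; have yp0 := powR_ge0 (enorm y) p.
apply: (@le_trans _ _ ((enorm x + enorm y) `^ p)).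
  by rewrite ge0_ler_powR ?nnegrE ?enorm_ge0 ?addr_ge0 ?enormD//; lra.
have [t01 t0] : 0 < 1 - s <= 1 /\ 0 < 1 - s by split; [apply/andP; split|]; lra.
pose a := enorm x / (1 - s); pose b := enorm y / s.
have a0 : 0 <= a by rewrite divr_ge0// ltW.
have b0 : 0 <= b by rewrite divr_ge0// ltW.
have ax : enorm x = (1 - s) * a by rewrite mulrC divfK ?gt_eqF.
have by_ : enorm y = s * b by rewrite mulrC divfK ?gt_eqF.
have key z u : 0 < u <= 1 -> 0 <= z -> u * z `^ p <= u `^ (1 - P) * (u * z) `^ p.
  move=> /andP[u0 u1] z0; rewrite powRM ?(ltW u0)// mulrA ler_wpM2r ?powR_ge0//.
  rewrite -powRD; last by rewrite (gt_eqF u0) implybT.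
  by rewrite ger1_powR ?u0//; lra.
apply: (@le_trans _ _ ((1 - s) * a `^ p + s * b `^ p)); last first.
  rewrite ax by_; apply: lerD; first exact: key.
  by apply: key => //; apply/andP; split; lra.
rewrite ax by_; set c := _ + _.
have c0 : 0 <= c by rewrite addr_ge0// mulr_ge0//; lra.
have h1 := powR_tangent p1 a0 c0; have h2 := powR_tangent p1 b0 c0.
have h1' := ler_wpM2l (ltW t0) h1; have h2' := ler_wpM2l (ltW s0) h2.
have e : (1 - s) * (c `^ p + p * c `^ (p - 1) * (a - c)) +
  s * (c `^ p + p * c `^ (p - 1) * (b - c)) = c `^ p by rewrite /c; ring.
by rewrite -[leLHS]e lerD.
Qed.

End power_of_norm.

(** * A smooth substitute for the absolute value *)

Section smoothed_absolute_value.
Context {R : realType}.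
Implicit Types e s t : R.

Definition smabs e t := Num.sqrt (t ^+ 2 + e ^+ 2).

Lemma smabs_sqr e t : smabs e t ^+ 2 = t ^+ 2 + e ^+ 2.
Proof. by rewrite sqr_sqrtr// addr_ge0// sqr_ge0. Qed.

Lemma smabs_ge0 e t : 0 <= smabs e t.
Proof. exact: sqrtr_ge0. Qed.

Lemma smabs_gt0 e t : 0 < e -> 0 < smabs e t.
Proof. by move=> e0; rewrite sqrtr_gt0 ltr_wpDl ?sqr_ge0// exprn_gt0. Qed.

Lemma smabs_ge e t : `|t| <= smabs e t.
Proof. by rewrite -sqrtr_sqr ler_sqrt ?addr_ge0 ?sqr_ge0// lerDl sqr_ge0. Qed.

Lemma smabs_ge_eps e t : e <= smabs e t.
Proof.
apply: le_trans (ler_norm e) _.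
by rewrite -sqrtr_sqr ler_sqrt ?addr_ge0 ?sqr_ge0// lerDr sqr_ge0.
Qed.

Lemma smabs_le e t : 0 <= e -> smabs e t <= `|t| + e.
Proof.
move=> e0; rewrite -(@ler_pXn2r _ 2) ?nnegrE ?smabs_ge0 ?addr_ge0// smabs_sqr.
by rewrite sqrrD real_normK ?num_real// lerD2r lerDl mulrn_wge0// mulr_ge0.
Qed.

Lemma smabs_lipschitz e s t : smabs e t <= smabs e s + `|t - s|.
Proof.
rewrite -(@ler_pXn2r _ 2) ?nnegrE ?addr_ge0 ?smabs_ge0//.
rewrite sqrrD !smabs_sqr real_normK ?num_real//.
have h1 := smabs_ge e s; have h0 := normr_ge0 (t - s).
have h2 : s * (t - s) <= smabs e s * `|t - s|.
  apply: le_trans (ler_norm _) _; rewrite normrM; exact: ler_wpM2r.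
rewrite (_ : t ^+ 2 = s ^+ 2 + 2 * (s * (t - s)) + (t - s) ^+ 2); last by ring.
rewrite mulr2n; lra.
Qed.

Lemma smabs_slope e t : 0 < e -> `|t / smabs e t| <= 1.
Proof.
move=> e0; rewrite normrM normfV (ger0_norm (smabs_ge0 _ _)).
by rewrite ler_pdivrMr ?smabs_gt0// mul1r smabs_ge.
Qed.

End smoothed_absolute_value.

(** * Integrals with variable exponents *)

Section continuity_of_powers.
Context {R : realType}.
Implicit Types (s b : nat -> R) (p c : R).

Lemma exprn_powR (a b : R) n : 0 <= a -> (a `^ b) ^+ n = (a ^+ n) `^ b.
Proof.
move=> a0; rewrite -(powR_mulrn n (powR_ge0 a b)) -(powR_mulrn n a0).
exact: powRAC.
Qed.

Lemma cvg_powR_gt0 s (s0 p : R) : 0 < s0 ->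
  s @ \oo --> s0 -> (s n `^ p) @[n --> \oo] --> s0 `^ p.
Proof.
move=> s0gt ss0; apply: (@continuous_cvg _ _ _ _ _ s (@powR R ^~ p) s0) => //.
have d : derivable (@powR R ^~ p) s0 1.
  by apply: derivable_powR; rewrite in_itv/= s0gt.
exact/differentiable_continuous/derivable1_diffP.
Qed.

Lemma cvg_powR_to0 s p : 0 < p -> (forall n, 0 <= s n) ->
  s @ \oo --> 0 -> (s n `^ p) @[n --> \oo] --> (0 : R).
Proof.
move=> p0 s0 ss0; apply/cvgrPdist_lt => e e0.
have e1 : 0 < e `^ p^-1 by rewrite powR_gt0.
move/cvgrPdist_lt : ss0 => /(_ _ e1); apply: filterS => n.
rewrite !sub0r !normrN (ger0_norm (s0 n)) ger0_norm ?powR_ge0// => h.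
have -> : e = (e `^ p^-1) `^ p by rewrite -powRrM mulVf ?gt_eqF// powRr1// ltW.
by rewrite gt0_ltr_powR ?nnegrE// ltW.
Qed.

(* The hypothesis [`|b n| <= s n * c] handles the degenerate case [s0 = 0],
   where the exponent [p - 2] may be negative. *)
Lemma cvg_powR_mul s b (s0 b0 p c : R) : 1 < p -> 0 <= c ->
  (forall n, 0 <= s n) -> (forall n, `|b n| <= s n * c) ->
  s @ \oo --> s0 -> b @ \oo --> b0 ->
  (s n `^ (p - 2) * b n) @[n --> \oo] --> s0 `^ (p - 2) * b0.
Proof.
move=> p1 c0 sge0 bs ss0 bb0.
have s0ge0 : 0 <= s0 by apply: (cvgr_to_ge ss0); near=> n.
have [s00|s0n] := eqVneq s0 0; last first.
  by apply: cvgM => //; apply: cvg_powR_gt0 => //; rewrite lt_def s0n.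
have b00 : b0 = 0.
  apply: (cvg_unique _ bb0) => //; apply/norm_cvg0P.
  apply: (@squeeze_cvgr _ _ _ _ (fun=> 0) (fun n => s n * c)).
  - by near=> n; rewrite normr_ge0 bs.
  - exact: cvg_cst.
  - by rewrite -(mul0r c) -s00; exact: cvgMr_tmp.
rewrite b00 mulr0; apply/norm_cvg0P.
apply: (@squeeze_cvgr _ _ _ _ (fun=> 0) (fun n => s n `^ (p - 1) * c)).
- near=> n; rewrite normr_ge0/= normrM ger0_norm ?powR_ge0//.
  have [sn0|snn] := eqVneq (s n) 0.
    have := bs n; rewrite sn0 mul0r normr_le0 => /eqP ->.
    by rewrite normr0 mulr0 mulr_ge0// powR_ge0.
  have -> : s n `^ (p - 1) = s n `^ (p - 2) * s n.
    rewrite -[X in _ * X]powRr1// -powRD; last by rewrite snn implybT.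
    by congr (_ `^ _); ring.
  by rewrite -mulrA ler_wpM2l// powR_ge0.
- exact: cvg_cst.
- rewrite -(mul0r c); apply: cvgMr_tmp; apply: cvg_powR_to0 => //; first lra.
  by rewrite -s00.
Unshelve. all: by end_near. Qed.

Lemma cvg_norm_powR (s : nat -> R) (s0 p : R) : 1 < p -> s @ \oo --> s0 ->
  (`|s n| `^ p) @[n --> \oo] --> `|s0| `^ p.
Proof.
move=> p1 ss0; have ns : (fun n => `|s n|) @ \oo --> `|s0| by exact: cvg_norm.
have [s00|s0n] := eqVneq s0 0.
  rewrite s00 normr0 powR0; last by rewrite gt_eqF//; lra.
  rewrite s00 normr0 in ns.
  by apply: (@cvg_powR_to0 (fun n => `|s n|)) => //; lra.
by apply: cvg_powR_gt0 => //; rewrite normr_gt0.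
Qed.

End continuity_of_powers.

(** * Completeness with respect to the modular *)

Section variable_exponent_integrals.
Context d (T : measurableType d) (R : realType).
Variables (mu : {measure set T -> \bar R}) (D : set T).
Hypothesis mD : measurable D.
Implicit Types (f g h : T -> R) (P : R).

Lemma measurable_fun_powR f h : measurable_fun D f -> measurable_fun D h ->
  measurable_fun D (fun x => f x `^ h x).
Proof.
move=> mf mh; rewrite /powR.
apply: measurable_fun_if => //.
- exact: measurable_fun_eqr.
- apply: (@measurableT_comp _ _ _ _ _ _ (fun b : bool => b%:R : R)) => //.
  apply: measurable_funS (_ : measurable_fun D (fun x => h x == 0)) => //.
  exact: measurable_fun_eqr.
- apply: measurable_funS (_ : measurable_fun D (fun x => expR (h x * ln (f x)))) => //.
  apply: measurableT_comp; first exact: measurable_expR.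
  apply: measurable_funM => //; apply: measurableT_comp => //; exact: measurable_ln.
Qed.

Local Notation modu h u := (\int[mu]_(x in D) (`|u x| `^ h x)%:E)%E.

Lemma measurable_modular h f : measurable_fun D f -> measurable_fun D h ->
  measurable_fun D (fun x => (`|f x| `^ h x)%:E).
Proof.
move=> mf mh; apply/measurable_EFinP/measurable_fun_powR => //.
exact: measurableT_comp.
Qed.

Lemma cvg_geometric_increments (u : nat -> R) (C : R) :
  (forall j, 2 ^+ j * `|u j.+1 - u j| <= C) -> cvgn u.
Proof.
move=> uC.
have C0 : 0 <= C by apply: le_trans (uC 0%N); rewrite expr0 mul1r.
have : cvgn (series (telescope u)).
  apply: normed_cvg.
  apply: (@series_le_cvg _ _ (geometric C (2^-1 : R))) => //=.
  - by move=> n; rewrite mulr_ge0// exprn_ge0.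
  - by move=> n; rewrite /telescope exprVn ler_pdivlMr ?exprn_gt0// mulrC.
  - by apply: is_cvg_geometric_series; rewrite ger0_norm; lra.
rewrite telescopeK => /cvg_ex[l ul]; apply/cvg_ex; exists (l + u 0%N).
have e : (fun n => u n - u 0%N : R) + cst (u 0%N) = u.
  by apply/funext => n /=; rewrite fctE subrK.
by rewrite -[in X in X @ _]e; apply: cvgD; [exact: ul|exact: cvg_cst].
Qed.

Section completeness.
Variables (h : T -> R) (P : R) (g : nat -> T -> R).
Hypothesis mh : measurable_fun D h.
Hypothesis h1P : forall x, D x -> 1 < h x <= P.
Hypothesis mg : forall n, measurable_fun D (g n).
Hypothesis cauchy_g : forall e, 0 < e -> exists n0, forall n k,
  (n0 <= n)%N -> (n0 <= k)%N -> (modu h (fun x => g n x - g k x)%R <= e%:E)%E.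

(** The factor [(2 ^ P) ^- j] pays for the weights by which the increments are multiplied below; the
    remaining factors 2^-(j + 1) have sum 1. *)
Let fast_subsequence : exists s : nat -> nat, (forall j, (j <= s j)%N) /\
  forall j, (modu h (fun x => g (s j.+1) x - g (s j) x)%R
    <= ((2 `^ P) ^- j / (2 ^ j.+1)%:R)%:E)%E.
Proof.
have e0 j : 0 < (2 `^ P) ^- j / (2 ^ j.+1)%:R :> R.
  by rewrite divr_gt0 ?invr_gt0 ?exprn_gt0 ?powR_gt0// ltr0n expn_gt0.
have /choice[s0 hs0] j := cauchy_g (e0 j).
(* Summing the thresholds makes the values at j and at j + 1 both exceed [s0 j]; the summand j makes
   the indices tend to infinity. *)
exists (fun j => (\sum_(i < j.+1) s0 i + j)%N); split=> j; first exact: leq_addl.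
apply: hs0; last by rewrite big_ord_recr/= -addnA addnCA leq_addr.
by rewrite 2!big_ord_recr/= -!addnA addnCA leq_addr.
Qed.

(* Along a fast subsequence the series [S] of the (weighted) modulars of the
   increments is integrable, and where it is finite the subsequence converges. *)
Lemma modular_complete : exists g', [/\ measurable_fun D g',
  forall x B, D x -> (forall n, `|g n x| <= B) -> `|g' x| <= B &
  forall e, 0 < e -> exists n0, forall n, (n0 <= n)%N ->
    (modu h (fun x => g n x - g' x)%R <= e%:E)%E].
Proof.
have [s [js hs]] := fast_subsequence.
pose c : R := 2 `^ P; have c0 : 0 < c by rewrite powR_gt0.
pose k j x := (c ^+ j * `|g (s j.+1) x - g (s j) x| `^ h x)%:E.
have mB n n' : measurable_fun D (fun x => g n x - g n' x) by exact: measurable_funB.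
have mk j : measurable_fun D (k j).
  apply/measurable_EFinP; apply: measurable_funM => //.
  by apply/measurable_EFinP; exact: measurable_modular.
have k0 j x : D x -> (0 <= k j x)%E.
  by move=> _; rewrite lee_fin mulr_ge0 ?powR_ge0// exprn_ge0// ltW.
pose S x := (\sum_(j <oo) k j x)%E.
have S0 x : D x -> (0 <= S x)%E by move=> Dx; apply: nneseries_ge0 => j _ _; exact: k0.
have mS : measurable_fun D S.
  by apply: ge0_emeasurable_sum => // j x Dx _; exact: k0.
have iS : (\int[mu]_(x in D) S x <= 1)%E.
  rewrite integral_nneseries//; apply: le_trans (@epsilon_trick0 R 1 xpredT _) => //.
  apply: lee_nneseries => j _; first by move=> _; apply: integral_ge0 => x; exact: k0.
  rewrite (eq_integral (fun x => (c ^+ j)%:E * (`|g (s j.+1) x - g (s j) x| `^ h x)%:E))%E;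
    last by move=> x _; rewrite -EFinM.
  rewrite ge0_integralZl//=; first last.
  - by rewrite lee_fin exprn_ge0// ltW.
  - exact: measurable_modular.
  apply: (@le_trans _ _ ((c ^+ j)%:E * (c ^- j / (2 ^ j.+1)%:R)%:E)%E).
    by rewrite lee_wpmul2l// lee_fin exprn_ge0// ltW.
  by rewrite -EFinM lee_fin mulrA mulfV ?mul1r// gt_eqF// exprn_gt0.
have intS : mu.-integrable D S.
  apply/integrableP; split => //.
  rewrite (eq_integral S); first exact: le_lt_trans iS (ltry _).
  by move=> x; rewrite inE => Dx; rewrite gee0_abs// S0.
have [N [mN N0 hN]] := integrable_ae mD intS.
(* On the null set the sequence is replaced by 0, so that it converges on all of D, with a
   measurable limit that inherits pointwise bounds. *)
pose G j x := g (s j) x * \1_(~` N) x.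
have GE x j : ~ N x -> G j x = g (s j) x.
  by move=> Nx; rewrite /G indicE mem_set// mulr1.
have cvG x : D x -> cvgn (G ^~ x).
  move=> Dx; have [Nx|Nx] := pselect (N x).
    rewrite (_ : G ^~ x = cst 0); first exact: is_cvg_cst.
    by apply/funext => j; rewrite /G indicE memNset ?mulr0//= => /(_ Nx).
  have Sx : S x \is a fin_num.
    by apply: contrapT => h'; apply: Nx; apply: hN => /= /(_ Dx).
  rewrite (_ : G ^~ x = fun j => g (s j) x); last by apply/funext => j; exact: GE.
  apply: (@cvg_geometric_increments _ (1 + fine (S x))) => j.
  set dl := `|_ - _|; have dl0 : 0 <= dl by exact: normr_ge0.
  have hk : c ^+ j * dl `^ h x <= fine (S x).
    rewrite -lee_fin fineK//; apply: le_trans (nneseries_lim_ge j.+1 _); last first.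
      by move=> i _ _; exact: k0.
    rewrite big_nat_recr//= leeDr//; apply: sume_ge0 => i _; exact: k0.
  have /andP[h1 hP] := h1P Dx.
  have Sx0 : 0 <= fine (S x) by rewrite fine_ge0// S0.
  (* A number above 1 may be raised to the power h x, and then (2^j)^(h x) <= c^j reduces it to a
     term of the series. *)
  have [le1|gt1] := leP (2 ^+ j * dl) 1; first lra.
  have twoj : 1 <= (2 : R) ^+ j by rewrite exprn_ege1// ler1n.
  apply: (@le_trans _ _ ((2 ^+ j * dl) `^ h x)).
    by rewrite le1r_powR// ltW.
  rewrite powRM ?exprn_ge0//.
  apply: (@le_trans _ _ (c ^+ j * dl `^ h x)); last lra.
  rewrite ler_wpM2r ?powR_ge0//.
  have -> : c ^+ j = (2 ^+ j) `^ P.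
    exact: exprn_powR.
  by rewrite ler_powR.
exists (fun x => limn (G ^~ x)); split.
- apply: (@measurable_fun_cvg _ _ _ D G) => [j|x Dx]; last exact: cvG.
  by apply: measurable_funM => //; apply: measurable_indic; exact: measurableC.
- move=> x B Dx gB; apply: (cvgr_to_le (cvg_norm (cvG _ Dx))); near=> j.
  have B0 : 0 <= B by apply: le_trans (gB 0%N).
  rewrite /G normrM indicE; case: (_ \in _) => /=; last by rewrite normr0 mulr0.
  by rewrite normr1 mulr1.
- move=> e e0; have [n0 hn0] := cauchy_g e0; exists n0 => n nn0.
  pose f j x := (`|g n x - g (s j) x| `^ h x)%:E.
  have mDN : measurable (D `\` N) by exact: measurableD.
  have mf j : measurable_fun D (f j) by exact: measurable_modular.
  rewrite (ge0_negligible_integral mN)//; last first.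
    apply: measurable_modular => //; apply: measurable_funB => //.
    apply: (@measurable_fun_cvg _ _ _ D G) => [j|x Dx]; last exact: cvG.
    by apply: measurable_funM => //; apply: measurable_indic; exact: measurableC.
  (* Fatou's lemma along the subsequence, with n fixed: the modular of the distance to the limit is
     at most the lower limit of those to [g (s j)]. *)
  apply: (@le_trans _ _ (\int[mu]_(x in D `\` N) limn_einf (f ^~ x))%E).
    rewrite le_eqVlt; apply/orP; left; apply/eqP; apply: eq_integral => x.
    rewrite inE => -[Dx Nx].
    have := @cvg_limn_einf_sup _ (f ^~ x) ((`|g n x - limn (G ^~ x)| `^ h x)%:E).
    case=> [|-> //]; apply: cvg_EFin; first by near=> j.
    have /andP[h1 _] := h1P Dx.
    apply: cvg_norm_powR => //; apply: cvgB; first exact: cvg_cst.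
    rewrite [X in X @ _](_ : _ = G ^~ x); first exact: cvG.
    by apply/funext => j; rewrite GE.
  apply: (le_trans (@fatou _ _ _ mu _ mDN f _ _)).
  + by move=> j; apply: measurable_funS (mf j) => // x [].
  + by move=> j x _; rewrite lee_fin powR_ge0.
  rewrite limn_einf_lim; apply: lime_le; first exact: is_cvg_einfs.
  near=> j; apply: (@le_trans _ _ (\int[mu]_(x in D `\` N) f j x)%E).
    by apply: ereal_inf_lbound; exists j => /=.
  apply: (@le_trans _ _ (\int[mu]_(x in D) f j x)%E).
    by apply: ge0_subset_integral => // x _; rewrite lee_fin powR_ge0.
  apply: hn0 => //; apply: leq_trans (js j).
  by near: j; exists n0.
Unshelve. all: by end_near. Qed.

End completeness.
End variable_exponent_integrals.

(** Tolerances of the form r / (C + 1) also serve when C vanishes. *)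
Lemma mul_div_succ_le (R : realFieldType) (r C : R) : 0 <= r -> 0 <= C ->
  C * (r / (C + 1)) <= r.
Proof.
move=> r0 C0; have C1 : 0 < C + 1 by lra.
by rewrite mulrA ler_pdivrMr// mulrC ler_wpM2l// lerDl.
Qed.

(** The suprema of A over the d-almost minimizers of J decrease to some S as d tends to 0. The n-th
    point has A at least S - 1 / (n + 1), while A is at most S + 1 / (n + 1) on a larger class of
    almost minimizers, which contains the competitors y. In the application J is the energy and A
    the integral. *)
Lemma extremal_sequence (R : realType) (X : Type) (K : X -> Prop) (J A : X -> R)
    (I0 B : R) :
  (forall x, K x -> `|A x| <= B) ->
  (forall e, 0 < e -> exists2 x, K x & J x <= I0 + e) ->
  exists z : nat -> X, (forall n, K (z n)) /\
    forall eta, 0 < eta -> exists n0, forall n k, (n0 <= n)%N -> (n0 <= k)%N ->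
      J (z n) <= I0 + eta /\
      exists2 e, 0 < e & forall y, K y -> J y <= J (z n) + J (z k) - I0 + e ->
        A y <= (A (z n) + A (z k)) / 2 + eta.
Proof.
move=> AB Ji.
pose E d := [set A x | x in [set x | K x /\ J x <= I0 + d]].
have E_sup d : 0 < d -> has_sup (E d).
  move=> d0; split.
    by have [x Kx Jx] := Ji _ d0; exists (A x), x.
  by exists B => _ [x [Kx _] <-]; exact: le_trans (ler_norm _) (AB _ Kx).
pose F := [set sup (E d) | d in [set d | 0 < d]].
have F_inf : has_inf F.
  split; first by exists (sup (E 1)), 1 => //=; rewrite ltr01.
  exists (- B) => _ [d d0 <-]; have [x Kx Jx] := Ji _ d0.
  apply: (@le_trans _ _ (A x)); first by have := AB _ Kx; rewrite ler_norml => /andP[].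
  by apply: ub_le_sup; [exact: (E_sup _ d0).2|exists x].
pose S := inf F.
have S_le d : 0 < d -> S <= sup (E d).
  by move=> d0; apply: ge_inf; [exact: F_inf.2|exists d].
have E_mono d d' : 0 < d -> d <= d' -> sup (E d) <= sup (E d').
  move=> d0 dd'; apply: sup_le; last 2 first.
  - exact: (E_sup _ d0).1.
  - exact: (E_sup _ (lt_le_trans d0 dd')).
  apply: subset_trans (@le_down _ _) => _ [x [Kx Jx] <-]; exists x => //; split=> //.
  by apply: le_trans Jx _; rewrite lerD2l.
have step k : exists dz : R * X, [/\ 0 < dz.1 <= k.+1%:R^-1,
    sup (E dz.1) <= S + k.+1%:R^-1, K dz.2, J dz.2 <= I0 + dz.1 / 4 &
    S - k.+1%:R^-1 <= A dz.2].
  have k0 : 0 < k.+1%:R^-1 :> R by [].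
  have [_ [d d0 <-] dS] := inf_adherent k0 F_inf.
  have m0 : 0 < Num.min d k.+1%:R^-1 by rewrite lt_min d0.
  have m4 : 0 < Num.min d k.+1%:R^-1 / 4 by rewrite divr_gt0.
  have [_ [x [Kx Jx] <-] xS] := sup_adherent k0 (E_sup _ m4).
  exists (Num.min d k.+1%:R^-1, x) => /=; split=> //.
  - by rewrite m0 ge_min lexx orbT.
  - apply: (@le_trans _ _ (sup (E d))); last exact: ltW.
    by apply: E_mono => //; rewrite ge_min lexx.
  - by apply: le_trans (ltW xS); rewrite lerD2r S_le.
have /choice[dz hdz] := step.
exists (fun n => (dz n).2); split=> [n|eta eta0]; first by have [] := hdz n.
have [n0 hn0] : exists n0, forall n, (n0 <= n)%N -> n.+1%:R^-1 <= eta / 2 :> R.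
  exists (Num.truncn (2 / eta)) => n hn.
  have : 2 / eta < n.+1%:R.
    apply: (lt_le_trans (truncnS_gt _)); by rewrite ler_nat ltnS.
  rewrite ltr_pdivrMr// => h.
  by rewrite -[leLHS]mul1r ler_pdivrMr// mulrAC ler_pdivlMr// mul1r mulrC ltW.
(* Each point uses a quarter of its own tolerance, so that with slack d_n / 2 the sum d_n / 4 + d_k
   / 4 + d_n / 2 is at most d_n when d_k <= d_n. *)
have key n k : (n0 <= n)%N -> (n0 <= k)%N -> (dz k).1 <= (dz n).1 ->
    exists2 e, 0 < e & forall y, K y -> J y <= J (dz n).2 + J (dz k).2 - I0 + e ->
        A y <= (A (dz n).2 + A (dz k).2) / 2 + eta.
  move=> n0n n0k kn.
  have [/andP[dn0 dn1] Sn Kn Jn An] := hdz n.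
  have [/andP[dk0 dk1] Sk Kk Jk Ak] := hdz k.
  have un := hn0 _ n0n; have uk := hn0 _ n0k.
  set a := n.+1%:R^-1 in dn1 Sn An un; set b := k.+1%:R^-1 in dk1 Sk Ak uk.
  exists ((dz n).1 / 2); first by rewrite divr_gt0.
  move=> y Ky Jy; have : A y <= sup (E (dz n).1).
    apply: ub_le_sup; first exact: (E_sup _ dn0).2.
    by exists y => //; split => //; lra.
  by lra.
exists n0 => n k n0n n0k; split.
  have [/andP[dn0 dn1] _ _ Jn _] := hdz n.
  have := hn0 _ n0n; set a := n.+1%:R^-1 in dn1 *; lra.
have [|/ltW] := leP (dz k).1 (dz n).1; first exact: key.
move=> /(key _ _ n0k n0n)[e e0 he]; exists e => // y Ky.
by rewrite (addrC (J _)) (addrC (A (dz n).2)); exact: he.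
Qed.

(** * Real-valued integrals over a set of finite measure *)

Section integrals.
Context d (T : measurableType d) (R : realType).
Variables (mu : {measure set T -> \bar R}) (D : set T).
Hypotheses (mD : measurable D) (Dfin : (mu D < +oo)%E).
Implicit Types (f g : T -> R).

Definition itg f := mu.-integrable D (EFin \o f).

Lemma itg_measurable f : itg f -> measurable_fun D f.
Proof. by move=> /measurable_int/measurable_EFinP. Qed.

Lemma itg_le f g : measurable_fun D f -> itg g ->
  (forall x, D x -> `|f x| <= g x) -> itg f.
Proof.
move=> mf ig fg; apply: (le_integrable mD _ _ ig).
  exact/measurable_EFinP.
move=> x Dx; rewrite /= lee_fin; apply: le_trans (fg _ Dx) (ler_norm _).
Qed.

Lemma itg_bounded f (C : R) : measurable_fun D f ->
  (forall x, D x -> `|f x| <= C) -> itg f.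
Proof.
move=> mf fC; apply: measurable_bounded_integrable => //; exists C.
by split=> [|M CM x Dx]; [exact: num_real|exact: le_trans (fC _ Dx) (ltW CM)].
Qed.

Lemma itg_cst (C : R) : itg (fun=> C).
Proof. by apply: (@itg_bounded _ `|C|) => //; exact: measurable_cst. Qed.

Lemma itgD f g : itg f -> itg g -> itg (fun x => f x + g x).
Proof. by move=> if_ ig; have := integrableD mD if_ ig. Qed.

Lemma itgZ (a : R) f : itg f -> itg (fun x => a * f x).
Proof. by move=> if_; have := integrableZl mD a if_. Qed.

Lemma itgN f : itg f -> itg (fun x => - f x).
Proof. by move=> if_; have := integrableN if_. Qed.

Lemma itgB f g : itg f -> itg g -> itg (fun x => f x - g x).
Proof. by move=> if_ ig; apply: itgD => //; exact: itgN. Qed.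

Lemma itg_norm f : itg f -> itg (fun x => `|f x|).
Proof. by move=> if_; apply: integrable_norm. Qed.

Lemma le_itg f g : itg f -> itg g -> (forall x, D x -> f x <= g x) ->
  \int[mu]_(x in D) f x <= \int[mu]_(x in D) g x.
Proof. by move=> *; exact: le_Rintegral. Qed.

Lemma integralD_itg f g : itg f -> itg g ->
  \int[mu]_(x in D) (f x + g x) = \int[mu]_(x in D) f x + \int[mu]_(x in D) g x.
Proof. exact: RintegralD. Qed.

Lemma integralB_itg f g : itg f -> itg g ->
  \int[mu]_(x in D) (f x - g x) = \int[mu]_(x in D) f x - \int[mu]_(x in D) g x.
Proof. exact: RintegralB. Qed.

Lemma integralZ_itg (a : R) f : itg f ->
  \int[mu]_(x in D) (a * f x) = a * \int[mu]_(x in D) f x.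
Proof. by move=> if_; rewrite RintegralZl. Qed.

Lemma le_itgD f1 f2 g1 g2 : itg f1 -> itg f2 -> itg g1 -> itg g2 ->
  (forall x, D x -> f1 x + f2 x <= g1 x + g2 x) ->
  \int[mu]_(x in D) f1 x + \int[mu]_(x in D) f2 x <=
  \int[mu]_(x in D) g1 x + \int[mu]_(x in D) g2 x.
Proof.
move=> i1 i2 j1 j2 h; rewrite -(integralD_itg i1 i2) -(integralD_itg j1 j2).
exact: le_itg (itgD i1 i2) (itgD j1 j2) h.
Qed.

Lemma le_itgD_cst f1 f2 g1 g2 (c : R) : itg f1 -> itg f2 -> itg g1 -> itg g2 ->
  (forall x, D x -> f1 x + f2 x <= g1 x + g2 x + c) ->
  \int[mu]_(x in D) f1 x + \int[mu]_(x in D) f2 x <=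
  \int[mu]_(x in D) g1 x + \int[mu]_(x in D) g2 x + c * fine (mu D).
Proof.
move=> i1 i2 j1 j2 h; have ic := itg_cst c; rewrite -Rintegral_cst//.
rewrite -(integralD_itg i1 i2) -(integralD_itg j1 j2).
rewrite -(integralD_itg (itgD j1 j2) ic).
exact: le_itg (itgD i1 i2) (itgD (itgD j1 j2) ic) h.
Qed.

Lemma integral_itg f : itg f ->
  (\int[mu]_(x in D) (f x)%:E)%E = (\int[mu]_(x in D) f x)%:E.
Proof. by move=> if_; rewrite /Rintegral fineK//; exact: integrable_fin_num. Qed.

Lemma itg_ge0 f (e : R) : measurable_fun D f -> (forall x, D x -> 0 <= f x) ->
  (\int[mu]_(x in D) (f x)%:E <= e%:E)%E ->
  itg f /\ \int[mu]_(x in D) f x <= e.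
Proof.
move=> mf f0 fe; have if_ : itg f.
  apply/integrableP; split; first exact/measurable_EFinP.
  rewrite (eq_integral (EFin \o f)); first exact: le_lt_trans fe (ltry _).
  by move=> x; rewrite inE => Dx; rewrite /= ger0_norm// f0.
by split=> //; rewrite -lee_fin -integral_itg.
Qed.

End integrals.

(** * The variational problem *)

Section vector_measurability.
Context d (T : measurableType d) (R : realType) (D : set T) (N : nat).
Hypothesis mD : measurable D.
Implicit Types F G : T -> 'rV[R]_N.

(** Equivalent to the measurability of F by [measurable_fun_rV_coord]; in this form the results on
    real functions apply directly. *)
Definition coord_measurable F := forall i, measurable_fun D (fun x => F x ord0 i).

Lemma coord_measurableB F G : coord_measurable F -> coord_measurable G ->
  coord_measurable (fun x => F x - G x).
Proof.
move=> mF mG i; rewrite (_ : (fun x => _) = (fun x => F x ord0 i - G x ord0 i)).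
  exact: measurable_funB.
by apply/funext => x; rewrite !mxE.
Qed.

Lemma measurable_dot F G : coord_measurable F -> coord_measurable G ->
  measurable_fun D (fun x => dot (F x) (G x)).
Proof.
move=> mF mG; rewrite /dot; apply: measurable_sum => i.
exact: measurable_funM.
Qed.

Lemma measurable_enorm F : coord_measurable F ->
  measurable_fun D (fun x => enorm (F x)).
Proof.
move=> mF; rewrite (_ : (fun x => _) = (fun x => dot (F x) (F x) `^ 2^-1)).
  by apply: measurable_fun_powR => //; exact: measurable_dot.
by apply/funext => x; rewrite powR12_sqrt// dot_ge0.
Qed.

End vector_measurability.

(** * Linear arithmetic for the energy estimates *)

Section linear_combinations.
Context {R : realType}.
Implicit Types a b c e i r s t x y z : R.

Lemma lerD_lin2 a b s t (x1 x2 y1 y2 : R) : a <= s * x1 + t * y1 ->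
  b <= s * x2 + t * y2 -> a + b <= s * (x1 + x2) + t * (y1 + y2).
Proof. by move=> h1 h2; rewrite !mulrDr addrACA lerD. Qed.

Lemma ler_of_sum a b c e i : a + b <= c + e -> i <= b -> a <= c - i + e.
Proof. lra. Qed.

Lemma sum_defect r s (x1 x2 y1 y2 z1 z2 : R) :
  ((x1 * r + x2 * s) + (y1 * r + y2 * s)) / 2 - (z1 * r + z2 * s) =
  ((x1 + y1) / 2 - z1) * r + ((x2 + y2) / 2 - z2) * s.
Proof. by field. Qed.

Lemma convex_swap a b t x y : a <= t * x + (1 - t) * y ->
  b <= (1 - t) * x + (1 - (1 - t)) * y -> a + b <= x + y.
Proof. lra. Qed.

Lemma sum_of_energies (x1 x2 x3 x4 y1 y2 y3 y4 : R) r e : x1 + x2 <= x3 + x4 ->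
  y1 + y2 <= y3 + y4 + r -> r <= e ->
  (x1 + y1) + (x2 + y2) <= (x3 + y3) + (x4 + y4) + e.
Proof. lra. Qed.

Lemma le_of_half_sum a b c y s r : (a + b + c) / 2 - s <= y ->
  y <= (a + b) / 2 + r / 4 -> s <= r / 4 -> c <= r.
Proof. lra. Qed.

Lemma midpoint_energy (x y z a b c e i : R) : c <= a + 2^-1 * e -> c <= b + 2^-1 * e ->
  0 <= e -> i <= z + c -> (x + y) / 2 - z <= ((x + a) + (y + b)) / 2 - i + e.
Proof. lra. Qed.

Lemma sub_combinations (r a1 a2 b1 b2 c1 c2 : R) :
  (a1 - a2) - r * (b1 - b2) + (c1 - c2) =
  (a1 - r * b1 + c1) - (a2 - r * b2 + c2).
Proof. ring. Qed.

Lemma opp_combination r a b c :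
  -1 * a - r * (-1 * b) + -1 * c = - (a - r * b + c).
Proof. ring. Qed.

Lemma lt0_of_le_half a b c : a <= b -> b <= c + - c / 2 -> c < 0 -> a < 0.
Proof. lra. Qed.

Lemma normrD_le_double a b c : `|a| <= c -> `|b| <= c -> `|a + b| <= 2 * c.
Proof.
by move=> ac bc; rewrite mulr_natl mulr2n (le_trans (ler_normD _ _))// lerD.
Qed.

End linear_combinations.

(** * The energy on an abstract class of functions with gradients *)

Section energy.
Context d (T : measurableType d) (R : realType).
Variables (mu : {measure set T -> \bar R}) (D : set T).
Hypotheses (mD : measurable D) (Dfin : (mu D < +oo)%E).
Variable N : nat.
Variables (p1 p2 q : T -> R) (p0 P lam : R).
Hypotheses (mp1 : measurable_fun D p1) (mp2 : measurable_fun D p2)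
  (mq : measurable_fun D q).
Hypotheses (p01 : 1 < p0) (p0P : p0 <= P) (lam0 : 0 <= lam).

Let m x := Num.max (p1 x) (p2 x).

Hypothesis exponent_bounds : forall x, D x ->
  [/\ p0 <= p1 x <= P, p0 <= p2 x <= P, p0 <= q x <= P & m x <= q x].

Implicit Types (f g : T -> R) (F G : T -> 'rV[R]_N) (x : T) (xi eta : 'rV[R]_N).

Definition dens x xi := enorm xi `^ p1 x / p1 x + enorm xi `^ p2 x / p2 x.
Definition pot x (t : R) := - lam * (`|t| `^ m x / m x) + `|t| `^ q x / q x.

Lemma exps x : D x ->
  [/\ 1 < p1 x <= P, 1 < p2 x <= P, 1 < q x <= P, 1 < m x <= P & m x <= q x].
Proof.
move=> /exponent_bounds[/andP[a b] /andP[a' b'] /andP[a'' b''] mq'].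
split=> //; last by rewrite /m lt_max (lt_le_trans p01 a) ge_max b.
all: by apply/andP; split => //; apply: lt_le_trans p01 _.
Qed.

Lemma measurable_m : measurable_fun D m.
Proof. exact: measurable_maxr. Qed.

Lemma measurable_powR_div (h t : T -> R) : (forall x, D x -> 0 <= h x) ->
  measurable_fun D h -> measurable_fun D t ->
  measurable_fun D (fun x => t x `^ h x / h x).
Proof.
move=> h0 mh mt.
apply: (@eq_measurable_fun _ _ _ _ _ (fun x => t x `^ h x * h x `^ (-1))).
  by move=> x; rewrite inE => Dx; rewrite powR_inv1// h0.
by apply: measurable_funM; apply: measurable_fun_powR.
Qed.

Lemma powR_le_max x (p t : R) : D x -> 1 < p -> p <= m x -> 0 <= t ->
  t `^ p <= 1 + t `^ m x.
Proof.
move=> Dx p1' pm t0; have [t1|t1] := leP t 1.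
  apply: (@le_trans _ _ 1); last by rewrite lerDl powR_ge0.
  by rewrite -[leRHS](powR1l p) ge0_ler_powR ?nnegrE; lra.
by apply: (@le_trans _ _ (t `^ m x)); [rewrite ler_powR// ltW|rewrite lerDr].
Qed.

Lemma dens_ge0 x xi : D x -> 0 <= dens x xi.
Proof.
move=> /exps[/andP[a b] /andP[a' b'] _ _ _].
by apply: addr_ge0; rewrite divr_ge0 ?powR_ge0//; lra.
Qed.

Lemma powR_div_le (t p : R) : 0 <= t -> 1 <= p -> t / p <= t.
Proof. by move=> t0 p1'; rewrite ler_pdivrMr ?ler_peMr//; lra. Qed.

Lemma dens_le x xi : D x -> dens x xi <= 2 * (1 + enorm xi `^ m x).
Proof.
move=> Dx; have [/andP[a b] /andP[a' b'] _ _ _] := exps Dx.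
have h1 := @powR_le_max x (p1 x) (enorm xi) Dx.
have h2 := @powR_le_max x (p2 x) (enorm xi) Dx.
have {}h1 : enorm xi `^ p1 x <= 1 + enorm xi `^ m x.
  by apply: h1; [lra|rewrite le_max lexx|exact: enorm_ge0].
have {}h2 : enorm xi `^ p2 x <= 1 + enorm xi `^ m x.
  by apply: h2; [lra|rewrite le_max lexx orbT|exact: enorm_ge0].
have h3 := @powR_div_le (enorm xi `^ p1 x) (p1 x) (powR_ge0 _ _) ltac:(lra).
have h4 := @powR_div_le (enorm xi `^ p2 x) (p2 x) (powR_ge0 _ _) ltac:(lra).
rewrite /dens; lra.
Qed.

(** Coercivity: [m x] is one of [p1 x] and [p2 x], and the other term of the density is
    nonnegative. *)
Lemma powR_m_dens x xi : D x -> enorm xi `^ m x <= P * dens x xi.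
Proof.
move=> Dx; have [/andP[a b] /andP[a' b'] _ _ _] := exps Dx.
have key p : 1 < p <= P -> enorm xi `^ p <= P * (enorm xi `^ p / p).
  move=> /andP[p'1 pP]; rewrite mulrCA ler_peMr ?powR_ge0//.
  by rewrite ler_pdivlMr ?mul1r//; lra.
have P0 : 0 <= P by lra.
rewrite /dens mulrDr; have [e|e] : m x = p1 x \/ m x = p2 x.
  by rewrite /m; have [_|_] := leP (p1 x) (p2 x); [right|left].
- rewrite e; apply: le_trans (key _ _) _; first by rewrite a b.
  by rewrite lerDl mulr_ge0// divr_ge0 ?powR_ge0//; lra.
- rewrite e; apply: le_trans (key _ _) _; first by rewrite a' b'.
  by rewrite lerDr mulr_ge0// divr_ge0 ?powR_ge0//; lra.
Qed.

(** The defect of the density is the sum of the defects of its two powers, both nonnegative by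
    convexity, and one of them belongs to the exponent [m x]. So closeness in the modular of m can
    be read off from the energy. *)
Lemma powR_m_defect x xi eta : D x ->
  (enorm xi `^ m x + enorm eta `^ m x) / 2 - enorm (2^-1 *: (xi + eta)) `^ m x <=
  P * ((dens x xi + dens x eta) / 2 - dens x (2^-1 *: (xi + eta))).
Proof.
move=> Dx; have [/andP[a b] /andP[a' b'] _ _ _] := exps Dx.
pose df p := (enorm xi `^ p + enorm eta `^ p) / 2 - enorm (2^-1 *: (xi + eta)) `^ p.
have df0 p : 1 < p -> 0 <= df p.
  by move=> p'1; rewrite subr_ge0; apply: enorm_midpoint_powR; lra.
have key p : 1 < p <= P -> df p <= P * (df p / p).
  move=> /andP[p'1 pP]; rewrite mulrCA ler_peMr ?df0//.
  by rewrite ler_pdivlMr ?mul1r//; lra.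
have P0 : 0 <= P by lra.
have dfp p : 1 < p -> 0 <= P * (df p / p).
  by move=> p'1; rewrite mulr_ge0// divr_ge0 ?df0//; lra.
have -> : (dens x xi + dens x eta) / 2 - dens x (2^-1 *: (xi + eta)) =
  df (p1 x) / p1 x + df (p2 x) / p2 x.
  exact: sum_defect.
rewrite mulrDr; have [e|e] : m x = p1 x \/ m x = p2 x.
  by rewrite /m; have [_|_] := leP (p1 x) (p2 x); [right|left].
- rewrite e; apply: le_trans (key _ _) _; first by rewrite a b.
  by rewrite lerDl dfp.
- rewrite e; apply: le_trans (key _ _) _; first by rewrite a' b'.
  by rewrite lerDr dfp.
Qed.

(** The tangent at the convex combination is evaluated at both ends. The gradients of smoothed
    maxima and minima have this form. *)
Lemma dens_lin x (t : R) xi eta : D x -> 0 <= t <= 1 ->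
  dens x (t *: xi + (1 - t) *: eta) <= t * dens x xi + (1 - t) * dens x eta.
Proof.
move=> Dx /andP[t0 t1]; have [/andP[a b] /andP[a' b'] _ _ _] := exps Dx.
have key p : 1 < p -> enorm (t *: xi + (1 - t) *: eta) `^ p / p <=
    t * (enorm xi `^ p / p) + (1 - t) * (enorm eta `^ p / p).
  move=> p1'; have p'0 : 0 < p by lra.
  rewrite !mulrA -mulrDl ler_pM2r ?invr_gt0//.
  set z := _ + _.
  have h1 := enorm_powR_tangent z xi p1'; have h2 := enorm_powR_tangent z eta p1'.
  have h1' := ler_wpM2l t0 h1.
  have h2' : (1 - t) * (enorm z `^ p + p * (enorm z `^ (p - 2) * dot z (eta - z)))
     <= (1 - t) * enorm eta `^ p by rewrite ler_wpM2l// subr_ge0.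
  have e : t * dot z (xi - z) + (1 - t) * dot z (eta - z) = 0.
    rewrite -!dotZr -dotDr (_ : t *: _ + _ = 0) ?(dotC _ 0) ?dot0l//.
    by rewrite /z; apply/rowP => i; rewrite !mxE; ring.
  have := lerD h1' h2'; set k := enorm z `^ (p - 2).
  rewrite (_ : t * _ + (1 - t) * _ = enorm z `^ p + p * k *
    (t * dot z (xi - z) + (1 - t) * dot z (eta - z))); last by ring.
  by rewrite e mulr0 addr0.
have h1 := key (p1 x) ltac:(lra); have h2 := key (p2 x) ltac:(lra).
exact: lerD_lin2.
Qed.

Lemma dens_scale_le x (t : R) xi : D x -> `|t| <= 1 -> dens x (t *: xi) <= dens x xi.
Proof.
move=> Dx t1; have [/andP[a b] /andP[a' b'] _ _ _] := exps Dx.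
have key p : 1 < p -> enorm (t *: xi) `^ p / p <= enorm xi `^ p / p.
  move=> p'1; rewrite ler_pM2r ?invr_gt0; last lra.
  rewrite ge0_ler_powR ?nnegrE ?enorm_ge0//; first lra.
  by rewrite enormZ ler_piMl ?enorm_ge0.
by apply: lerD; apply: key.
Qed.

(** As s tends to 0 the factor of [dens x xi] tends to 1; this asymmetry is what makes [Phi]
    continuous from above. *)
Lemma densD_le x (s : R) xi eta : D x -> 0 < s < 1 ->
  dens x (xi + eta) <= (1 - s) `^ (1 - P) * dens x xi + s `^ (1 - P) * dens x eta.
Proof.
move=> Dx s01; have [/andP[a b] /andP[a' b'] _ _ _] := exps Dx.
have key p : 1 < p <= P -> enorm (xi + eta) `^ p / p <=
  (1 - s) `^ (1 - P) * (enorm xi `^ p / p) + s `^ (1 - P) * (enorm eta `^ p / p).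
  move=> /andP[p'1 pP]; rewrite !mulrA -mulrDl ler_pM2r ?invr_gt0; last lra.
  by apply: enormD_powR_le => //; apply/andP; split; lra.
have := key (p1 x); rewrite a b => /(_ isT) h1.
have := key (p2 x); rewrite a' b' => /(_ isT) h2.
exact: lerD_lin2.
Qed.

(** A Lipschitz constant on [-A, A], for 1 <= A, common to all [pot x]: the summand lam belongs to
    the m-term, 1 to the q-term. *)
Definition potL (A : R) := (lam + 1) * A `^ (P - 1).

Lemma potL_ge0 A : 0 <= potL A.
Proof. by rewrite mulr_ge0 ?powR_ge0// addr_ge0. Qed.

Lemma pot_lipschitz x (A s t : R) : D x -> 1 <= A -> `|s| <= A -> `|t| <= A ->
  pot x s <= pot x t + potL A * `|s - t|.
Proof.
move=> Dx A1 sA tA; have [_ _ /andP[a b] /andP[a' b'] _] := exps Dx.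
have h1 := @powR_norm_lipschitz R (m x) P A t s _ A1 tA sA.
have {}h1 : `|t| `^ m x / m x - `|s| `^ m x / m x <= A `^ (P - 1) * `|t - s|.
  by apply: h1; rewrite b' andbT; lra.
have h2 : `|s| `^ q x / q x - `|t| `^ q x / q x <= A `^ (P - 1) * `|s - t|.
  by apply: powR_norm_lipschitz => //; rewrite b andbT; lra.
rewrite distrC in h1.
have := ler_wpM2l lam0 h1; rewrite /pot /potL; lra.
Qed.

Lemma pot0 x : D x -> pot x 0 = 0.
Proof.
move=> Dx; have [_ _ /andP[a b] /andP[a' b'] _] := exps Dx.
by rewrite /pot normr0 !powR0 ?mul0r ?mulr0 ?addr0// gt_eqF//; lra.
Qed.

Lemma pot_bound x (A t : R) : D x -> 1 <= A -> `|t| <= A -> `|pot x t| <= potL A * A.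
Proof.
move=> Dx A1 tA; have A0 : `|0 : R| <= A by rewrite normr0; lra.
have h1 := pot_lipschitz Dx A1 tA A0; have h2 := pot_lipschitz Dx A1 A0 tA.
rewrite pot0// sub0r normrN in h1 h2; rewrite subr0 in h1.
have := ler_wpM2l (potL_ge0 A) tA; rewrite ler_norml; lra.
Qed.

Lemma measurable_pot f : measurable_fun D f -> measurable_fun D (fun x => pot x (f x)).
Proof.
move=> mf; have mabs : measurable_fun D (fun x => `|f x|) by exact: measurableT_comp.
apply: measurable_funD; [apply: measurable_funM => //|];
  apply: measurable_powR_div => //; last 2 first.
- exact: measurable_m.
- by move=> x /exps[_ _ /andP[a _] _ _]; lra.
- by move=> x /exps[_ _ _ /andP[a _] _]; lra.
Qed.

Lemma measurable_dens F : coord_measurable D F ->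
  measurable_fun D (fun x => dens x (F x)).
Proof.
move=> /(measurable_enorm mD) mF.
by apply: measurable_funD; apply: measurable_powR_div => // x
  /exps[/andP[a b] /andP[a' b'] _ _ _]; lra.
Qed.

Definition finite_modular F :=
  coord_measurable D F /\ itg mu D (fun x => enorm (F x) `^ m x).

Lemma itg_dens F : finite_modular F -> itg mu D (fun x => dens x (F x)).
Proof.
move=> [mF iF]; apply: (itg_le mD (g := fun x => 2 * (1 + enorm (F x) `^ m x))).
- exact: measurable_dens.
- by apply: (itgZ mD); apply: (itgD mD) => //; exact: itg_cst.
- by move=> x Dx; rewrite ger0_norm ?dens_ge0// dens_le.
Qed.

Lemma finite_modular_bounded F (B : R) : coord_measurable D F ->
  (forall x, D x -> enorm (F x) <= B) -> finite_modular F.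
Proof.
move=> mF FB; split=> //; apply: (@itg_bounded _ _ _ _ _ mD Dfin _ (1 + `|B| `^ P)).
  by apply: measurable_fun_powR => //; [exact: measurable_enorm|exact: measurable_m].
move=> x Dx; have [_ _ _ /andP[a b] _] := exps Dx.
rewrite ger0_norm ?powR_ge0//; have FB' := le_trans (FB _ Dx) (ler_norm B).
apply: (@le_trans _ _ (`|B| `^ m x)).
  by rewrite ge0_ler_powR ?nnegrE ?enorm_ge0//; lra.
have [B1|B1] := leP `|B| 1.
  apply: (@le_trans _ _ 1); last by rewrite lerDl powR_ge0.
  by rewrite -[leRHS](powR1l (m x)) ge0_ler_powR ?nnegrE//; lra.
by apply: (@le_trans _ _ (`|B| `^ P)); [rewrite ler_powR// ltW|rewrite lerDr].
Qed.

Lemma finite_modularD F G : finite_modular F -> finite_modular G ->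
  finite_modular (fun x => F x + G x).
Proof.
move=> [mF iF] [mG iG]; have mFG : coord_measurable D (fun x => F x + G x).
  move=> i; rewrite (_ : (fun x => _) = (fun x => F x ord0 i + G x ord0 i)).
    exact: measurable_funD.
  by apply/funext => x; rewrite mxE.
split; first exact: mFG.
pose c : R := 2^-1 `^ (1 - P).
apply: (itg_le mD (g := fun x => c * enorm (F x) `^ m x + c * enorm (G x) `^ m x)).
- by apply: measurable_fun_powR => //; [exact: measurable_enorm|exact: measurable_m].
- by apply: (itgD mD); exact: itgZ.
- move=> x Dx; rewrite ger0_norm ?powR_ge0//.
  have [_ _ _ mP _] := exps Dx.
  have := @enormD_powR_le _ _ (m x) P 2^-1 (F x) (G x) mP.
  rewrite (_ : 1 - 2^-1 = 2^-1); last by field.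
  by apply; apply/andP; split; lra.
Qed.

Lemma finite_modularN F : finite_modular F -> finite_modular (fun x => - F x).
Proof.
move=> [mF iF]; split.
  move=> i; rewrite (_ : (fun x => _) = (fun x => - F x ord0 i)).
    exact: measurable_funN.
  by apply/funext => x; rewrite mxE.
by rewrite (_ : (fun x => _) = fun x => enorm (F x) `^ m x)//; apply/funext => x;
  rewrite enormN.
Qed.

Definition Phi F := \int[mu]_(x in D) dens x (F x).
Definition Lo f := \int[mu]_(x in D) pot x (f x).
Definition en f F := Phi F + Lo f.

Lemma Phi_ge0 F : 0 <= Phi F.
Proof. by apply: Rintegral_ge0 => x Dx; exact: dens_ge0. Qed.

Lemma itg_pot A f : 1 <= A -> measurable_fun D f -> (forall x, D x -> `|f x| <= A) ->
  itg mu D (fun x => pot x (f x)).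
Proof.
move=> A1 mf fA; apply: (@itg_bounded _ _ _ _ _ mD Dfin _ (potL A * A)).
  exact: measurable_pot.
by move=> x Dx; apply: pot_bound => //; exact: fA.
Qed.

Lemma Lo_le A f g : 1 <= A -> measurable_fun D f -> (forall x, D x -> `|f x| <= A) ->
  measurable_fun D g -> (forall x, D x -> `|g x| <= A) ->
  Lo f <= Lo g + potL A * \int[mu]_(x in D) `|f x - g x|.
Proof.
move=> A1 mf fA mg gA.
have ifg : itg mu D (fun x => `|f x - g x|).
  apply: itg_norm; apply: (itgB mD).
    exact: (itg_bounded mD Dfin mf fA).
  exact: (itg_bounded mD Dfin mg gA).
have ig : itg mu D (fun x => pot x (g x)) by exact: itg_pot A1 mg gA.
have iZ := itgZ mD (potL A) ifg.
rewrite -(integralZ_itg mD)// -(integralD_itg mD)//.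
apply: le_itg => //.
- exact: itg_pot A1 mf fA.
- exact: itgD.
- by move=> x Dx; apply: pot_lipschitz => //; [exact: fA|exact: gA].
Qed.

Lemma Phi_add_le (s : R) F G : finite_modular F -> finite_modular G -> 0 < s < 1 ->
  Phi (fun x => F x + G x) <= (1 - s) `^ (1 - P) * Phi F + s `^ (1 - P) * Phi G.
Proof.
move=> fF fG s01; have iF := itg_dens fF; have iG := itg_dens fG.
have iF' := itgZ mD ((1 - s) `^ (1 - P)) iF; have iG' := itgZ mD (s `^ (1 - P)) iG.
rewrite -(integralZ_itg mD _ iF) -(integralZ_itg mD _ iG) -(integralD_itg mD iF' iG').
apply: (le_itg mD (itg_dens (finite_modularD fF fG)) (itgD mD iF' iG')) => x Dx.
exact: densD_le.
Qed.

(** To be read: f is a test function and F its gradient. The shift c in [V_smabs] is 0 for maxima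
    and minima, and M or -M for truncation; subtracting [smabs e c] keeps the value 0 at 0 and with
    it the compact support. *)
Variable V : (T -> R) -> (T -> 'rV[R]_N) -> Prop.
Hypothesis V_lin : forall (a b : R) f F g G, V f F -> V g G ->
  V (fun x => a * f x + b * g x) (fun x => a *: F x + b *: G x).
Hypothesis V_smabs : forall (c e : R) f F, 0 < e -> V f F ->
  V (fun x => smabs e (f x + c) - smabs e c)
    (fun x => ((f x + c) / smabs e (f x + c)) *: F x).
Hypothesis V_measurable : forall f F, V f F ->
  measurable_fun D f /\ coord_measurable D F.
Hypothesis V_bounded : forall f F, V f F ->
  exists B : R, forall x, D x -> `|f x| <= B /\ enorm (F x) <= B.

Lemma V_finite_modular f F : V f F -> finite_modular F.
Proof.
move=> Vf; have [B hB] := V_bounded Vf; have [_ mF] := V_measurable Vf.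
by apply: (@finite_modular_bounded _ B) => // x /hB[].
Qed.

Lemma V_bound f F A : V f F -> exists2 B, 1 <= B /\ A <= B & forall x, D x -> `|f x| <= B.
Proof.
move=> Vf; have [B hB] := V_bounded Vf; exists (1 + `|A| + `|B|).
  have := normr_ge0 A; have := normr_ge0 B; have := ler_norm A; split; lra.
move=> x /hB[fB _]; apply: le_trans fB _; have := normr_ge0 A; have := ler_norm B; lra.
Qed.

Lemma V_itg_pot f F : V f F -> itg mu D (fun x => pot x (f x)).
Proof.
move=> Vf; have [B [B1 _] fB] := V_bound 0 Vf.
by apply: (itg_pot B1) => //; exact: (V_measurable Vf).1.
Qed.

Variable M : R.
Hypotheses (M1 : 1 <= M) (hM : forall x, D x -> lam <= M `^ (q x - m x)).

Let vD := fine (mu D).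

Lemma integral_cst_D (c : R) : \int[mu]_(x in D) c = c * vD.
Proof. by rewrite Rintegral_cst. Qed.

Lemma vD_ge0 : 0 <= vD.
Proof. by rewrite fine_ge0. Qed.

(** A smoothing of (|t + M| - |t - M|) / 2, the truncation at level M. *)
Definition smtrunc (e t : R) := (smabs e (t + M) - smabs e (t - M)) / 2.

(** [smabs e] is 1-Lipschitz and the two arguments differ by 2 M, so that the smoothing causes no
    error in this bound. *)
Lemma smtrunc_bound e t : `|smtrunc e t| <= M.
Proof.
have M1' := M1.
have h1 := smabs_lipschitz e (t - M) (t + M); have h2 := smabs_lipschitz e (t + M) (t - M).
rewrite (_ : t + M - (t - M) = 2 * M) ?ger0_norm in h1; [|lra|ring].
rewrite (_ : t - M - (t + M) = - (2 * M)) ?normrN ?ger0_norm in h2; [|lra|ring].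
by rewrite /smtrunc ler_norml; apply/andP; split; lra.
Qed.

(** The exact truncation [k] does not increase the potential, by [energy_increasing], and the
    smoothed one differs from k by at most e. *)
Lemma pot_smtrunc x (A e t : R) : D x -> M <= A -> `|t| <= A -> 0 <= e ->
  pot x (smtrunc e t) <= pot x t + potL A * e.
Proof.
move=> Dx MA tA e0; have M1' := M1; have tr := smtrunc_bound e t.
have A1 : 1 <= A by lra.
pose k := (`|t + M| - `|t - M|) / 2.
have tk : `|smtrunc e t - k| <= e.
  have a1 := smabs_le (t + M) e0; have a2 := smabs_ge e (t + M).
  have a3 := smabs_le (t - M) e0; have a4 := smabs_ge e (t - M).
  by rewrite /smtrunc /k ler_norml; apply/andP; split; lra.
have [kM kt] : `|k| <= M /\ pot x k <= pot x t; last first.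
  apply: le_trans (pot_lipschitz Dx A1 (le_trans tr MA) (le_trans kM MA)) _.
  by apply: lerD => //; rewrite ler_wpM2l// potL_ge0.
have [_ _ /andP[q1 _] /andP[m1 _] mq'] := exps Dx.
have inc : M <= `|t| -> pot x M <= pot x t.
  move=> Mt; rewrite /pot (ger0_norm (_ : 0 <= M)); last by lra.
  by apply: energy_increasing => //; [lra|exact: hM].
have potN s : pot x (- s) = pot x s by rewrite /pot normrN.
have [tM|Mt] := leP t (- M).
  have -> : k = - M by rewrite /k !ler0_norm; lra.
  by rewrite potN normrN ger0_norm; [split=> //; apply: inc; rewrite ler0_norm; lra|lra].
have [tM'|Mt'] := leP M t.
  have -> : k = M by rewrite /k !ger0_norm; lra.
  by rewrite ger0_norm; [split=> //; apply: inc; rewrite ger0_norm; lra|lra].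
have -> : k = t by rewrite /k ger0_norm ?ltr0_norm; lra.
by split=> //; rewrite ler_norml; apply/andP; split; lra.
Qed.

Lemma V_trunc f F e : V f F -> 0 < e -> exists g G,
  [/\ V g G, forall x, D x -> `|g x| <= M & en g G <= en f F + e].
Proof.
move=> Vf e0; have [A [A1 MA] fA] := V_bound M Vf.
have L0 : 0 <= potL A * vD by rewrite mulr_ge0 ?potL_ge0 ?vD_ge0.
pose ep := e / (potL A * vD + 1).
have ep0 : 0 < ep by rewrite divr_gt0// ltr_wpDl.
have epe : potL A * ep * vD <= e.
  by rewrite mulrAC mulrA ler_pdivrMr ?ltr_wpDl// mulrC ler_wpM2l ?lerDl// ltW.
(* The derivative of [smtrunc ep] at [f x]. It lies in [-1, 1], so that the gradient part of the
   energy does not grow. *)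
pose th x := ((f x + M) / smabs ep (f x + M) - (f x - M) / smabs ep (f x - M)) / 2.
have Vg : V (fun x => smtrunc ep (f x)) (fun x => th x *: F x).
  have := V_lin 2^-1 (- 2^-1) (V_smabs M ep0 Vf) (V_smabs (- M) ep0 Vf).
  congr V; apply/funext => x.
    have -> : smabs ep (- M) = smabs ep M by rewrite /smabs sqrrN.
    by rewrite /smtrunc; field.
  by rewrite !scalerA -scalerDl; congr (_ *: _); rewrite /th; ring.
exists (fun x => smtrunc ep (f x)), (fun x => th x *: F x); split=> //.
  by move=> x Dx; exact: smtrunc_bound.
rewrite /en -addrA; apply: lerD.
  apply: le_itg => //.
  - exact/itg_dens/(V_finite_modular Vg).
  - exact/itg_dens/(V_finite_modular Vf).
  move=> x Dx; apply: dens_scale_le => //.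
  have h1 := smabs_slope (f x + M) ep0; have h2 := smabs_slope (f x - M) ep0.
  rewrite ler_norml in h1; rewrite ler_norml in h2.
  by rewrite /th ler_norml; apply/andP; split; lra.
apply: (@le_trans _ _ (Lo f + potL A * ep * vD)); last by rewrite lerD2l.
have iL := V_itg_pot Vf; have ic := @itg_cst _ _ _ mu D mD Dfin (potL A * ep).
rewrite -integral_cst_D -(integralD_itg mD)//.
apply: le_itg => //; first exact: V_itg_pot Vg.
  exact: itgD.
by move=> x Dx; apply: pot_smtrunc => //; [exact: fA|exact: ltW].
Qed.

(** [y] and [z] smooth the maximum and the minimum. The correction by e makes both vanish at s = t =
    0 and keeps them in [-M, M]; for s <= t they are within e of t and s respectively. *)
Lemma pot_smmax x (e s t : R) : D x -> 0 <= e -> `|s| <= M -> `|t| <= M ->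
  let y := (s + t + smabs e (s - t) - e) / 2 in
  let z := (s + t - smabs e (s - t) + e) / 2 in
  [/\ `|y| <= M, `|z| <= M, pot x y + pot x z <= pot x s + pot x t + 2 * (potL M * e) &
      (s + t + `|s - t|) / 2 - e <= y].
Proof.
move=> Dx e0; wlog st : s t / s <= t.
  move=> wl sM tM; have [|/ltW ts] := leP s t; first by move=> /wl; exact.
  have E : smabs e (s - t) = smabs e (t - s) by rewrite /smabs -(opprB t s) sqrrN.
  by have := wl _ _ ts tM sM; rewrite /= E (distrC s t) (addrC s t) (addrC (pot x s)).
move=> sM tM y z; have M1' := M1.
have h1 := smabs_ge e (s - t); have h2 := smabs_le (s - t) e0.
have h3 := smabs_ge_eps e (s - t).
have st' : `|s - t| = t - s by rewrite ler0_norm; lra.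
rewrite st' in h1 h2 *.
have /andP[s1 s2] : - M <= s <= M by rewrite -ler_norml.
have /andP[t1 t2] : - M <= t <= M by rewrite -ler_norml.
have yM : `|y| <= M by rewrite /y ler_norml; apply/andP; split; lra.
have zM : `|z| <= M by rewrite /z ler_norml; apply/andP; split; lra.
split=> //; last by rewrite /y; lra.
have yt : `|y - t| <= e by rewrite /y ler_norml; apply/andP; split; lra.
have zs : `|z - s| <= e by rewrite /z ler_norml; apply/andP; split; lra.
have := pot_lipschitz Dx M1 yM tM; have := pot_lipschitz Dx M1 zM sM.
have := ler_wpM2l (potL_ge0 M) yt; have := ler_wpM2l (potL_ge0 M) zs; lra.
Qed.

Definition admissible f F := V f F /\ forall x, D x -> `|f x| <= M.

Variable I0 : R.
Hypothesis I0_le : forall f F, admissible f F -> I0 <= en f F.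

(** The gradients of the smoothed maximum and minimum are complementary convex combinations of F and
    G, so that convexity bounds the sum of the two energies; the minimum has energy at least [I0],
    and the rest bounds that of the maximum. *)
Lemma V_smmax f F g G e : admissible f F -> admissible g G -> 0 < e ->
  exists y Y, [/\ admissible y Y, en y Y <= en f F + en g G - I0 + e &
    (\int[mu]_(x in D) f x + \int[mu]_(x in D) g x
      + \int[mu]_(x in D) `|f x - g x|) / 2 - e <= \int[mu]_(x in D) y x].
Proof.
move=> [Vf fM] [Vg gM] e0.
have K0 : 0 < 2 * (potL M * vD) + vD + 1.
  by have := mulr_ge0 (potL_ge0 M) vD_ge0; have := vD_ge0; lra.
pose ep := e / (2 * (potL M * vD) + vD + 1).
have ep0 : 0 < ep by rewrite divr_gt0.
have epK : ep * (2 * (potL M * vD) + vD + 1) = e by rewrite divfK ?gt_eqF.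
have h1 : 0 <= ep * vD by rewrite mulr_ge0 ?vD_ge0// ltW.
have h2 : 0 <= ep * (potL M * vD).
  by rewrite mulr_ge0 ?(ltW ep0)// mulr_ge0 ?vD_ge0 ?potL_ge0.
have [hv hk] : ep * vD <= e /\ 2 * (potL M * ep) * vD <= e.
  by rewrite -epK; move: h1 h2 ep0; clearbody ep; move: (potL M) vD => l v *; split; lra.
(* The derivative of the smoothed maximum in its first argument; that of the smoothed minimum is 1 -
   th. *)
pose th x := (1 + (f x - g x) / smabs ep (f x - g x)) / 2.
have Vd := V_lin 1 (-1) Vf Vg; have Vs := V_smabs 0 ep0 Vd.
have Vfg := V_lin 2^-1 2^-1 Vf Vg.
have smabs0 : smabs ep 0 = ep by rewrite /smabs expr0n add0r sqrtr_sqr gtr0_norm.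
pose y x := (f x + g x + smabs ep (f x - g x) - ep) / 2.
pose z x := (f x + g x - smabs ep (f x - g x) + ep) / 2.
have Vy : V y (fun x => th x *: F x + (1 - th x) *: G x).
  have := V_lin 1 2^-1 Vfg Vs; congr V; apply/funext => x.
    by rewrite smabs0 /y !mul1r mulN1r addr0; field.
  rewrite !mul1r mulN1r addr0; apply/rowP => i; rewrite !mxE /th; field.
  by rewrite gt_eqF// smabs_gt0.
have Vz : V z (fun x => (1 - th x) *: F x + th x *: G x).
  have := V_lin 1 (- 2^-1) Vfg Vs; congr V; apply/funext => x.
    by rewrite smabs0 /z !mul1r mulN1r addr0; field.
  rewrite !mul1r mulN1r addr0; apply/rowP => i; rewrite !mxE /th; field.
  by rewrite gt_eqF// smabs_gt0.
have pw x (Dx : D x) := pot_smmax Dx (ltW ep0) (fM _ Dx) (gM _ Dx).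
have yM x : D x -> `|y x| <= M by move=> /pw[].
have zM x : D x -> `|z x| <= M by move=> /pw[].
have Ky : admissible y (fun x => th x *: F x + (1 - th x) *: G x) by [].
have Kz : admissible z (fun x => (1 - th x) *: F x + th x *: G x) by [].
exists y, (fun x => th x *: F x + (1 - th x) *: G x); split => //.
  suff : en y (fun x => th x *: F x + (1 - th x) *: G x) +
    en z (fun x => (1 - th x) *: F x + th x *: G x) <= en f F + en g G + e.
    move=> h; exact: ler_of_sum h (I0_le Kz).
  have hP : Phi (fun x => th x *: F x + (1 - th x) *: G x) +
      Phi (fun x => (1 - th x) *: F x + th x *: G x) <= Phi F + Phi G.
    have i1 := itg_dens (V_finite_modular Vy).
    have i2 := itg_dens (V_finite_modular Vz).
    have i3 := itg_dens (V_finite_modular Vf).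
    have i4 := itg_dens (V_finite_modular Vg).
    apply: (le_itgD mD i1 i2 i3 i4) => x Dx.
    have sl : `|(f x - g x) / smabs ep (f x - g x)| <= 1 by exact: smabs_slope.
    have [th01 th01'] : 0 <= th x <= 1 /\ 0 <= 1 - th x <= 1.
      move: sl; rewrite /th ler_norml; move: (_ / smabs _ _) => u /andP[u1 u2].
      by split; apply/andP; split; lra.
    have h := dens_lin (F x) (G x) Dx th01'.
    rewrite {1}(_ : 1 - (1 - th x) = th x) in h; last by ring.
    exact: convex_swap (dens_lin (F x) (G x) Dx th01) h.
  have hL : Lo y + Lo z <= Lo f + Lo g + 2 * (potL M * ep) * vD.
    have i1 := V_itg_pot Vy; have i2 := V_itg_pot Vz.
    have i3 := V_itg_pot Vf; have i4 := V_itg_pot Vg.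
    apply: (le_itgD_cst mD Dfin i1 i2 i3 i4) => x Dx.
    by have [] := pw x Dx.
  exact: sum_of_energies hP hL hk.
have iV h H : V h H -> (forall x, D x -> `|h x| <= M) -> itg mu D h.
  move=> Vh hM'; exact: (itg_bounded mD Dfin (V_measurable Vh).1 hM').
have iff := iV _ _ Vf fM; have ig := iV _ _ Vg gM; have iy := iV _ _ Vy yM.
have ifg : itg mu D (fun x => `|f x - g x|) by apply: itg_norm; exact: itgB.
have ifs : itg mu D (fun x => f x + g x) by exact: itgD.
have isum : itg mu D (fun x => f x + g x + `|f x - g x|) by exact: itgD.
have ic := @itg_cst _ _ _ mu D mD Dfin ep; have iZ := itgZ mD 2^-1 isum.
apply: (@le_trans _ _ (2^-1 * (\int[mu]_(x in D) f x + \int[mu]_(x in D) g x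
      + \int[mu]_(x in D) `|f x - g x|) - ep * vD)).
  by rewrite [leLHS]addrC [leRHS]addrC (mulrC 2^-1) lerD2r lerN2.
rewrite -(integral_cst_D ep) -(integralD_itg mD iff ig) -(integralD_itg mD ifs ifg).
rewrite -(integralZ_itg mD _ isum) -(integralB_itg mD iZ ic).
apply: (le_itg mD (itgB mD iZ ic) iy) => x Dx.
by have [_ _ _] := pw x Dx; rewrite mulrC.
Qed.

Hypothesis I0_inf : forall e : R, 0 < e -> exists f F, admissible f F /\ en f F <= I0 + e.

Lemma admissible_itg f F : admissible f F -> itg mu D f.
Proof. by move=> [Vf fM]; exact: (itg_bounded mD Dfin (V_measurable Vf).1 fM). Qed.

Lemma minimizing_sequence : exists (z : nat -> T -> R) (Z : nat -> T -> 'rV[R]_N),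
  [/\ forall n, admissible (z n) (Z n),
      forall r : R, 0 < r -> exists n0, forall n, (n0 <= n)%N ->
        en (z n) (Z n) <= I0 + r &
      forall r : R, 0 < r -> exists n0, forall n k, (n0 <= n)%N -> (n0 <= k)%N ->
        \int[mu]_(x in D) `|z n x - z k x| <= r].
Proof.
pose K (y : (T -> R) * (T -> 'rV[R]_N)) := admissible y.1 y.2.
pose J (y : (T -> R) * (T -> 'rV[R]_N)) := en y.1 y.2.
pose A (y : (T -> R) * (T -> 'rV[R]_N)) := \int[mu]_(x in D) y.1 x.
have AB y : K y -> `|A y| <= M * vD.
  move=> Ky; apply: le_trans (le_normr_Rintegral mD (admissible_itg Ky)) _.
  rewrite -integral_cst_D; apply: le_itg => //.
  - exact/itg_norm/admissible_itg/Ky.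
  - exact: itg_cst.
  - exact: Ky.2.
have Ji e : 0 < e -> exists2 y, K y & J y <= I0 + e.
  by move=> /I0_inf[f [F [KF JF]]]; exists (f, F).
have [z [Kz hz]] := extremal_sequence AB Ji.
exists (fun n => (z n).1), (fun n => (z n).2); split=> [n|r r0|r r0].
- exact: Kz.
- have [n0 hn0] := hz _ r0; exists n0 => n n0n.
  by have [] := hn0 _ _ n0n n0n.
- have r4 : 0 < r / 4 by rewrite divr_gt0.
  have [n0 hn0] := hz _ r4; exists n0 => n k n0n n0k.
  have [_ [e e0 he]] := hn0 _ _ n0n n0k.
  (* [e] keeps the smoothed maximum among the competitors of [he]; [r / 4] bounds the smoothing
     error of its integral. *)
  have m0 : 0 < Num.min e (r / 4) by rewrite lt_min e0.
  have [y [Y [Ky Jy]]] := V_smmax (Kz n) (Kz k) m0.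
  have me : Num.min e (r / 4) <= e by rewrite ge_min lexx.
  have mr : Num.min e (r / 4) <= r / 4 by rewrite ge_min lexx orbT.
  move=> hy; apply: le_of_half_sum hy _ mr.
  exact: (he (y, Y) Ky (le_trans Jy (lerD (lexx _) me))).
Qed.

Lemma Lo_bound f F : admissible f F -> `|Lo f| <= potL M * M * vD.
Proof.
move=> [Vf fM]; apply: le_trans (le_normr_Rintegral mD (V_itg_pot Vf)) _.
rewrite -integral_cst_D; apply: le_itg => //.
- exact/itg_norm/V_itg_pot/Vf.
- exact: itg_cst.
- by move=> x Dx; apply: pot_bound => //; exact: fM.
Qed.

(** The midpoint has energy at least [I0]. Its potential exceeds those of f and g by at most a
    multiple of the L^1 distance, although the potential need not be convex. The remaining gap falls
    on the gradient part. *)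
Lemma midpoint_defect f F g G : admissible f F -> admissible g G ->
  (Phi F + Phi G) / 2 - Phi (fun x => 2^-1 *: (F x + G x)) <=
  (en f F + en g G) / 2 - I0 + potL M * \int[mu]_(x in D) `|f x - g x|.
Proof.
move=> [Vf fM] [Vg gM].
pose h x := (f x + g x) / 2; pose H x := 2^-1 *: (F x + G x).
have Vh : V h H.
  have := V_lin 2^-1 2^-1 Vf Vg; congr V; apply/funext => x.
    by rewrite /h; field.
  by rewrite /H scalerDr.
have hM' x : D x -> `|h x| <= M.
  move=> Dx; have := fM _ Dx; have := gM _ Dx; rewrite /h !ler_norml.
  by move=> /andP[? ?] /andP[? ?]; apply/andP; split; lra.
have [mf _] := V_measurable Vf; have [mg _] := V_measurable Vg.
have [mh _] := V_measurable Vh.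
have ifg : itg mu D (fun x => `|f x - g x|).
  apply: itg_norm; apply: (itgB mD).
    exact: (itg_bounded mD Dfin mf fM).
  exact: (itg_bounded mD Dfin mg gM).
have key k : (forall x, D x -> `|h x - k x| = 2^-1 * `|f x - g x|) ->
    \int[mu]_(x in D) `|h x - k x| = 2^-1 * \int[mu]_(x in D) `|f x - g x|.
  move=> hk; rewrite -(integralZ_itg mD)//; apply: eq_Rintegral => x.
  by rewrite inE; exact: hk.
have h1 := Lo_le M1 mh hM' mf fM; have h2 := Lo_le M1 mh hM' mg gM.
rewrite key in h1; last first.
  move=> x _; rewrite (_ : h x - f x = 2^-1 * (g x - f x)); last by rewrite /h; field.
  by rewrite normrM ger0_norm ?invr_ge0// distrC.
rewrite key in h2; last first.
  move=> x _; rewrite (_ : h x - g x = 2^-1 * (f x - g x)); last by rewrite /h; field.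
  by rewrite normrM ger0_norm ?invr_ge0.
have L0 : 0 <= potL M * \int[mu]_(x in D) `|f x - g x|.
  by rewrite mulr_ge0 ?potL_ge0// Rintegral_ge0.
rewrite mulrCA in h1; rewrite mulrCA in h2.
exact: midpoint_energy h1 h2 L0 (I0_le (conj Vh hM')).
Qed.

(** [enorm_unif_convex] integrated, with the powers of exponent m replaced by the energy density. *)
Lemma grad_difference eps : 0 < eps <= 1 -> exists2 C, 0 <= C &
  forall F G, finite_modular F -> finite_modular G ->
  \int[mu]_(x in D) (enorm (F x - G x) `^ m x) <=
  eps * (P * (Phi F + Phi G)) +
  C * ((Phi F + Phi G) / 2 - Phi (fun x => 2^-1 *: (F x + G x))).
Proof.
move=> e01; have [C C0 hC] := @enorm_unif_convex R N p0 P eps p01 e01.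
have e0 : 0 <= eps by case/andP: e01 => /ltW.
exists (C * P); first by rewrite mulr_ge0// (le_trans _ p0P)// (le_trans _ (ltW p01)).
move=> F G fF fG.
have fH : finite_modular (fun x => 2^-1 *: (F x + G x)).
  have [mFG iFG] := finite_modularD fF fG; split.
    move=> i; rewrite (_ : (fun x => _) = (fun x => 2^-1 * (F x + G x) ord0 i)).
      exact: measurable_funM.
    by apply/funext => x; rewrite mxE.
  apply: (itg_le mD _ iFG).
    apply: measurable_fun_powR => //; last exact: measurable_m.
    apply: measurable_enorm => // i.
    rewrite (_ : (fun x => _) = (fun x => 2^-1 * (F x + G x) ord0 i)).
      exact: measurable_funM.
    by apply/funext => x; rewrite mxE.
  move=> x Dx; have [_ _ _ /andP[a b] _] := exps Dx.
  rewrite ger0_norm ?powR_ge0// ge0_ler_powR ?nnegrE ?enorm_ge0//; first lra.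
  by rewrite enormZ ler_piMl ?enorm_ge0// ger0_norm; lra.
have [mFG iFG] := finite_modularD fF (finite_modularN fG).
have iF := itg_dens fF; have iG := itg_dens fG; have iH := itg_dens fH.
have iS : itg mu D (fun x => dens x (F x) + dens x (G x)) by exact: itgD.
have iP := itgZ mD P iS; have iE := itgZ mD eps iP.
have i2 := itgZ mD 2^-1 iS.
have iB : itg mu D (fun x => 2^-1 * (dens x (F x) + dens x (G x))
  - dens x (2^-1 *: (F x + G x))) by exact: itgB.
have iC := itgZ mD (C * P) iB.
rewrite (mulrC (_ + _) 2^-1) -(integralD_itg mD)// -!(integralZ_itg mD)//.
rewrite -(integralB_itg mD)// -(integralZ_itg mD)// -(integralD_itg mD)//.
apply: le_itg => //; first exact: itgD.
move=> x Dx; have mx : p0 <= m x <= P.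
  have [/andP[a b] /andP[a' b'] _ _] := exponent_bounds Dx.
  by rewrite /m le_max a ge_max b b'.
apply: le_trans (hC _ _ _ mx) _; apply: lerD.
  rewrite ler_wpM2l// mulrDr; apply: lerD; exact: powR_m_dens.
by rewrite -mulrA ler_wpM2l// (mulrC 2^-1); exact: powR_m_defect.
Qed.

(** * Convergence of the minimizing sequence *)

Section limit_of_minimizing_sequence.
Variables (z : nat -> T -> R) (Z : nat -> T -> 'rV[R]_N).
Hypothesis Kz : forall n, admissible (z n) (Z n).
Hypothesis z_min : forall r : R, 0 < r -> exists n0, forall n, (n0 <= n)%N ->
  en (z n) (Z n) <= I0 + r.
Hypothesis z_cauchy : forall r : R, 0 < r -> exists n0, forall n k,
  (n0 <= n)%N -> (n0 <= k)%N -> \int[mu]_(x in D) `|z n x - z k x| <= r.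

Lemma gradients_cauchy (r : R) : 0 < r -> exists n0, forall n k,
  (n0 <= n)%N -> (n0 <= k)%N ->
  \int[mu]_(x in D) (enorm (Z n x - Z k x) `^ m x) <= r.
Proof.
have half_sum_le (a b c s i : R) : a <= i + s / 2 -> b <= i + s / 2 -> c <= s / 2 ->
    (a + b) / 2 - i + c <= s by lra.
move=> r0; have P0 : 0 <= P by apply: le_trans p0P; exact: le_trans (ltW p01).
(* A bound of [Phi (Z n)] for large n: the energy is then at most I0 + 1, and the potential part is
   bounded. *)
pose B := `|I0| + 1 + potL M * M * vD.
have B0 : 0 <= B.
  rewrite /B; have := normr_ge0 I0; have := mulr_ge0 (mulr_ge0 (potL_ge0 M) (le_trans ler01 M1)) vD_ge0.
  by lra.
pose K := P * (2 * B); have K0 : 0 <= K by rewrite mulr_ge0// mulr_ge0.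
(* First eps makes the bounded term small; this determines the constant [C], against which the
   defect is then made small. *)
pose eps := Num.min 1 (r / 2 / (K + 1)).
have r20 : 0 < r / 2 by rewrite divr_gt0.
have eps0 : 0 < eps by rewrite lt_min ltr01 divr_gt0// ltr_wpDl.
have eps1 : eps <= 1 by rewrite ge_min lexx.
have epsK : eps * K <= r / 2.
  apply: le_trans (mul_div_succ_le (ltW r20) K0).
  by rewrite mulrC ler_wpM2l// ge_min lexx orbT.
have [C C0 hC] := @grad_difference eps ltac:(by rewrite eps0 eps1).
pose s := r / 2 / (C + 1).
have s0 : 0 < s by rewrite divr_gt0// ltr_wpDl.
have sC : C * s <= r / 2 by apply: mul_div_succ_le => //; exact: ltW.
have s20 : 0 < s / 2 by rewrite divr_gt0.
pose s1 := s / 2 / (potL M + 1).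
have s10 : 0 < s1 by rewrite divr_gt0// ltr_wpDl// potL_ge0.
have s1L : potL M * s1 <= s / 2.
  by apply: mul_div_succ_le; [exact: ltW|exact: potL_ge0].
have m0 : 0 < Num.min 1 (s / 2) by rewrite lt_min ltr01 divr_gt0.
have [n0 hn0] := z_min m0; have [n1 hn1] := z_cauchy s10.
have enb n : (n0 <= n)%N -> en (z n) (Z n) <= I0 + 1 /\ en (z n) (Z n) <= I0 + s / 2.
  move=> /hn0 h; split; apply: le_trans h _; rewrite lerD2l ge_min lexx// orbT//.
have PhiB n : (n0 <= n)%N -> Phi (Z n) <= B.
  move=> /enb[h _]; have := Lo_bound (Kz n); rewrite ler_norml => /andP[h1 _].
  by move: h; rewrite /en /B => h; have := ler_norm I0; lra.
exists (maxn n0 n1) => n k; rewrite !geq_max => /andP[n0n n1n] /andP[n0k n1k].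
have [_ en1] := enb _ n0n; have [_ en2] := enb _ n0k.
have P1 := PhiB _ n0n; have P2 := PhiB _ n0k.
have := hC _ _ (V_finite_modular (Kz n).1) (V_finite_modular (Kz k).1).
have md := midpoint_defect (Kz n) (Kz k).
have hz := ler_wpM2l (potL_ge0 M) (hn1 _ _ n1n n1k).
move=> /le_trans; apply.
have h1 : eps * (P * (Phi (Z n) + Phi (Z k))) <= eps * K.
  have PP : Phi (Z n) + Phi (Z k) <= 2 * B by rewrite mulr_natl mulr2n lerD.
  exact: (ler_wpM2l (ltW eps0) (ler_wpM2l P0 PP)).
have h2 : (Phi (Z n) + Phi (Z k)) / 2 - Phi (fun x => 2^-1 *: (Z n x + Z k x)) <= s.
  apply: le_trans md _; apply: half_sum_le en1 en2 _; exact: le_trans hz s1L.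
rewrite [leRHS](splitr r); apply: lerD; first exact: le_trans h1 epsK.
exact: le_trans (ler_wpM2l C0 h2) sC.
Qed.

(** Compare with the largest coordinate. The base 1 + N, unlike N, is always at least 1, so that its
    exponent may be raised to P. *)
Lemma enorm_powR_le_sum x xi : D x ->
  enorm xi `^ m x <= (1 + N%:R) `^ P * \sum_(i < N) `|xi ord0 i| `^ m x.
Proof.
move=> Dx; have [_ _ _ /andP[a b] _] := exps Dx.
have N0 : 0 <= N%:R :> R by [].
have s0 : 0 <= (1 + N%:R) `^ P * \sum_(i < N) `|xi ord0 i| `^ m x.
  by rewrite mulr_ge0 ?powR_ge0// sumr_ge0// => i _; exact: powR_ge0.
have [->|xi0] := eqVneq (enorm xi) 0; first by rewrite powR0// gt_eqF//; lra.
have [i _ hi] : exists2 i : 'I_N, true & forall j, `|xi ord0 j| <= `|xi ord0 i|.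
  apply: contrapT => hn; move: xi0; rewrite enorm_eq0 => /eqP; apply.
  apply/rowP => j; case: hn.
  have [i _ hi] := @Order.TotalTheory.arg_maxP _ _ _ j xpredT (fun i => `|xi ord0 i|) isT.
  by exists i => // k; exact: hi.
apply: (@le_trans _ _ (((1 + N%:R) * `|xi ord0 i|) `^ m x)).
  rewrite ge0_ler_powR ?nnegrE ?enorm_ge0 ?mulr_ge0 ?addr_ge0//; first lra.
  apply: le_trans (enorm_le_sum xi) _.
  apply: (@le_trans _ _ (\sum_(j < N) `|xi ord0 i|)); first exact: ler_sum.
  by rewrite sumr_const card_ord -[leLHS]mulr_natl ler_wpM2r// lerDr.
rewrite powRM ?addr_ge0//; apply: ler_pM; rewrite ?powR_ge0//.
  by rewrite ler_powR// lerDl.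
by rewrite (bigD1 i)//= lerDl sumr_ge0// => j _; exact: powR_ge0.
Qed.

(** As |z n - z k| <= 2 M, its power m is at most (2 M)^(P - 1) times itself, so that the sequence
    is Cauchy in the modular too. The gradients are completed coordinate by coordinate and
    reassembled by [enorm_powR_le_sum]. *)
Lemma minimizer_limit : exists (w : T -> R) (G : T -> 'rV[R]_N),
  [/\ measurable_fun D w, forall x, D x -> `|w x| <= M, coord_measurable D G,
      forall r : R, 0 < r -> exists n0, forall n, (n0 <= n)%N ->
        (\int[mu]_(x in D) (`|z n x - w x| `^ m x)%:E <= r%:E)%E &
      forall r : R, 0 < r -> exists n0, forall n, (n0 <= n)%N ->
        (\int[mu]_(x in D) (enorm (Z n x - G x) `^ m x)%:E <= r%:E)%E].
Proof.
have m1P x : D x -> 1 < m x <= P by move=> /exps[].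
have mz n := (V_measurable (Kz n).1).1; have mZ n := (V_measurable (Kz n).1).2.
have iz n k : itg mu D (fun x => `|z n x - z k x|).
  by apply: itg_norm; apply: (itgB mD); exact: admissible_itg.
have [w [mw wM hw]] : exists g', [/\ measurable_fun D g',
    forall x B, D x -> (forall n, `|z n x| <= B) -> `|g' x| <= B &
    forall e : R, 0 < e -> exists n0, forall n, (n0 <= n)%N ->
    (\int[mu]_(x in D) (`|z n x - g' x| `^ m x)%:E <= e%:E)%E].
  apply: (modular_complete mD measurable_m m1P mz) => e e0.
  pose c : R := (2 * M) `^ (P - 1).
  have c0 : 0 <= c by exact: powR_ge0.
  have ec : 0 < e / (c + 1) by rewrite divr_gt0// ltr_wpDl.
  have [n0 hn0] := z_cauchy ec; exists n0 => n k n0n n0k.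
  have mzz : measurable_fun D (fun x => `|z n x - z k x| `^ m x).
    by apply: measurable_fun_powR => //; [exact: itg_measurable (iz n k)|exact: measurable_m].
  have pw x : D x -> `|z n x - z k x| `^ m x <= c * `|z n x - z k x|.
    move=> Dx; have /andP[a b] := m1P _ Dx; have M1' := M1.
    rewrite -(mulr_powRB1 (normr_ge0 _)); last lra.
    rewrite mulrC ler_wpM2r// /c.
    have zz : `|z n x - z k x| <= 2 * M.
      apply: le_trans (ler_normB _ _) _.
      by have := (Kz n).2 _ Dx; have := (Kz k).2 _ Dx; lra.
    apply: (@le_trans _ _ ((2 * M) `^ (m x - 1))).
      by rewrite ge0_ler_powR ?nnegrE//; lra.
    by rewrite ler_powR//; lra.
  have ic := itgZ mD c (iz n k).
  have i : itg mu D (fun x => `|z n x - z k x| `^ m x).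
    by apply: (itg_le mD mzz ic) => x Dx; rewrite ger0_norm ?powR_ge0// pw.
  rewrite (integral_itg mD i) lee_fin.
  apply: (@le_trans _ _ (c * \int[mu]_(x in D) `|z n x - z k x|)).
    by rewrite -(integralZ_itg mD)//; exact: le_itg.
  apply: (@le_trans _ _ (c * (e / (c + 1)))); first by rewrite ler_wpM2l// hn0.
  by apply: mul_div_succ_le => //; exact: ltW.
have mdZ n k (i : 'I_N) : measurable_fun D (fun x => Z n x ord0 i - Z k x ord0 i).
  by apply: measurable_funB; exact: mZ.
have mZZ n k : coord_measurable D (fun x => Z n x - Z k x).
  move=> i; rewrite (_ : (fun x => _) = fun x => Z n x ord0 i - Z k x ord0 i)//.
  by apply/funext => x; rewrite !mxE.
have hG (i : 'I_N) : exists g', [/\ measurable_fun D g',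
    forall x B, D x -> (forall n, `|Z n x ord0 i| <= B) -> `|g' x| <= B &
    forall e : R, 0 < e -> exists n0, forall n, (n0 <= n)%N ->
    (\int[mu]_(x in D) (`|Z n x ord0 i - g' x| `^ m x)%:E <= e%:E)%E].
  apply: (modular_complete mD measurable_m m1P (fun n => mZ n i)) => e e0.
  have [n0 hn0] := gradients_cauchy e0; exists n0 => n k n0n n0k.
  have [_ iZ] := finite_modularD (V_finite_modular (Kz n).1)
    (finite_modularN (V_finite_modular (Kz k).1)).
  apply: le_trans (_ : (e%:E <= _)%E); last exact: lexx.
  apply: (@le_trans _ _ (\int[mu]_(x in D) (enorm (Z n x - Z k x) `^ m x)%:E)%E).
    apply: ge0_le_integral => //.
    - by apply: measurable_modular => //; exact: measurable_m.
    - apply/measurable_EFinP/measurable_fun_powR => //; last exact: measurable_m.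
      by apply: measurable_enorm.
    - move=> x Dx; have /andP[a b] := m1P _ Dx; rewrite lee_fin.
      rewrite ge0_ler_powR ?nnegrE ?enorm_ge0//; first lra.
      have -> : Z n x ord0 i - Z k x ord0 i = (Z n x - Z k x) ord0 i by rewrite !mxE.
      exact: ler_norm_enorm.
  by rewrite (integral_itg mD iZ) lee_fin hn0.
have /choice[g hg] := hG.
pose G x : 'rV[R]_N := \row_i g i x.
have mG : coord_measurable D G.
  move=> i; rewrite (_ : (fun x => _) = g i); first by have [] := hg i.
  by apply/funext => x; rewrite mxE.
exists w, G; split; [exact: mw| |exact: mG|exact: hw|].
  by move=> x Dx; apply: (wM x M Dx) => n; exact: (Kz n).2 x Dx.
move=> r r0; pose c : R := (1 + N%:R) `^ P.
have c0 : 0 < c by rewrite powR_gt0// ltr_wpDr.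
pose e := r / (c * (N%:R + 1)).
have e0 : 0 < e by rewrite divr_gt0// mulr_gt0// ltr_wpDl.
have /choice[n0 hn0] i : exists n0, forall n, (n0 <= n)%N ->
    (\int[mu]_(x in D) (`|Z n x ord0 i - g i x| `^ m x)%:E <= e%:E)%E.
  by have [_ _ /(_ _ e0)] := hg i.
exists (\max_i n0 i) => n n0n.
have mgi i : measurable_fun D (fun x => (`|Z n x ord0 i - g i x| `^ m x)%:E).
  have [mgi _ _] := hg i; apply: measurable_modular => //; last exact: measurable_m.
  by apply: measurable_funB => //; exact: mZ.
apply: (@le_trans _ _ (\int[mu]_(x in D)
    (c%:E * \sum_(i < N) (`|Z n x ord0 i - g i x| `^ m x)%:E))%E).
  apply: ge0_le_integral => //.
  - by move=> x Dx; rewrite lee_fin powR_ge0.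
  - apply/measurable_EFinP/measurable_fun_powR => //; last exact: measurable_m.
    apply: measurable_enorm => // i.
    rewrite (_ : (fun x => _) = fun x => Z n x ord0 i - g i x).
      by have [mgi' _ _] := hg i; apply: measurable_funB => //; exact: mZ.
    by apply/funext => x; rewrite !mxE.
  - by apply: measurable_funeM; apply: emeasurable_sum.
  - move=> x Dx; rewrite sumEFin -EFinM lee_fin.
    have := enorm_powR_le_sum (Z n x - G x) Dx; rewrite -/c => /le_trans; apply.
    by rewrite ler_wpM2l ?(ltW c0)//; apply: ler_sum => i _; rewrite !mxE.
rewrite ge0_integralZl//; first last.
- by rewrite lee_fin ltW.
- by move=> x Dx; apply: sume_ge0 => i _; rewrite lee_fin powR_ge0.
- exact: emeasurable_sum.
rewrite ge0_integral_sum//.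
apply: (@le_trans _ _ (c%:E * \sum_(i < N) e%:E)%E).
  rewrite lee_wpmul2l ?lee_fin ?(ltW c0)//; apply: lee_sum => i _.
  by apply: hn0; apply: leq_trans n0n; exact: leq_bigmax.
rewrite sumEFin -EFinM lee_fin sumr_const card_ord -[_ *+ _]mulr_natr.
rewrite (_ : c * (e * N%:R) = N%:R * (r / (N%:R + 1))).
  by apply: mul_div_succ_le => //; exact: ltW.
by rewrite /e; field; rewrite !gt_eqF// ltr_wpDl.
Qed.

End limit_of_minimizing_sequence.

Lemma P_gt1 : 1 < P.
Proof. exact: lt_le_trans p0P. Qed.

Lemma measurable_norm_powR_m (u : T -> R) : measurable_fun D u ->
  measurable_fun D (fun x => `|u x| `^ m x).
Proof.
by move=> mu'; apply/measurable_EFinP/measurable_modular => //; exact: measurable_m.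
Qed.

Lemma measurable_enorm_powR_m F : coord_measurable D F ->
  measurable_fun D (fun x => enorm (F x) `^ m x).
Proof.
move=> mF; apply: measurable_fun_powR => //; last exact: measurable_m.
exact: measurable_enorm.
Qed.

(** [powR_small] is integrated with an s for which s vD is small, and c compensates [s ^ (- P)]. The
    resulting bound r / 2 leaves room for the two powers in [Phi]. *)
Lemma modular_small (r : R) : 0 < r -> exists2 c : R, 0 < c &
  (forall u : T -> R, measurable_fun D u -> itg mu D (fun x => `|u x| `^ m x) ->
    \int[mu]_(x in D) (`|u x| `^ m x) <= c ->
    itg mu D (fun x => `|u x|) /\ \int[mu]_(x in D) `|u x| <= r) /\
  (forall H, finite_modular H ->
    \int[mu]_(x in D) (enorm (H x) `^ m x) <= c -> Phi H <= r).
Proof.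
move=> r0; have r4 : 0 < r / 4 by rewrite divr_gt0.
have v1 : 0 < vD + 1 by rewrite ltr_wpDl// vD_ge0.
pose s := Num.min 1 (r / 4 / (vD + 1)).
have s0 : 0 < s by rewrite lt_min ltr01 divr_gt0.
have s01 : 0 < s <= 1 by rewrite s0 ge_min lexx.
have sv : s * vD <= r / 4.
  apply: le_trans (mul_div_succ_le (ltW r4) vD_ge0).
  by rewrite mulrC ler_wpM2l ?vD_ge0// ge_min lexx orbT.
clearbody s.
have sP := powR_gt0 (- P) s0.
have sVs : s `^ (- P) * (r / 4 / s `^ (- P)) = r / 4 by rewrite mulrC divfK ?gt_eqF.
exists (r / 4 / s `^ (- P)); first by rewrite divr_gt0.
have main (I : R) : I <= r / 4 / s `^ (- P) -> s * vD + s `^ (- P) * I <= r / 2.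
  move=> /(ler_wpM2l (ltW sP)); rewrite sVs => h.
  by rewrite (_ : r / 2 = r / 4 + r / 4); [exact: lerD|field].
have ics := @itg_cst _ _ _ mu D mD Dfin s.
split=> [u mu' iu hu|H [mH iH] hH].
  have ic := itgZ mD (s `^ (- P)) iu.
  have pw x : D x -> `|u x| <= s + s `^ (- P) * `|u x| `^ m x.
    move=> Dx; have [_ _ _ /andP[a a'] _] := exps Dx.
    have := @powR_small _ 1 (m x) P s `|u x| (lexx _).
    by rewrite (ltW a) a' powRr1// => /(_ isT s01); apply.
  have iu1 : itg mu D (fun x => `|u x|).
    apply: (itg_le mD (g := fun x => s + s `^ (- P) * `|u x| `^ m x)).
    - exact: measurableT_comp.
    - exact: itgD.
    - by move=> x Dx; rewrite normr_id pw.
  split=> //; apply: (@le_trans _ _ (r / 2)); last first.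
    by rewrite ler_pdivrMr// ler_peMr ?(ltW r0)// ler1n.
  apply: le_trans (main _ hu).
  rewrite -integral_cst_D -(integralZ_itg mD)// -(integralD_itg mD)//.
  by apply: le_itg => //; exact: itgD.
have ic := itgZ mD (s `^ (- P)) iH.
have isum : itg mu D (fun x => s + s `^ (- P) * enorm (H x) `^ m x) by exact: itgD.
have i2 := itgZ mD 2 isum.
apply: (@le_trans _ _ (2 * (r / 2))); last first.
  by rewrite mulrC divfK.
apply: le_trans (ler_wpM2l _ (main _ hH)) => //.
rewrite -integral_cst_D -(integralZ_itg mD)// -(integralD_itg mD)// -(integralZ_itg mD)//.
apply: le_itg => //; first exact: itg_dens.
move=> x Dx; have [/andP[a a'] /andP[b b'] _ /andP[c c'] _] := exps Dx.
have key p : 1 < p -> p <= m x -> enorm (H x) `^ p / p <= s + s `^ (- P) * enorm (H x) `^ m x.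
  move=> p1' pm; apply: le_trans (powR_div_le (powR_ge0 _ _) (ltW p1')) _.
  by apply: powR_small => //; [exact: ltW|rewrite pm|exact: enorm_ge0].
rewrite mulr_natl mulr2n; apply: lerD; apply: key => //.
  by rewrite le_max lexx.
by rewrite le_max lexx orbT.
Qed.

(* [s] is chosen such that [(1 - s) `^ (1 - P) = 1 + delta]. *)
Lemma Phi_upper_continuous (B r : R) : 0 < r -> 0 <= B -> exists2 c : R, 0 < c &
  forall Y H, finite_modular Y -> finite_modular H -> Phi Y <= B -> Phi H <= c ->
    Phi (fun x => Y x + H x) <= Phi Y + r.
Proof.
move=> r0 B0; have r2 : 0 < r / 2 by rewrite divr_gt0.
pose dl := r / 2 / (B + 1); have dl0 : 0 < dl by rewrite divr_gt0// ltr_wpDl.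
have dlB : B * dl <= r / 2 by apply: mul_div_succ_le => //; exact: ltW.
clearbody dl.
have P1 : 0 < P - 1 by rewrite subr_gt0 P_gt1.
pose t := (1 + dl) `^ (- (P - 1)^-1).
have t0 : 0 < t by rewrite powR_gt0// ltr_wpDl.
have t1 : t < 1.
  rewrite /t powRN invf_lt1 ?powR_gt0 ?ltr_wpDl// -[ltLHS](powR1l (P - 1)^-1).
  by rewrite gt0_ltr_powR ?invr_gt0 ?nnegrE ?ltrDl// ltW// ltr_wpDl.
have tE : t `^ (1 - P) = 1 + dl.
  rewrite /t -powRrM mulNr -mulrN opprB mulVf ?gt_eqF// powRr1//.
  by rewrite ltW// ltr_wpDl.
clearbody t.
have s01 : 0 < 1 - t < 1 by rewrite subr_gt0 t1 ltrBlDr ltrDl.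
have sP : 0 < (1 - t) `^ (1 - P) by rewrite powR_gt0//; case/andP: s01.
exists (r / 2 / (1 - t) `^ (1 - P)); first by rewrite divr_gt0.
move=> Y H fY fH YB Hc; apply: le_trans (Phi_add_le fY fH s01) _.
have -> : 1 - (1 - t) = t by rewrite opprB addrC subrK.
rewrite tE mulrDl mul1r -addrA lerD2l [leRHS](splitr r); apply: lerD.
  by apply: le_trans dlB; rewrite mulrC ler_wpM2r// ltW.
by rewrite mulrC -ler_pdivlMr.
Qed.

(** Truncation costs arbitrarily little. Hence variations of the minimizer need not respect the
    bound M. *)
Lemma I0_le_V f F : V f F -> I0 <= en f F.
Proof.
move=> Vf; apply/ler_addgt0Pr => e e0.
have [g [H [Vg gM gf]]] := V_trunc Vf e0.
exact: le_trans (I0_le (conj Vg gM)) gf.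
Qed.

Definition gradT F H x :=
  (enorm (F x) `^ (p1 x - 2) + enorm (F x) `^ (p2 x - 2)) * dot (F x) (H x).
Definition potT (h f g : T -> R) x := `|f x| `^ (h x - 2) * f x * g x.

(** The base 1 + |F| is at least 1, so that the exponents p1 - 1 and p2 - 1 may be raised to m - 1,
    and [powR_mul_small] applies. For small s the first term is a small multiple of a fixed
    integrable function. *)
Lemma gradT_le F H (s : R) x : D x -> 0 < s <= 1 ->
  `|gradT F H x| <=
  2 * (s * (1 + enorm (F x)) `^ m x + s `^ (1 - P) * enorm (H x) `^ m x).
Proof.
move=> Dx s01; have [/andP[a a'] /andP[b b'] _ /andP[c c'] _] := exps Dx.
have F0 := enorm_ge0 (F x); have H0 := enorm_ge0 (H x).
have F1 : 1 <= 1 + enorm (F x) by rewrite lerDl.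
have F1' : 0 <= 1 + enorm (F x) by rewrite addr_ge0.
have key p : 1 < p -> p <= m x -> `|enorm (F x) `^ (p - 2) * dot (F x) (H x)| <=
    s * (1 + enorm (F x)) `^ m x + s `^ (1 - P) * enorm (H x) `^ m x.
  move=> p1' pm; have m1 : 1 <= m x <= P by rewrite (ltW c).
  apply: le_trans (powR_mul_small m1 F1' H0 s01).
  rewrite normrM (ger0_norm (powR_ge0 _ _)).
  have [->|Fx0] := eqVneq (F x) 0.
    by rewrite dot0l normr0 mulr0 mulr_ge0// powR_ge0.
  apply: (@le_trans _ _ (enorm (F x) `^ (p - 2) * (enorm (F x) * enorm (H x)))).
    by rewrite ler_wpM2l ?powR_ge0// norm_dot_le.
  rewrite mulrA ler_wpM2r//.
  have -> : enorm (F x) `^ (p - 2) * enorm (F x) = enorm (F x) `^ (p - 1).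
    rewrite -[X in _ * X]powRr1// -powRD; last by rewrite enorm_eq0 Fx0 implybT.
    by congr (_ `^ _); ring.
  apply: (@le_trans _ _ ((1 + enorm (F x)) `^ (p - 1))).
    by rewrite ge0_ler_powR ?nnegrE// ?lerDr// subr_ge0 ltW.
  by rewrite ler_powR// lerD2r.
have j1 : p1 x <= m x by rewrite /m le_max lexx.
have j2 : p2 x <= m x by rewrite /m le_max lexx orbT.
by rewrite /gradT mulrDl; exact: (normrD_le_double (key _ a j1) (key _ b j2)).
Qed.

Lemma measurable_gradT F H : coord_measurable D F -> coord_measurable D H ->
  measurable_fun D (gradT F H).
Proof.
move=> mF mH; apply: measurable_funM; last exact: measurable_dot.
by apply: measurable_funD; apply: measurable_fun_powR => //;
  try exact: measurable_enorm; apply: measurable_funB.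
Qed.

Lemma measurable_potT (h f g : T -> R) : measurable_fun D h -> measurable_fun D f ->
  measurable_fun D g -> measurable_fun D (potT h f g).
Proof.
move=> mh mf mg; apply: measurable_funM => //; apply: measurable_funM => //.
apply: measurable_fun_powR => //; first exact: measurableT_comp.
exact: measurable_funB.
Qed.

Lemma itg_enorm1_powR F (c : R) : 1 <= c -> finite_modular F ->
  itg mu D (fun x => (c + enorm (F x)) `^ m x).
Proof.
move=> c1 [mF iF]; have ic := @itg_cst _ _ _ mu D mD Dfin 1.
have isum := itgD mD ic iF; have iZ := itgZ mD ((2 * c) `^ P) isum.
apply: (itg_le mD _ iZ).
  apply: measurable_fun_powR => //; last exact: measurable_m.
  by apply: measurable_funD => //; exact: measurable_enorm.
move=> x Dx; have [_ _ _ /andP[a a'] _] := exps Dx.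
by rewrite ger0_norm ?powR_ge0// powRD_le// ?enorm_ge0// (ltW a).
Qed.

Lemma itg_gradT F H : finite_modular F -> finite_modular H -> itg mu D (gradT F H).
Proof.
move=> fF fH; have i1 := itg_enorm1_powR (lexx 1) fF; have [mH iH] := fH.
have isum := itgD mD i1 iH; have iZ := itgZ mD 2 isum.
apply: (itg_le mD _ iZ); first by apply: measurable_gradT => //; exact: fF.1.
move=> x Dx; have := @gradT_le F H 1 x Dx; rewrite ltr01 lexx => /(_ isT).
by rewrite powR1l !mul1r.
Qed.

Lemma potT_le (h f g : T -> R) (A : R) x : 1 < h x <= P -> 1 <= A ->
  `|f x| <= A -> `|potT h f g x| <= A `^ (P - 1) * `|g x|.
Proof. by move=> hP A1 fA; rewrite normrM ler_wpM2r// norm_powR_mul_le. Qed.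

Lemma itg_potT (h f g : T -> R) (A : R) : measurable_fun D h ->
  (forall x, D x -> 1 < h x <= P) -> 1 <= A ->
  measurable_fun D f -> (forall x, D x -> `|f x| <= A) ->
  measurable_fun D g -> itg mu D (fun x => `|g x|) -> itg mu D (potT h f g).
Proof.
move=> mh hP A1 mf fA mg ig; have iZ := itgZ mD (A `^ (P - 1)) ig.
apply: (itg_le mD _ iZ); first exact: measurable_potT.
by move=> x Dx; apply: potT_le => //; [exact: hP|exact: fA].
Qed.

(** The tangent inequality at the new point: the increment of a convex function is at most t times
    its derivative there. *)
Lemma dens_slope x (t : R) xi eta : D x ->
  dens x (xi + t *: eta) - dens x xi <=
  t * ((enorm (xi + t *: eta) `^ (p1 x - 2) + enorm (xi + t *: eta) `^ (p2 x - 2))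
       * dot (xi + t *: eta) eta).
Proof.
move=> Dx; have [/andP[a a'] /andP[b b'] _ _ _] := exps Dx.
have key p : 1 < p -> enorm (xi + t *: eta) `^ p / p - enorm xi `^ p / p <=
    t * (enorm (xi + t *: eta) `^ (p - 2) * dot (xi + t *: eta) eta).
  move=> p1'; have p'0 : 0 < p by exact: lt_trans ltr01 p1'.
  have := enorm_powR_tangent (xi + t *: eta) xi p1'.
  have -> : xi - (xi + t *: eta) = (- t) *: eta by rewrite opprD addrA subrr add0r scaleNr.
  rewrite dotZr -mulrBl ler_pdivrMr//.
  move: (_ `^ (p - 2)) (dot _ _) (_ `^ p) (_ `^ p) => k d' u v; lra.
rewrite /dens opprD addrACA mulrDl mulrDr.
by apply: lerD; apply: key.
Qed.

(** The concave m-term is bounded by its derivative at the old point, the convex q-term by its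
    derivative at the new one. *)
Lemma pot_slope x (t a b : R) : D x ->
  pot x (a + t * b) - pot x a <=
  t * (- lam * (`|a| `^ (m x - 2) * a * b)
       + `|a + t * b| `^ (q x - 2) * (a + t * b) * b).
Proof.
move=> Dx; have [_ _ /andP[q1 _] /andP[m1 _] _] := exps Dx.
have key p (y z : R) : 1 < p -> `|y| `^ p / p - `|z| `^ p / p <=
    - (`|y| `^ (p - 2) * y * (z - y)).
  move=> p1'; have p'0 : 0 < p by exact: lt_trans ltr01 p1'.
  have := powR_norm_tangent y z p1'; rewrite -mulrBl ler_pdivrMr//.
  move: (_ * (z - y)) (_ `^ p) (_ `^ p) => k u v; lra.
have h1 := key (m x) a (a + t * b) m1; have h2 := key (q x) (a + t * b) a q1.
have h1' := ler_wpM2l lam0 h1.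
rewrite (_ : a + t * b - a = t * b) in h1'; last by ring.
rewrite (_ : a - (a + t * b) = - (t * b)) in h2; last by ring.
rewrite /pot; move: h1' h2; move: (_ `^ (m x - 2)) (_ `^ (q x - 2)) (_ / m x) (_ / m x) (_ / q x) (_ / q x).
by move=> k1 k2 u1 u2 u3 u4; lra.
Qed.

(** * The Euler-Lagrange equation for the limit *)

Section euler_lagrange.
Implicit Types (v : T -> R) (H : T -> 'rV[R]_N).
Variables (z : nat -> T -> R) (Z : nat -> T -> 'rV[R]_N).
Variables (w : T -> R) (G : T -> 'rV[R]_N).
Hypothesis Kz : forall n, admissible (z n) (Z n).
Hypothesis z_min : forall r : R, 0 < r -> exists n0, forall n, (n0 <= n)%N ->
  en (z n) (Z n) <= I0 + r.
Hypotheses (mw : measurable_fun D w) (wM : forall x, D x -> `|w x| <= M).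
Hypothesis mG : coord_measurable D G.
Hypothesis zw : forall r : R, 0 < r -> exists n0, forall n, (n0 <= n)%N ->
  (\int[mu]_(x in D) (`|z n x - w x| `^ m x)%:E <= r%:E)%E.
Hypothesis ZG : forall r : R, 0 < r -> exists n0, forall n, (n0 <= n)%N ->
  (\int[mu]_(x in D) (enorm (Z n x - G x) `^ m x)%:E <= r%:E)%E.

Lemma limit_approximation (r : R) : 0 < r -> exists n0, forall n, (n0 <= n)%N ->
  [/\ \int[mu]_(x in D) `|z n x - w x| <= r, finite_modular (fun x => Z n x - G x) &
      Phi (fun x => Z n x - G x) <= r].
Proof.
move=> r0; have [c c0 [hc1 hc2]] := modular_small r0.
have [n0 hn0] := zw c0; have [n1 hn1] := ZG c0.
exists (maxn n0 n1) => n; rewrite geq_max => /andP[n0n n1n].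
have mzw : measurable_fun D (fun x => z n x - w x).
  by apply: measurable_funB => //; exact: (V_measurable (Kz n).1).1.
have mZG : coord_measurable D (fun x => Z n x - G x).
  by apply: coord_measurableB mG; exact: (V_measurable (Kz n).1).2.
have [iz zc] := itg_ge0 mD (measurable_norm_powR_m mzw)
  (fun x _ => powR_ge0 _ _) (hn0 _ n0n).
have [iZ Zc] := itg_ge0 mD (measurable_enorm_powR_m mZG)
  (fun x _ => powR_ge0 _ _) (hn1 _ n1n).
have [_ h1] := hc1 _ mzw iz zc.
by split=> //; exact: (hc2 _ (conj mZG iZ) Zc).
Qed.

Lemma limit_finite_modular : finite_modular G.
Proof.
have [n0 hn0] := limit_approximation ltr01; have [_ fZG _] := hn0 _ (leqnn n0).
have := finite_modularD (V_finite_modular (Kz n0).1) (finite_modularN fZG).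
by congr finite_modular; apply/funext => x; rewrite opprB addrC subrK.
Qed.

(** [Phi_upper_continuous] is used twice: at G, to bound [Phi (Z n)], and then, thanks to this
    bound, at [Z n] with the small perturbation G - Z n, to get [Phi G] below [Phi (Z n) + r / 3].
    Lower semicontinuity thus comes from upper continuity that is uniform on bounded energies. *)
Lemma limit_energy_le : en w G <= I0.
Proof.
have fG := limit_finite_modular.
have [cG cG0 hcG] := Phi_upper_continuous ltr01 (Phi_ge0 G).
have B0 : 0 <= Phi G + 1 by rewrite addr_ge0// Phi_ge0.
apply/ler_addgt0Pr => r r0; have r3 : 0 < r / 3 by rewrite divr_gt0.
have [c c0 hc] := Phi_upper_continuous r3 B0.
have L0 := potL_ge0 M.
have r3L : 0 < r / 3 / (potL M + 1) by rewrite divr_gt0// ltr_wpDl.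
pose e := Num.min (Num.min cG c) (r / 3 / (potL M + 1)).
have e0 : 0 < e by rewrite !lt_min cG0 c0.
have [n0 hn0] := limit_approximation e0; have [n1 hn1] := z_min r3.
pose n := maxn n0 n1.
have [zn fZn Zn] := hn0 n (leq_maxl _ _); have en_n := hn1 n (leq_maxr _ _).
have ecG : e <= cG by rewrite /e !ge_min lexx.
have ec : e <= c by rewrite /e !ge_min lexx orbT.
have eL : e <= r / 3 / (potL M + 1) by rewrite /e !ge_min lexx !orbT.
have PZ : Phi (Z n) <= Phi G + 1.
  have := hcG G _ fG fZn (lexx _) (le_trans Zn ecG).
  rewrite (_ : (fun x => G x + (Z n x - G x)) = Z n)//.
  by apply/funext => x; rewrite addrC subrK.
have fGZ : finite_modular (fun x => G x - Z n x).
  have := finite_modularN fZn.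
  by congr finite_modular; apply/funext => x; rewrite opprB.
have PhiN : Phi (fun x => G x - Z n x) = Phi (fun x => Z n x - G x).
  by apply: eq_Rintegral => x _; rewrite /dens enormB.
have GE : Phi G = Phi (fun x => Z n x + (G x - Z n x)).
  by apply: eq_Rintegral => x _; rewrite [in RHS]addrC subrK.
have hP : Phi G <= Phi (Z n) + r / 3.
  rewrite GE; apply: (hc (Z n) _ (V_finite_modular (Kz n).1) fGZ PZ).
  rewrite PhiN; exact: le_trans Zn ec.
have [mz _] := V_measurable (Kz n).1.
have hL : Lo w <= Lo (z n) + r / 3.
  apply: le_trans (Lo_le M1 mw wM mz (Kz n).2) _; rewrite lerD2l.
  rewrite (_ : \int[mu]_(x in D) _ = \int[mu]_(x in D) `|z n x - w x|); last first.
    by apply: eq_Rintegral => x _; rewrite distrC.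
  apply: le_trans (ler_wpM2l L0 (le_trans zn eL)) _.
  exact: mul_div_succ_le (ltW r3) L0.
apply: le_trans (lerD hP hL) _.
rewrite addrACA; apply: le_trans (lerD en_n (lexx _)) _.
rewrite -addrA lerD2l le_eqVlt; apply/orP; left; apply/eqP.
by field.
Qed.

(** The limit need not belong to V, so the lower bound is taken at [z n + t * v] and carried over.
    These sums may leave [-M, M]; hence [I0_le_V] and a Lipschitz constant on the larger interval
    [-2 A, 2 A]. *)
Lemma limit_energy_ge v H (t : R) : V v H ->
  I0 <= en (fun x => w x + t * v x) (fun x => G x + t *: H x).
Proof.
move=> Vv; have fG := limit_finite_modular.
have Vzv n : V (fun x => z n x + t * v x) (fun x => Z n x + t *: H x).
  have := V_lin 1 t (Kz n).1 Vv.
  by congr V; apply/funext => x; rewrite ?mul1r ?scale1r.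
have V0v : V (fun x => t * v x) (fun x => t *: H x).
  have := V_lin t 0 Vv Vv.
  by congr V; apply/funext => x; rewrite ?mul0r ?scale0r addr0.
have [A [A1 MA] vA] := V_bound (2 * M) V0v.
have A2 : 1 <= 2 * A by rewrite (le_trans A1)// ler_peMl ?ler1n// (le_trans ler01).
have bd (f : T -> R) x : D x -> `|f x| <= M -> `|f x + t * v x| <= 2 * A.
  move=> Dx fM; apply: le_trans (ler_normD _ _) _.
  rewrite mulr_natl mulr2n; apply: lerD; last exact: vA.
  apply: le_trans fM _; apply: le_trans MA; rewrite ler_peMl ?ler1n//.
  exact: le_trans ler01 M1.
have fY : finite_modular (fun x => G x + t *: H x).
  exact: finite_modularD fG (V_finite_modular V0v).
apply/ler_addgt0Pr => r r0; have r2 : 0 < r / 2 by rewrite divr_gt0.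
have [c c0 hc] := Phi_upper_continuous r2 (Phi_ge0 (fun x => G x + t *: H x)).
have L0 := potL_ge0 (2 * A).
have r2L : 0 < r / 2 / (potL (2 * A) + 1) by rewrite divr_gt0// ltr_wpDl.
pose e := Num.min c (r / 2 / (potL (2 * A) + 1)).
have e0 : 0 < e by rewrite !lt_min c0.
have ec : e <= c by rewrite /e !ge_min lexx.
have eL : e <= r / 2 / (potL (2 * A) + 1) by rewrite /e !ge_min lexx !orbT.
have [n hn] := limit_approximation e0; have {hn} [zn fZn Zn] := hn n (leqnn n).
apply: le_trans (I0_le_V (Vzv n)) _.
have hP : Phi (fun x => Z n x + t *: H x) <= Phi (fun x => G x + t *: H x) + r / 2.
  have := hc _ _ fY fZn (lexx _) (le_trans Zn ec).
  rewrite (_ : (fun x => _ + (Z n x - G x)) = (fun x => Z n x + t *: H x))//.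
  by apply/funext => x; rewrite addrC addrA subrK.
have [mzv _] := V_measurable (Vzv n); have [mtv _] := V_measurable V0v.
have mwv : measurable_fun D (fun x => w x + t * v x) by exact: measurable_funD.
have hL : Lo (fun x => z n x + t * v x) <= Lo (fun x => w x + t * v x) + r / 2.
  have := @Lo_le (2 * A) _ _ A2 mzv _ mwv _.
  move=> /(_ (fun x Dx => bd (z n) x Dx ((Kz n).2 x Dx)) (fun x Dx => bd w x Dx (wM Dx))).
  move=> /le_trans; apply; rewrite lerD2l.
  rewrite (_ : \int[mu]_(x in D) _ = \int[mu]_(x in D) `|z n x - w x|); last first.
    apply: eq_Rintegral => x _; congr `|_|; by ring.
  apply: le_trans (ler_wpM2l L0 (le_trans zn eL)) _.
  exact: mul_div_succ_le (ltW r2) L0.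
by apply: le_trans (lerD hP hL) _; rewrite addrACA lerD2l -splitr.
Qed.

(** For t > 0 the difference quotient of the energy at the minimizer is nonnegative, and
    [dens_slope] and [pot_slope] bound it from above by the integral of [g t]. Dominated convergence
    along t = 1 / (n + 1) leads to t = 0. *)
Lemma euler_lagrange_ge0 v H : V v H ->
  0 <= \int[mu]_(x in D) (gradT G H x - lam * potT m w v x + potT q w v x).
Proof.
move=> Vv; have fG := limit_finite_modular; have [B hB] := V_bounded Vv.
have [mv mH] := V_measurable Vv; have fH := V_finite_modular Vv.
pose g t x := gradT (fun x => G x + t *: H x) H x - lam * potT m w v x
  + potT q (fun x => w x + t * v x) v x.
have V0v t : V (fun x => t * v x) (fun x => t *: H x).
  have := V_lin t 0 Vv Vv.
  by congr V; apply/funext => x; rewrite ?mul0r ?scale0r addr0.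
have fGt t : finite_modular (fun x => G x + t *: H x).
  exact: finite_modularD fG (V_finite_modular (V0v t)).
have mwt t : measurable_fun D (fun x => w x + t * v x).
  by apply: measurable_funD => //; exact: measurable_funM.
have hm x : D x -> 1 < m x <= P by move=> /exps[].
have hq x : D x -> 1 < q x <= P by move=> /exps[].
have iv : itg mu D (fun x => `|v x|).
  apply: itg_norm; apply: (itg_bounded mD Dfin mv) => x Dx; exact: (hB _ Dx).1.
pose A := M + `|B|; have A1 : 1 <= A by rewrite (le_trans M1)// lerDl.
have wA t x : 0 <= t <= 1 -> D x -> `|w x + t * v x| <= A.
  move=> /andP[t0 t1] Dx; apply: le_trans (ler_normD _ _) _; apply: lerD.
    exact: wM.
  rewrite normrM (ger0_norm t0); apply: (@le_trans _ _ `|v x|).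
    by rewrite ler_piMl.
  exact: le_trans (hB _ Dx).1 (ler_norm _).
have im := itg_potT measurable_m hm M1 mw wM mv iv.
have iq t : 0 <= t <= 1 -> itg mu D (potT q (fun x => w x + t * v x) v).
  move=> t01; apply: (itg_potT mq hq A1 (mwt t) _ mv iv) => x; exact: wA.
have ig t : 0 <= t <= 1 -> itg mu D (g t).
  move=> t01; apply: (itgD mD) (iq _ t01).
  exact: (itgB mD (itg_gradT (fGt t) fH) (itgZ mD lam im)).
have A0 : 0 <= A by exact: le_trans A1.
have slope t : 0 < t <= 1 -> 0 <= \int[mu]_(x in D) g t x.
  move=> /andP[t0 t1]; have t01 : 0 <= t <= 1 by rewrite ltW.
  rewrite -(pmulr_rge0 _ t0) -(integralZ_itg mD); last exact: ig.
  have h0 : en w G <= en (fun x => w x + t * v x) (fun x => G x + t *: H x).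
    exact: le_trans limit_energy_le (limit_energy_ge t Vv).
  have id1 := itg_dens (fGt t); have id0 := itg_dens fG.
  have ip1 : itg mu D (fun x => pot x (w x + t * v x)).
    by apply: (itg_pot A1) => // x; exact: wA.
  have ip0 : itg mu D (fun x => pot x (w x)) by exact: itg_pot M1 mw wM.
  have i1 := itgB mD id1 id0; have i2 := itgB mD ip1 ip0.
  move: h0; rewrite -subr_ge0 /en opprD addrACA.
  rewrite -(integralB_itg mD id1 id0) -(integralB_itg mD ip1 ip0).
  rewrite -(integralD_itg mD i1 i2) => /le_trans; apply; apply: le_itg => //.
  - exact: itgD.
  - by apply: itgZ => //; exact: ig.
  - move=> x Dx; rewrite /g -[X in _ <= t * X]addrA mulrDr; apply: lerD.
      exact: dens_slope.
    by rewrite -mulNr; exact: pot_slope.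
have [i1 i2] : itg mu D (fun x => (A + enorm (G x)) `^ m x) /\
    itg mu D (fun x => enorm (H x) `^ m x).
  by split; [exact: itg_enorm1_powR|exact: fH.2].
(* A bound independent of t in [0, 1], since |H| <= A gives |G + t H| <= |G| + A. *)
pose bnd x := 2 * ((1 + A + enorm (G x)) `^ m x + enorm (H x) `^ m x)
  + (lam * M `^ (P - 1) + A `^ (P - 1)) * `|v x|.
have ib : itg mu D bnd.
  have i3 : itg mu D (fun x => (1 + A + enorm (G x)) `^ m x).
    by apply: itg_enorm1_powR => //; rewrite lerDl.
  have i4 := itgD mD i3 i2.
  by apply: itgD => //; exact: itgZ.
pose t_ n : R := n.+1%:R^-1.
have t01 n : 0 < t_ n <= 1 by rewrite invr_gt0 ltr0n/= invf_le1// ler1n.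
have t01' n : 0 <= t_ n <= 1 by have /andP[/ltW -> ->] := t01 n.
have t_cvg : t_ @ \oo --> (0 : R) by exact: cvg_harmonic.
have gbnd n x : D x -> `|g (t_ n) x| <= bnd x.
  move=> Dx; have /andP[t0 t1] := t01' n; have [_ _ _ /andP[a a'] _] := exps Dx.
  have bE : bnd x = 2 * ((1 + A + enorm (G x)) `^ m x + enorm (H x) `^ m x)
      + lam * (M `^ (P - 1) * `|v x|) + A `^ (P - 1) * `|v x|.
    by rewrite /bnd; ring.
  have m0 : 0 <= m x by exact: le_trans ler01 (ltW a).
  have hn : 1 + enorm (G x + t_ n *: H x) <= 1 + A + enorm (G x).
    rewrite -addrA lerD2l [leRHS]addrC; apply: le_trans (enormD _ _) _.
    rewrite lerD2l enormZ ger0_norm//; apply: (@le_trans _ _ (enorm (H x))).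
      by rewrite ler_piMl// enorm_ge0.
    apply: le_trans (hB _ Dx).2 _; apply: le_trans (ler_norm _) _.
    by rewrite lerDr (le_trans ler01).
  have n0 : 0 <= 1 + enorm (G x + t_ n *: H x) by rewrite addr_ge0// enorm_ge0.
  apply: le_trans (ler_normD _ _) _; rewrite bE; apply: lerD.
    apply: le_trans (ler_normB _ _) _; apply: lerD.
      have := @gradT_le (fun x => G x + t_ n *: H x) H 1 x Dx.
      rewrite ltr01 lexx => /(_ isT)/le_trans; apply.
      rewrite powR1l !mul1r ler_wpM2l// lerD2r.
      exact: (ge0_ler_powR m0 n0 (le_trans n0 hn) hn).
    rewrite normrM (ger0_norm lam0) ler_wpM2l//.
    by apply: potT_le => //; [exact: hm|exact: wM].
  by apply: potT_le; [exact: hq|by []|exact: wA].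
have gcvg x : D x -> g (t_ n) x @[n --> \oo] --> g 0 x.
  move=> Dx.
  have cvl (E : R -> R) (a b : R) : (forall t, E t = a + t * b) -> E (t_ n) @[n --> \oo] --> E 0.
    move=> EE; rewrite (_ : (fun n => _) = (fun n => a + t_ n * b)).
      by rewrite EE; apply: cvgD; [exact: cvg_cst|exact: cvgMr_tmp].
    by apply/funext => n; rewrite EE.
  have dotE t : dot (G x + t *: H x) (H x) = dot (G x) (H x) + t * dot (H x) (H x).
    by rewrite dotDl dotZl.
  have dcvg : dot (G x + t_ n *: H x) (H x) @[n --> \oo] --> dot (G x + 0 *: H x) (H x).
    exact: (cvl (fun t => dot (G x + t *: H x) (H x))) dotE.
  have ncvg : enorm (G x + t_ n *: H x) @[n --> \oo] --> enorm (G x + 0 *: H x).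
    apply: (@continuous_cvg _ _ _ _ _
      (fun n => dot (G x + t_ n *: H x) (G x + t_ n *: H x)) (@Num.sqrt R)).
      exact: sqrt_continuous.
    rewrite (_ : (fun n => _) = (fun n => dot (G x) (G x)
      + t_ n * (2 * dot (G x) (H x) + t_ n * dot (H x) (H x)))); last first.
      by apply/funext => n; rewrite dotDl !dotDr !(dotZl, dotZr) (dotC (H x) (G x)); ring.
    rewrite scale0r addr0 -[X in _ --> X]addr0; apply: cvgD; first exact: cvg_cst.
    rewrite -(mul0r (2 * dot (G x) (H x) + 0 * dot (H x) (H x))); apply: cvgM => //.
    by apply: cvgD; [exact: cvg_cst|exact: cvgMr_tmp].
  have [/andP[a _] /andP[b _] /andP[c _] _ _] := exps Dx.
  (* [cvg_powR_mul] also covers the points where G vanishes while p - 2 is negative; the bound it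
     asks for is the Cauchy-Schwarz inequality. *)
  have pcvg p : 1 < p -> enorm (G x + t_ n *: H x) `^ (p - 2) * dot (G x + t_ n *: H x) (H x)
      @[n --> \oo] --> enorm (G x + 0 *: H x) `^ (p - 2) * dot (G x + 0 *: H x) (H x).
    move=> p1'; apply: (cvg_powR_mul (c := enorm (H x)) p1') => //.
    - exact: enorm_ge0.
    - by move=> n; exact: enorm_ge0.
    - by move=> n; exact: norm_dot_le.
  have gTcvg : gradT (fun y => G y + t_ n *: H y) H x @[n --> \oo] -->
      gradT (fun y => G y + 0 *: H y) H x.
    have gE F : gradT F H x = enorm (F x) `^ (p1 x - 2) * dot (F x) (H x) +
      enorm (F x) `^ (p2 x - 2) * dot (F x) (H x) by rewrite /gradT mulrDl.
    rewrite gE (_ : (fun n => _) = (fun n =>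
        enorm (G x + t_ n *: H x) `^ (p1 x - 2) * dot (G x + t_ n *: H x) (H x) +
        enorm (G x + t_ n *: H x) `^ (p2 x - 2) * dot (G x + t_ n *: H x) (H x))).
      exact: (cvgD (pcvg _ a) (pcvg _ b)).
    by apply/funext => n; exact: gE.
  have wcvg : w x + t_ n * v x @[n --> \oo] --> w x + 0 * v x.
    exact: (cvl (fun t => w x + t * v x)).
  apply: cvgD; first apply: cvgB.
  - exact: gTcvg.
  - exact: cvg_cst.
  - apply: cvgMr_tmp; apply: (cvg_powR_mul (c := 1) c) => //.
    + by move=> n; rewrite mulr1.
    + exact: cvg_norm.
have := @dominated_convergence _ _ _ mu D mD (fun n x => (g (t_ n) x)%:E)
  (fun x => (g 0 x)%:E) (EFin \o bnd).
case.
- by move=> n; apply/measurable_EFinP; exact: itg_measurable (ig _ (t01' n)).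
- by apply/measurable_EFinP; apply: itg_measurable; apply: ig; rewrite lexx ler01.
- apply: aeW => x Dx; apply: cvg_EFin; first by near=> n.
  exact: gcvg.
- exact: ib.
- by apply: aeW => x n Dx; rewrite /= lee_fin gbnd.
move=> _ _ hcv; rewrite -lee_fin -integral_itg//; last first.
  have := ig 0; rewrite lexx ler01 => /(_ isT).
  rewrite /g; congr (itg mu D _); apply/funext => x.
  by rewrite /gradT /potT scale0r mul0r !addr0.
rewrite [X in (_ <= X)%E](_ : _ = (\int[mu]_(x in D) (g 0 x)%:E)%E); last first.
  apply: eq_integral => x _; rewrite /g /gradT /potT scale0r mul0r !addr0//.
rewrite -(cvg_lim _ hcv)//; apply: lime_ge; first by apply/cvg_ex; eexists; exact: hcv.
near=> n; rewrite /= (integral_itg mD (ig _ (t01' n))) lee_fin.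
exact: slope.
Unshelve. all: by end_near. Qed.

Definition pairing v H := \int[mu]_(x in D) gradT G H x
  - lam * \int[mu]_(x in D) potT m w v x + \int[mu]_(x in D) potT q w v x.

Lemma pairing_itg v H : measurable_fun D v -> itg mu D (fun x => `|v x|) ->
  finite_modular H ->
  [/\ itg mu D (gradT G H), itg mu D (potT m w v) & itg mu D (potT q w v)].
Proof.
move=> mv iv fH; split; first exact: itg_gradT limit_finite_modular fH.
  by apply: (itg_potT measurable_m _ M1 mw wM mv iv) => x /exps[].
by apply: (itg_potT mq _ M1 mw wM mv iv) => x /exps[].
Qed.

Lemma V_itg_norm v H : V v H -> itg mu D (fun x => `|v x|).
Proof.
move=> Vv; have [B hB] := V_bounded Vv; apply: itg_norm.
by apply: (itg_bounded mD Dfin (V_measurable Vv).1) => x Dx; exact: (hB _ Dx).1.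
Qed.

Lemma pairing_V_ge0 v H : V v H -> 0 <= pairing v H.
Proof.
move=> Vv; have := euler_lagrange_ge0 Vv.
have [i1 i2 i3] := pairing_itg (V_measurable Vv).1 (V_itg_norm Vv) (V_finite_modular Vv).
have i4 := itgZ mD lam i2; have i5 := itgB mD i1 i4.
by rewrite (integralD_itg mD i5 i3) (integralB_itg mD i1 i4) (integralZ_itg mD lam i2).
Qed.

(** The inequality holds for v and for -v, and the pairing is odd. *)
Lemma pairing_V v H : V v H -> pairing v H = 0.
Proof.
move=> Vv; have h1 := pairing_V_ge0 Vv.
have [i1 i2 i3] := pairing_itg (V_measurable Vv).1 (V_itg_norm Vv) (V_finite_modular Vv).
have VN : V (fun x => - v x) (fun x => - H x).
  have := V_lin (-1) 0 Vv Vv.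
  by congr V; apply/funext => x; rewrite ?mulN1r ?scaleN1r ?mul0r ?scale0r addr0.
have := pairing_V_ge0 VN.
have -> : pairing (fun x => - v x) (fun x => - H x) = - pairing v H.
  rewrite /pairing (_ : \int[mu]_(x in D) gradT G (fun x => - H x) x =
      -1 * \int[mu]_(x in D) gradT G H x); last first.
    rewrite -(integralZ_itg mD (-1) i1); apply: eq_Rintegral => x _.
    by rewrite /gradT dotNr mulrN mulN1r.
  have potN h : itg mu D (potT h w v) -> \int[mu]_(x in D) potT h w (fun x => - v x) x =
      -1 * \int[mu]_(x in D) potT h w v x.
    move=> ih; rewrite -(integralZ_itg mD (-1) ih); apply: eq_Rintegral => x _.
    by rewrite /potT mulrN mulN1r.
  by rewrite (potN _ i2) (potN _ i3); exact: opp_combination.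
by rewrite oppr_ge0 => h2; apply/eqP; rewrite eq_le h1 h2.
Qed.

(** Continuity at 0 of a linear functional with respect to the modular: in [gradT_le] the choice of
    s makes the fixed part small, and c then the part in H. *)
Lemma gradT_small (r : R) : 0 < r -> exists2 c : R, 0 < c & forall H,
  finite_modular H -> \int[mu]_(x in D) (enorm (H x) `^ m x) <= c ->
  `|\int[mu]_(x in D) gradT G H x| <= r.
Proof.
move=> r0; have fG := limit_finite_modular.
have iG := itg_enorm1_powR (lexx 1) fG.
pose I := \int[mu]_(x in D) ((1 + enorm (G x)) `^ m x).
have I_ge0 : 0 <= I by apply: Rintegral_ge0 => x _; exact: powR_ge0.
have r4 : 0 < r / 4 by rewrite divr_gt0.
have I1 : 0 < I + 1 by rewrite ltr_wpDl.
pose s := Num.min 1 (r / 4 / (I + 1)).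
have s0 : 0 < s by rewrite lt_min ltr01 divr_gt0.
have s01 : 0 < s <= 1 by rewrite s0 ge_min lexx.
have sI : s * I <= r / 4.
  apply: le_trans (mul_div_succ_le (ltW r4) I_ge0).
  by rewrite mulrC ler_wpM2l// ge_min lexx orbT.
clearbody s.
have sP := powR_gt0 (1 - P) s0.
exists (r / 4 / s `^ (1 - P)) => [|H fH hH]; first by rewrite divr_gt0.
have ig := itg_gradT fG fH; have iZ1 := itgZ mD s iG.
have iZ2 := itgZ mD (s `^ (1 - P)) fH.2; have isum := itgD mD iZ1 iZ2.
apply: le_trans (le_normr_Rintegral mD ig) _.
apply: (@le_trans _ _ (2 * (s * I + s `^ (1 - P) *
    \int[mu]_(x in D) (enorm (H x) `^ m x)))).
  rewrite -(integralZ_itg mD _ iG) -(integralZ_itg mD _ fH.2).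
  rewrite -(integralD_itg mD iZ1 iZ2) -(integralZ_itg mD _ isum).
  apply: (le_itg mD (itg_norm ig) (itgZ mD 2 isum)) => x Dx.
  exact: gradT_le.
have h1 : s `^ (1 - P) * \int[mu]_(x in D) (enorm (H x) `^ m x) <= r / 4.
  by rewrite mulrC -ler_pdivlMr.
apply: le_trans (ler_wpM2l _ (lerD sI h1)) _ => //.
by rewrite le_eqVlt; apply/orP; left; apply/eqP; field.
Qed.

(** By linearity only the pairing with (vn - v, Hn - H) remains. Its gradient part is small by
    [gradT_small], its potential parts by the L^1 distance, because |w| <= M. *)
Lemma pairing_closure v H (vn : nat -> T -> R) (Hn : nat -> T -> 'rV[R]_N) :
  measurable_fun D v -> itg mu D (fun x => `|v x| `^ m x) -> finite_modular H ->
  (forall n, V (vn n) (Hn n)) ->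
  (forall r : R, 0 < r -> exists n,
    (\int[mu]_(x in D) (`|vn n x - v x| `^ m x)%:E <= r%:E)%E /\
    (\int[mu]_(x in D) (enorm (Hn n x - H x) `^ m x)%:E <= r%:E)%E) ->
  [/\ itg mu D (gradT G H), itg mu D (potT m w v), itg mu D (potT q w v) &
      pairing v H = 0].
Proof.
move=> mv iv fH Vn cv.
have [c1 c10 [hc1 _]] := modular_small ltr01.
have mvn n := (V_measurable (Vn n)).1; have mHn n := (V_measurable (Vn n)).2.
have mvv n : measurable_fun D (fun x => vn n x - v x) by exact: measurable_funB.
have mHH n : coord_measurable D (fun x => Hn n x - H x).
  exact: (finite_modularD (V_finite_modular (Vn n)) (finite_modularN fH)).1.
have conv r : 0 < r -> exists n, [/\ itg mu D (fun x => `|vn n x - v x|),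
    \int[mu]_(x in D) `|vn n x - v x| <= r, finite_modular (fun x => Hn n x - H x) &
    \int[mu]_(x in D) (enorm (Hn n x - H x) `^ m x) <= r].
  move=> r0; have [c c0 [hc _]] := modular_small r0.
  have [n [h1 h2]] := cv (Num.min c r) ltac:(by rewrite lt_min c0).
  have [i1 {}h1] := itg_ge0 mD (measurable_norm_powR_m (mvv n))
    (fun x _ => powR_ge0 _ _) h1.
  have [i2 {}h2] := itg_ge0 mD (measurable_enorm_powR_m (mHH n))
    (fun x _ => powR_ge0 _ _) h2.
  have mc : Num.min c r <= c by rewrite ge_min lexx.
  have mr : Num.min c r <= r by rewrite ge_min lexx orbT.
  have [i3 h3] := hc _ (mvv n) i1 (le_trans h1 mc).
  by exists n; split; [| | split| exact: le_trans h2 mr].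
have iv1 : itg mu D (fun x => `|v x|).
  have [n [i1 _ _ _]] := conv 1 ltr01.
  have iN := V_itg_norm (Vn n); have isum := itgD mD i1 iN.
  apply: (itg_le mD _ isum); first exact: measurableT_comp.
  move=> x Dx; rewrite normr_id distrC.
  by rewrite -[v x in leLHS](subrK (vn n x)) ler_normD.
have [i1 i2 i3] := pairing_itg mv iv1 fH.
split=> //; apply/eqP; rewrite -normr_le0; apply/ler_addgt0Pr => r r0; rewrite add0r.
have r2 : 0 < r / 2 by rewrite divr_gt0.
have [c c0 hc] := gradT_small r2.
pose L := (lam + 1) * M `^ (P - 1).
have L0 : 0 <= L by exact: potL_ge0.
have rL : 0 < r / 2 / (L + 1) by rewrite divr_gt0// ltr_wpDl.
have [n [j1 hv fE hE]] := conv (Num.min c (r / 2 / (L + 1)))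
  ltac:(by rewrite lt_min c0).
have ec : Num.min c (r / 2 / (L + 1)) <= c by rewrite ge_min lexx.
have eL : Num.min c (r / 2 / (L + 1)) <= r / 2 / (L + 1) by rewrite ge_min lexx orbT.
have [k1 k2 k3] := pairing_itg (mvv n) j1 fE.
have [l1 l2 l3] := pairing_itg (mvn n) (V_itg_norm (Vn n)) (V_finite_modular (Vn n)).
have split_pairing : pairing v H = pairing (vn n) (Hn n)
    - pairing (fun x => vn n x - v x) (fun x => Hn n x - H x).
  have gE : \int[mu]_(x in D) gradT G H x = \int[mu]_(x in D) gradT G (Hn n) x
      - \int[mu]_(x in D) gradT G (fun x => Hn n x - H x) x.
    rewrite -(integralB_itg mD l1 k1); apply: eq_Rintegral => x _.
    by rewrite /gradT dotDr dotNr; ring.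
  have pE h : itg mu D (potT h w (vn n)) -> itg mu D (potT h w (fun x => vn n x - v x)) ->
      \int[mu]_(x in D) potT h w v x = \int[mu]_(x in D) potT h w (vn n) x
      - \int[mu]_(x in D) potT h w (fun x => vn n x - v x) x.
    move=> a b; rewrite -(integralB_itg mD a b); apply: eq_Rintegral => x _.
    by rewrite /potT; ring.
  by rewrite {1}/pairing gE (pE m l2 k2) (pE q l3 k3); exact: sub_combinations.
rewrite split_pairing (pairing_V (Vn n)) sub0r normrN /pairing.
have hg := hc _ fE (le_trans hE ec).
have hpot h : (forall x, D x -> 1 < h x <= P) ->
    itg mu D (potT h w (fun x => vn n x - v x)) ->
    `|\int[mu]_(x in D) potT h w (fun x => vn n x - v x) x| <=
    M `^ (P - 1) * \int[mu]_(x in D) `|vn n x - v x|.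
  move=> hP ih; apply: le_trans (le_normr_Rintegral mD ih) _.
  rewrite -(integralZ_itg mD _ j1).
  apply: (le_itg mD (itg_norm ih) (itgZ mD _ j1)) => x Dx.
  by apply: potT_le; [exact: hP|exact: M1|exact: wM].
have h1 := hpot m (fun x Dx => let: And5 _ _ _ a _ := exps Dx in a) k2.
have h2 := hpot q (fun x Dx => let: And5 _ _ a _ _ := exps Dx in a) k3.
have h3 : L * \int[mu]_(x in D) `|vn n x - v x| <= r / 2.
  apply: le_trans (ler_wpM2l L0 (le_trans hv eL)) _.
  exact: mul_div_succ_le (ltW r2) L0.
rewrite [leRHS](splitr r) -addrA; apply: le_trans (ler_normD _ _) _.
apply: (lerD hg); apply: le_trans h3.
apply: le_trans (ler_normD _ _) _; rewrite normrN normrM (ger0_norm lam0).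
rewrite (_ : L * _ = lam * (M `^ (P - 1) * \int[mu]_(x in D) `|vn n x - v x|)
    + M `^ (P - 1) * \int[mu]_(x in D) `|vn n x - v x|); last by rewrite /L; ring.
exact: lerD (ler_wpM2l lam0 h1) h2.
Qed.

End euler_lagrange.

(** Under the constraint the energy is bounded below, since [Phi] is nonnegative and the potential
    is bounded on [-M, M]. *)
Lemma infimum_of_energy f F : admissible f F -> exists I1 : R,
  (forall g H, admissible g H -> I1 <= en g H) /\
  forall e : R, 0 < e -> exists g H, admissible g H /\ en g H <= I1 + e.
Proof.
move=> Kf; pose E := [set r : R | exists g H, admissible g H /\ r = en g H].
have E_inf : has_inf E.
  split; first by exists (en f F), f, F.
  exists (- (potL M * M * vD)) => _ [g [H [KH ->]]].
  have := Lo_bound KH; rewrite ler_norml => /andP[h _].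
  by rewrite /en -[leLHS]add0r lerD// Phi_ge0.
exists (inf E); split=> [g H KH|e e0].
  by apply: ge_inf; [exact: E_inf.2|exists g, H].
have [_ [g [H [KH ->]]] h] := inf_adherent e0 E_inf.
by exists g, H; split=> //; exact: ltW.
Qed.

End energy.

Section critical_point.
Context d (T : measurableType d) (R : realType).
Variables (mu : {measure set T -> \bar R}) (D : set T).
Hypotheses (mD : measurable D) (Dfin : (mu D < +oo)%E).
Variable N : nat.
Variables (p1 p2 q : T -> R) (p0 P lam : R).
Hypotheses (mp1 : measurable_fun D p1) (mp2 : measurable_fun D p2)
  (mq : measurable_fun D q).
Hypotheses (p01 : 1 < p0) (p0P : p0 <= P) (lam0 : 0 <= lam).

Let m x := Num.max (p1 x) (p2 x).

Hypothesis exponent_bounds : forall x, D x ->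
  [/\ p0 <= p1 x <= P, p0 <= p2 x <= P, p0 <= q x <= P & m x <= q x].

Variable V : (T -> R) -> (T -> 'rV[R]_N) -> Prop.
Hypothesis V_lin : forall (a b : R) f F g G, V f F -> V g G ->
  V (fun x => a * f x + b * g x) (fun x => a *: F x + b *: G x).
Hypothesis V_smabs : forall (c e : R) f F, 0 < e -> V f F ->
  V (fun x => smabs e (f x + c) - smabs e c)
    (fun x => ((f x + c) / smabs e (f x + c)) *: F x).
Hypothesis V_measurable : forall f F, V f F ->
  measurable_fun D f /\ coord_measurable D F.
Hypothesis V_bounded : forall f F, V f F ->
  exists B : R, forall x, D x -> `|f x| <= B /\ enorm (F x) <= B.
Variable M : R.
Hypotheses (M1 : 1 <= M) (hM : forall x, D x -> lam <= M `^ (q x - m x)).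

Definition modular_limit (fn : nat -> T -> R) (Fn : nat -> T -> 'rV[R]_N) f F :=
  forall r : R, 0 < r -> exists n0, forall n, (n0 <= n)%N ->
    (\int[mu]_(x in D) (`|fn n x - f x| `^ m x)%:E <= r%:E)%E /\
    (\int[mu]_(x in D) (enorm (Fn n x - F x) `^ m x)%:E <= r%:E)%E.

Lemma critical_point f0 F0 : V f0 F0 -> en mu D p1 p2 q lam f0 F0 < 0 ->
  exists (w : T -> R) (G : T -> 'rV[R]_N) (z : nat -> T -> R)
    (Z : nat -> T -> 'rV[R]_N), [/\ measurable_fun D w /\ (forall x, D x -> `|w x| <= M),
    finite_modular mu D p1 p2 G, en mu D p1 p2 q lam w G < 0,
    (forall n, V (z n) (Z n)) /\ modular_limit z Z w G &
    forall (v : T -> R) H vn Hn, measurable_fun D v -> itg mu D (fun x => `|v x| `^ m x) ->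
      finite_modular mu D p1 p2 H -> (forall n, V (vn n) (Hn n)) ->
      modular_limit vn Hn v H ->
      [/\ itg mu D (gradT p1 p2 G H), itg mu D (potT m w v),
        itg mu D (potT q w v) & pairing mu D p1 p2 q lam w G v H = 0]].
Proof.
move=> V0 en0; have e0 : 0 < - en mu D p1 p2 q lam f0 F0 / 2.
  by rewrite divr_gt0// oppr_gt0.
have [f1 [F1 [V1 f1M en1]]] := V_trunc mD Dfin mp1 mp2 mq p01 lam0 exponent_bounds
  V_lin V_smabs V_measurable V_bounded M1 hM V0 e0.
have [I1 [I_le I_inf]] := infimum_of_energy mD Dfin mp1 mp2 mq p01 lam0
  exponent_bounds V_measurable V_bounded M1 (conj V1 f1M).
have I1_lt0 : I1 < 0.
  exact: (lt0_of_le_half (I_le _ _ (conj V1 f1M)) en1 en0).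
have [z [Z [Kz z_min z_cauchy]]] := minimizing_sequence mD Dfin mp1 mp2 mq p01 lam0
  exponent_bounds V_lin V_smabs V_measurable V_bounded M1 I_le I_inf.
have [w [G [mw wM mG zw ZG]]] := minimizer_limit mD Dfin mp1 mp2 mq p01 p0P lam0
  exponent_bounds V_lin V_measurable V_bounded M1 I_le Kz z_min z_cauchy.
exists w, G, z, Z; split; [exact: (conj mw wM)| | | |].
- exact: (limit_finite_modular mD Dfin mp1 mp2 p01 exponent_bounds V_measurable
    V_bounded Kz mw mG zw ZG).
- apply: le_lt_trans I1_lt0.
  exact: (limit_energy_le mD Dfin mp1 mp2 mq p01 p0P lam0 exponent_bounds V_measurable
    V_bounded M1 Kz z_min mw wM mG zw ZG).
- split=> [n|r r0]; first exact: (Kz n).1.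
  have [n0 h0] := zw _ r0; have [n1 h1] := ZG _ r0.
  exists (maxn n0 n1) => n; rewrite geq_max => /andP[n0n n1n].
  exact: (conj (h0 _ n0n) (h1 _ n1n)).
- move=> v H vn Hn mv iv fH Vn vnv.
  apply: (pairing_closure mD Dfin mp1 mp2 mq p01 p0P lam0 exponent_bounds V_lin V_smabs
    V_measurable V_bounded M1 hM I_le Kz z_min mw wM mG zw ZG mv iv fH Vn).
  by move=> r r0; have [n0 h] := vnv _ r0; exists n0; exact: h.
Qed.

End critical_point.

(** * Test functions *)

Section smooth_functions.
Context {R : realType} {N : nat}.
Implicit Types (f g : 'rV[R]_N -> R) (x : 'rV[R]_N) (phi psi : R -> R).

Local Notation D_ i f := ('D_(delta_mx ord0 i) f).

Lemma CkS k f : Ck k.+1 f -> Ck k f.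
Proof.
elim: k f => [|k ih] f.
  by move=> [df _] x; exact: differentiable_continuous.
by move=> [df hf]; split=> // i; exact: ih.
Qed.

Lemma Ck_cst k (c : R) : Ck k (fun _ : 'rV[R]_N => c).
Proof.
elim: k c => [|k ih] c /=; first exact: cst_continuous.
split=> [x|i]; first exact: differentiable_cst.
rewrite (_ : D_ i _ = fun=> 0); first exact: ih.
by apply/funext => x; rewrite derive_cst.
Qed.

Lemma Ck_coord k (j : 'I_N) : Ck k (fun x : 'rV[R]_N => x ord0 j).
Proof.
case: k => [|k] /=; first exact: coord_continuous.
split=> [x|i]; first exact: differentiable_coord.
have @f : {linear 'rV[R]_N -> R}.
  by exists (fun x : 'rV[R]_N => x ord0 j); do 2![eexists]; do ?[constructor];
     rewrite ?mxE// => ? *; rewrite ?mxE//; move=> ?; rewrite !mxE.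
rewrite (_ : D_ i _ = fun=> f (delta_mx ord0 i)); first exact: Ck_cst.
apply/funext => x; rewrite deriveE; last exact: differentiable_coord.
by rewrite (diff_lin (f := f))//; exact: coord_continuous.
Qed.

Lemma CkD k f g : Ck k f -> Ck k g -> Ck k (fun x => f x + g x).
Proof.
elim: k f g => [|k ih] f g /=.
  by move=> cf cg x; exact: (cvgD (cf x) (cg x)).
move=> [df hf] [dg hg]; split=> [x|i]; first exact: differentiableD.
rewrite (_ : D_ i _ = fun x => D_ i f x + D_ i g x); first exact: ih.
by apply/funext => x; rewrite (deriveD (f := f) (g := g))//; exact: diff_derivable.
Qed.

Lemma CkM k f g : Ck k f -> Ck k g -> Ck k (fun x => f x * g x).
Proof.
elim: k f g => [|k ih] f g /=.
  by move=> cf cg x; exact: (cvgM (cf x) (cg x)).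
move=> hf hg; have [df pf] := hf; have [dg pg] := hg.
split=> [x|i]; first exact: differentiableM.
rewrite (_ : D_ i _ = fun x => f x * D_ i g x + g x * D_ i f x).
  by apply: CkD; apply: ih => //; exact: CkS.
by apply/funext => x; rewrite (deriveM (f := f) (g := g))//; exact: diff_derivable.
Qed.

(** A coinductive form of smoothness: a set of functions closed under differentiation is exhibited
    in place of formulas for the iterated derivatives. *)
Definition smooth1 phi := exists S : set (R -> R), S phi /\
  forall psi, S psi -> exists2 psi', S psi' & forall t : R, is_derive t (1 : R) psi (psi' t).

Lemma differentiable_comp1 f psi psi' x : differentiable f x ->
  (forall t : R, is_derive t (1 : R) psi (psi' t)) ->
  differentiable (fun x => psi (f x)) x.
Proof.
move=> df dpsi; apply: (@differentiable_comp _ _ _ _ f psi) => //.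
by apply/derivable1_diffP; have [] := dpsi (f x).
Qed.

Lemma derive_comp1 f psi psi' (i : 'I_N) x : differentiable f x ->
  (forall t : R, is_derive t (1 : R) psi (psi' t)) ->
  D_ i (fun x => psi (f x)) x = psi' (f x) * D_ i f x.
Proof.
move=> df dpsi; have dp t : differentiable psi t.
  by apply/derivable1_diffP; have [] := dpsi t.
have dc : differentiable (psi \o f) x by exact: differentiable_comp.
rewrite deriveE// diff_comp//= (diff1E (dp (f x))) derive1E -deriveE//.
by rewrite (@derive_val _ _ _ _ _ _ _ (dpsi (f x))) mulrC.
Qed.

Lemma smooth_comp f phi : smooth f -> smooth1 phi -> smooth (fun x => phi (f x)).
Proof.
move=> sf [S [Sphi hS]] k; elim: k phi Sphi => [|k ih] phi Sphi /=.
  have [psi' _ dphi] := hS _ Sphi => x.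
  have cphi : {for f x, continuous phi}.
    by apply/differentiable_continuous/derivable1_diffP; have [] := dphi (f x).
  exact: continuous_comp (sf 0%N x) cphi.
have [psi' Spsi' dphi] := hS _ Sphi; have [df _] := sf 1%N.
split=> [x|i]; first exact: differentiable_comp1 (df x) dphi.
rewrite (_ : D_ i _ = fun x => psi' (f x) * D_ i f x).
  apply: CkM; first exact: ih Spsi'.
  have [_ h] := sf k.+1; exact: h.
by apply/funext => x; exact: derive_comp1 (df x) dphi.
Qed.

End smooth_functions.

(** * Smooth functions of one real variable *)

Section smooth_functions_of_one_variable.
Context {R : realType}.
Implicit Types (p : {poly R}) (e t c : R).

Lemma is_derive_smabs e t : 0 < e ->
  is_derive t (1 : R) (smabs e) (t / smabs e t).
Proof.
move=> e0; pose p := 'X^2 + (e ^+ 2)%:P.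
have pE s : p.[s] = s ^+ 2 + e ^+ 2 by rewrite !hornerE.
have p0 : 0 < p.[t] by rewrite pE ltr_wpDl ?sqr_ge0// exprn_gt0.
rewrite (_ : smabs e = Num.sqrt \o horner p); last first.
  by apply/funext => s; rewrite /smabs /= pE.
apply: (@is_derive_eq _ _ _ _ _ _ _ _ (is_derive1_comp (is_derive1_sqrt p0) (is_derive_poly p t))).
rewrite /p derivD derivXn derivC addr0 !hornerE /= -/p pE /smabs.
have s0 : Num.sqrt (t ^+ 2 + e ^+ 2) != 0 by rewrite gt_eqF// smabs_gt0.
by field.
Qed.

Lemma is_derive_shift (f : R -> R) c a t : is_derive (t + c) (1 : R) f a ->
  is_derive t (1 : R) (fun t => f (t + c)) a.
Proof.
move=> fa; have := is_derive1_comp (g := fun t => t + c) (b := 1) fa.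
rewrite mulr1; apply; rewrite -[X in is_derive _ _ _ X]addr0.
exact: is_deriveD.
Qed.

Lemma is_derive_smabs_shift e c t : 0 < e ->
  is_derive t (1 : R) (fun t => smabs e (t + c) - smabs e c)
    ((t + c) / smabs e (t + c)).
Proof.
move=> e0; rewrite -[X in is_derive _ _ _ X]subr0; apply: is_deriveB.
by apply: (is_derive_shift (f := smabs e)); exact: is_derive_smabs.
Qed.

(** Polynomials divided by powers of [smabs] are closed under differentiation, and the derivative of
    the function itself is one of them. *)
Lemma smooth1_smabs e c : 0 < e -> smooth1 (fun t => smabs e (t + c) - smabs e c).
Proof.
move=> e0.
pose rat p k t := p.[t + c] * (smabs e (t + c))^-1 ^+ k.
pose S := [set f | (exists p k, f = rat p k) \/
  f = (fun t => smabs e (t + c) - smabs e c)].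
exists S; split; first by right.
move=> _ [[p [k ->]]|->].
  (* The quotient rule, with s^2 + e^2 = [smabs e s ^+ 2] bringing both terms over the power k + 2
     of [smabs]. *)
  pose q := p^`() * ('X^2 + (e ^+ 2)%:P) - k%:R *: ('X * p).
  exists (rat q k.+2); first by left; exists q, k.+2.
  move=> t; apply: (is_derive_shift (f := fun s => p.[s] * (smabs e s)^-1 ^+ k)).
  set s := t + c.
  have s0 : smabs e s != 0 by rewrite gt_eqF// smabs_gt0.
  have dV := is_deriveV s0 (is_derive_smabs s e0).
  have dX := @is_deriveX _ _ _ k _ _ _ dV.
  have dM := is_deriveM (is_derive_poly p s) dX.
  rewrite (_ : (fun s => _) = horner p * (fun y => (smabs e y)^-1) ^+ k); last first.
    by apply/funext => y; rewrite !fctE.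
  apply: (is_derive_eq dM); rewrite /rat -/s /q !(hornerM, hornerD, hornerN, hornerZ, hornerXn, hornerX, hornerC).
  have E : s ^+ 2 + e ^+ 2 = smabs e s ^+ 2 by rewrite smabs_sqr.
  rewrite E !fctE; move: (smabs e s) s0 => u u0.
  case: k {dX dM q} => [|k].
    by rewrite mulr0n !(mul0r, scale0r) /GRing.scale /=; field.
  rewrite succnK; have -> : u^-1 ^+ k.+3 = u^-1 * (u^-1 * (u^-1 * u^-1 ^+ k)).
    by rewrite !exprS.
  have -> : u^-1 ^+ k.+1 = u^-1 * u^-1 ^+ k by rewrite exprS.
  by move: (u^-1 ^+ k) => v; rewrite /GRing.scale /=; field.
exists (rat 'X 1%N); first by left; exists 'X, 1%N.
by move=> t; rewrite /rat hornerX expr1; exact: is_derive_smabs_shift.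
Qed.

Definition expinv t := if 0 < t then expR (- t^-1) else 0.

(** The family closed under differentiation that contains [expinv]. *)
Let expinvp p t := if 0 < t then p.[t^-1] * expR (- t^-1) else 0.

Lemma horner_le_powers p : exists2 C, 0 <= C & forall y : R, 1 <= y -> `|p.[y]| <= C * y ^+ size p.
Proof.
exists (\sum_(i < size p) `|p`_i|); first exact: sumr_ge0.
move=> y y1; rewrite horner_coef mulr_suml; apply: le_trans (ler_norm_sum _ _ _) _.
apply: ler_sum => i _; rewrite normrM ler_wpM2l// ger0_norm ?exprn_ge0 ?(le_trans ler01)//.
by rewrite ler_weXn2l // ltnW.
Qed.

(** With y = 1 / t, the exponential series bounds exp y below by y^(k + 2) / (k + 2)! where k =
    [size p], two powers more than the polynomial needs. The factor t^2 yields the derivative 0 at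
    0. *)
Lemma expinvp_small p : exists2 K, 0 <= K & forall t, t <= 1 -> `|expinvp p t| <= K * t ^+ 2.
Proof.
have [C C0 hC] := horner_le_powers p; pose n := (size p).+1.
have f0 : 0 < n.+1`!%:R :> R by rewrite ltr0n fact_gt0.
exists (C * n.+1`!%:R) => [|t t1]; first by rewrite mulr_ge0// ltW.
rewrite /expinvp; case: ifPn => [t0|_]; last first.
  by rewrite normr0 mulr_ge0 ?sqr_ge0// mulr_ge0// ltW.
have y1 : 1 <= t^-1 by rewrite invf_ge1.
have y0 : 0 < t^-1 by rewrite invr_gt0.
rewrite normrM (ger0_norm (expR_ge0 _)) expRN ler_pdivrMr ?expR_gt0//.
apply: le_trans (hC _ y1) _; rewrite -2!mulrA ler_wpM2l//.
have := expR_ge1Dxn n (ltW y0) => h.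
have {}h : t^-1 ^+ n.+1 / n.+1`!%:R <= expR t^-1 by apply: le_trans h; rewrite lerDr.
rewrite ler_pdivrMr// in h.
have -> : t^-1 ^+ size p = t ^+ 2 * t^-1 ^+ n.+1.
  by rewrite /n !exprS; move: (_ ^+ size p) => v; field; rewrite gt_eqF.
rewrite (_ : _ * expR _ = t ^+ 2 * (expR t^-1 * n.+1`!%:R)); last by ring.
by rewrite ler_wpM2l ?sqr_ge0.
Qed.

Lemma smooth1_expinv : smooth1 expinv.
Proof.
exists [set f | exists p, f = expinvp p]; split.
  exists 1; apply/funext => t; rewrite /expinv /expinvp hornerC mul1r//.
(* For t > 0 the derivative of p(1/t) exp(-1/t) is (p - p')(1/t) t^-2 exp(-1/t). *)
move=> _ [p ->]; pose q := (p - p^`()) * 'X^2.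
exists (expinvp q); first by exists q.
move=> t; have [t0|t0|->] := ltgtP t 0.
- rewrite /expinvp (lt_gtF t0).
  apply: (@near_eq_is_derive _ _ _ (cst 0)).
  near=> s; rewrite /= ifF//; apply/negbTE; rewrite -leNgt ltW//.
  by near: s; exact: lt_nbhsl.
- rewrite /expinvp t0.
  have tn : t != 0 by rewrite gt_eqF.
  have dV : is_derive t (1 : R) (fun s : R => s^-1) (- t ^- 2 *: 1).
    exact: is_deriveV.
  have dp := is_derive1_comp (is_derive_poly p t^-1) dV.
  have dN := is_deriveN dV.
  have de := @is_derive1_comp _ expR (- (fun s : R => s^-1)) t _ _ (is_derive_expR _) dN.
  have dM := is_deriveM dp de.
  apply: (@near_eq_is_derive _ _ _ ((horner p \o (fun s : R => s^-1)) * (expR \o - (fun s : R => s^-1)))).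
    near=> s; rewrite /= ifT//.
    by near: s; exact: lt_nbhsr.
  apply: (is_derive_eq dM); rewrite /q !hornerE /= /GRing.scale /=.
  by rewrite !fctE; field.
(* The difference quotient at 0, where division by zero gives it the value 0, is continuous there by
   the quadratic bound. *)
- apply/is_derive1_caratheodory; exists (fun s => expinvp p s / s).
  have e0 r : expinvp r 0 = 0 by rewrite /expinvp ltxx.
  split=> [s||]; last by rewrite !e0 mul0r.
    rewrite e0 !subr0; have [->|s0] := eqVneq s 0; first by rewrite e0 mulr0.
    by rewrite divfK.
  have [K K0 hK] := expinvp_small p.
  have z0 : (fun s => expinvp p s / s) 0 = 0 by rewrite /= e0 mul0r.
  rewrite /prop_for /continuous_at z0; apply/cvgr0Pnorm_le => e' e'0.
  have K1 : 0 < K + 1 by rewrite ltr_wpDl.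
  near=> s; have [->|s0] := eqVneq s 0; first by rewrite invr0 mulr0 normr0 ltW.
  rewrite normrM normfV ler_pdivrMr ?normr_gt0//.
  have s1 : s <= 1 by rewrite ltW//; near: s; exact: lt_nbhsl.
  apply: le_trans (hK _ s1) _; rewrite -(real_normK (num_real s)) expr2 mulrA ler_wpM2r//.
  have se : `|s| <= e' / (K + 1).
    rewrite ler_norml; apply/andP; split; apply: ltW; near: s.
      by apply: lt_nbhsr; rewrite oppr_lt0 divr_gt0.
    by apply: lt_nbhsl; rewrite divr_gt0.
  apply: le_trans (ler_wpM2l K0 se) _; exact: mul_div_succ_le (ltW e'0) K0.
Unshelve. all: by end_near. Qed.

End smooth_functions_of_one_variable.

(** * Measurability and Lebesgue measure in R^N *)

Section measurability_rV.
Context {R : realType} {N : nat}.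
Local Open Scope ring_scope.
Implicit Types (U : set 'rV[R]_N) (x y : 'rV[R]_N).

Lemma ball_rV x y (e : R) : 0 < e -> 
  (forall i, ball (x ord0 i) e (y ord0 i)) -> ball x e y.
Proof.
by move=> e0 h; split=> // i j; rewrite ord1; exact: h.
Qed.

Lemma ball_rV_coord x y (e : R) i : ball x e y -> ball (x ord0 i) e (y ord0 i).
Proof. by case. Qed.

Lemma measurable_box_rV (A : 'I_N -> set R) : (forall i, measurable (A i)) ->
  measurable [set x : 'rV[R]_N | forall i, A i (x ord0 i)].
Proof.
move=> mA; rewrite (_ : [set x | _] = \bigcap_(i in [set: 'I_N])
    ((fun x : 'rV[R]_N => x ord0 i) @^-1` A i)); last first.
  by apply/seteqP; split=> x /= Ax i; [move=> _|]; exact: Ax.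
apply: fin_bigcap_measurable => // i _.
by rewrite -[X in measurable X]setTI; exact: measurable_coord.
Qed.

(** The sigma-algebra is generated by the coordinates, so U is written as the union of the boxes
    with rational centre and radius 1 / (k + 1) that it contains, enumerated by [unpickle]. *)
Lemma open_measurable_rV U : open U -> measurable U.
Proof.
move=> oU; pose box (a : 'rV[rat]_N) (k : nat) : set 'rV[R]_N :=
  [set x | forall i, ball (ratr (a ord0 i) : R) k.+1%:R^-1 (x ord0 i)].
pose B n : set 'rV[R]_N := if unpickle n is Some (a, k) then
  if `[< box a k `<=` U >] then box a k else set0 else set0.
rewrite (_ : U = \bigcup_n B n); last first.
  apply/seteqP; split=> [x Ux|x [n _]]; last first.
    rewrite /B; case: (unpickle n) => [[a k]|//].
    by case: ifPn => // /asboolP; exact.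
  have /nbhs_ballP[e /= e0 xeU] : nbhs x U by exact: open_nbhs_nbhs.
  have [k ke] : exists k : nat, k.+1%:R^-1 < e / 2.
    have [k] := ltr_add_invr (divr_gt0 e0 (ltr0Sn R 1)).
    by rewrite add0r; exists k.
  have /choice[a ha] : forall i : 'I_N, exists a : rat,
      ball (ratr a : R) k.+1%:R^-1 (x ord0 i).
    move=> i; have [|a] := @rat_in_itvoo R (x ord0 i - k.+1%:R^-1) (x ord0 i + k.+1%:R^-1).
      by rewrite ltrD2l gtrN// invr_gt0.
    rewrite in_itv /= => ha; exists a.
    by rewrite -ball_normE /= distrC ltr_distlC.
  exists (pickle (\row_i a i, k)) => //; rewrite /B pickleK.
  have -> : `[< box (\row_i a i) k `<=` U >].
    apply/asboolP => y yb; apply: xeU; apply: ball_rV => // j.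
    have /ball_sym hx := ha j.
    have := yb j; rewrite mxE => hy.
    by apply: le_ball (ball_triangle hx hy); rewrite (splitr e) lerD// ltW.
  by move=> i; rewrite mxE.
apply: bigcupT_measurable => n; rewrite /B; case: (unpickle n) => [[a k]|]; last exact: measurable0.
case: ifP => _; last exact: measurable0.
apply: (@measurable_box_rV (fun i => ball (ratr (a ord0 i) : R) k.+1%:R^-1)) => i.
exact: measurable_ball.
Qed.

Lemma continuous_measurable_rV (f : 'rV[R]_N -> R) : continuous f ->
  measurable_fun setT f.
Proof.
move=> cf; apply: (measurability _ (RGenOpens.measurableE R)) => _ [_ [a [b ->] <-]].
rewrite setTI; apply: open_measurable_rV.
by move/continuousP: cf; apply; exact: interval_open.
Qed.

Lemma within_continuous_measurable_rV (U A : set 'rV[R]_N) (f : 'rV[R]_N -> R) :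
  open U -> U `<=` A -> {within A, continuous f} -> measurable_fun U f.
Proof.
move=> oU UA cf; apply: (measurability _ (RGenOpens.measurableE R)) => _ [_ [a [b ->] <-]].
have cU : {within U, continuous f} by exact: continuous_subspaceW cf.
have {}cU : {in U, continuous f} by rewrite -continuous_open_subspace.
apply: open_measurable_rV; rewrite openE => x [Ux fx].
rewrite /interior; apply: filterI; first exact: open_nbhs_nbhs.
apply: (cU x); first by rewrite inE.
by apply: open_nbhs_nbhs; split=> //; exact: interval_open.
Qed.

Lemma bounded_setP_rV U : bounded_set U ->
  exists2 r : R, 0 < r & forall x, U x -> `|x| <= r.
Proof.
move=> [M [_ hM]]; exists (`|M| + 1); first by rewrite ltr_wpDl.
by apply: hM; rewrite (le_lt_trans (ler_norm _))// ltrDl.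
Qed.

Lemma compact_closure_bounded U : bounded_set U -> compact (closure U).
Proof.
move=> /bounded_setP_rV[r r0 Ur].
have cl : closed [set x : 'rV[R]_N | `|x| <= r].
  apply: (@closed_comp _ _ (fun x : 'rV[R]_N => `|x|)) (@closed_le _ r) => x _.
  exact: norm_continuous.
apply: bounded_closed_compact; last exact: closed_closure.
exists r; split; first exact: num_real.
move=> s rs x Ux; apply: le_trans (ltW rs).
have Ub : U `<=` [set x : 'rV[R]_N | `|x| <= r] by exact: Ur.
by have := closure_subset Ub; rewrite -((closure_id _).1 cl); exact.
Qed.

Lemma lebesgue_rV_ball x (e : R) : 0 < e ->
  lebesgue_rV N (ball x e) = ((e *+ 2) ^+ N)%:E.
Proof.
move=> e0; rewrite (_ : ball x e = [set y | forall i, ball (x ord0 i) e (y ord0 i)]).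
  rewrite (lebesgue_rV_box (A := fun i => ball (x ord0 i) e)); last by move=> i; exact: measurable_ball.
  under eq_bigr do rewrite (lebesgue_measure_ball _ (ltW e0)).
  by rewrite prodEFin prodr_const card_ord.
apply/seteqP; split=> y /=; last exact: ball_rV.
by move=> xy i; exact: ball_rV_coord.
Qed.

Lemma lebesgue_rV_bounded U : measurable U -> bounded_set U -> (lebesgue_rV N U < +oo)%E.
Proof.
move=> mU /bounded_setP_rV[r r0 Ur].
have r1 : 0 < r + 1 by rewrite addr_gt0.
apply: (@le_lt_trans _ _ (lebesgue_rV N (ball (0 : 'rV[R]_N) (r + 1)))).
  apply: le_measure; rewrite ?inE//.
    by apply: open_measurable_rV; exact: ball_open.
  by move=> x /Ur xr; rewrite -ball_normE /= sub0r normrN (le_lt_trans xr)// ltrDl.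
by rewrite lebesgue_rV_ball// ltry.
Qed.

Lemma compact_bound_rV U (f : 'rV[R]_N -> R) : compact U -> {within U, continuous f} ->
  exists2 B, 0 <= B & forall x, U x -> `|f x| <= B.
Proof.
move=> cU cf; have [M [_ hM]] := compact_bounded (continuous_compact cf cU).
exists (`|M| + 1); first by rewrite addr_ge0.
move=> x Ux; apply: (hM (`|M| + 1)); last by exists x.
by rewrite (le_lt_trans (ler_norm _))// ltrDl.
Qed.

End measurability_rV.

(** * Operations on test functions, and a bump function *)

Section test_functions.
Context {R : realType} {N : nat}.
Variable Omega : set 'rV[R]_N.
Implicit Types (f g h : 'rV[R]_N -> R) (x : 'rV[R]_N).

Lemma smooth_lin (a b : R) f g : smooth f -> smooth g ->
  smooth (fun x => a * f x + b * g x).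
Proof.
by move=> sf sg k; apply: CkD; apply: CkM => //; exact: Ck_cst.
Qed.

Lemma smooth_sum (I : Type) (s : seq I) (F : I -> 'rV[R]_N -> R) :
  (forall i, smooth (F i)) -> smooth (fun x => \sum_(i <- s) F i x).
Proof.
move=> sF; elim: s => [|i s ih] k.
  by rewrite (_ : (fun x => _) = fun=> 0); [exact: Ck_cst|apply/funext => x; rewrite big_nil].
rewrite (_ : (fun x => _) = (fun x => F i x + \sum_(i <- s) F i x)).
  by apply: CkD; [exact: sF|exact: ih].
by apply/funext => x; rewrite big_cons.
Qed.

Lemma test_function_of_compact K h : smooth h -> compact K -> K `<=` Omega ->
  (forall x, h x != 0 -> K x) -> test_function Omega h.
Proof.
move=> sh cK KO hK.
have clK : closed K by apply: compact_closed => //; exact: norm_hausdorff.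
have sub : closure [set x | h x != 0] `<=` K.
  by have := @closure_subset _ [set x | h x != 0] K hK; rewrite -((closure_id _).1 clK).
split=> //; last exact: subset_trans KO.
by apply: subclosed_compact cK sub; exact: closed_closure.
Qed.

Lemma test_function_support f x : f x != 0 -> closure [set x | f x != 0] x.
Proof. by move=> fx; exact: subset_closure. Qed.

Lemma test_function_lin (a b : R) f g : test_function Omega f ->
  test_function Omega g -> test_function Omega (fun x => a * f x + b * g x).
Proof.
move=> [sf cf fO] [sg cg gO].
apply: (test_function_of_compact (smooth_lin a b sf sg) (compactU cf cg)).
  by move=> x [/fO|/gO].
move=> x fg0; have [f0|f0] := eqVneq (f x) 0; last first.
  by left; exact: test_function_support.
right; apply: test_function_support; apply: contra_neq fg0 => g0.
by rewrite f0 g0 !mulr0 addr0.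
Qed.

Lemma test_function_comp f phi : test_function Omega f -> smooth1 phi ->
  phi 0 = 0 -> test_function Omega (fun x => phi (f x)).
Proof.
move=> [sf cf fO] sphi phi0.
apply: (test_function_of_compact (smooth_comp sf sphi) cf fO) => x.
by move=> h; apply: test_function_support; apply: contra_neq h => ->.
Qed.

Lemma grad_lin (a b : R) f g x : smooth f -> smooth g ->
  grad (fun x => a * f x + b * g x) x = a *: grad f x + b *: grad g x.
Proof.
move=> sf sg; apply/rowP => i; rewrite !mxE.
have df : derivable f x (delta_mx ord0 i) by apply: diff_derivable; exact: (sf 1%N).1.
have dg : derivable g x (delta_mx ord0 i) by apply: diff_derivable; exact: (sg 1%N).1.
have := deriveD (derivableZ (k := a) df) (derivableZ (k := b) dg).
by rewrite (deriveZ _ df) (deriveZ _ dg); exact: id.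
Qed.

Lemma grad_comp f phi phi' x : smooth f ->
  (forall t : R, is_derive t (1 : R) phi (phi' t)) ->
  grad (fun x => phi (f x)) x = phi' (f x) *: grad f x.
Proof.
move=> sf dphi; apply/rowP => i; rewrite !mxE.
exact: derive_comp1 ((sf 1%N).1 x) dphi.
Qed.

Lemma test_function_measurable f : smooth f ->
  measurable_fun Omega f /\ coord_measurable Omega (grad f).
Proof.
move=> sf; have mc h : continuous h -> measurable_fun Omega h.
  by move=> ch; exact: measurable_funTS (continuous_measurable_rV ch).
split; first exact: mc (sf 0%N).
move=> i; rewrite (_ : (fun x => _) = 'D_(delta_mx ord0 i) f).
  by apply: mc; exact: (sf 1%N).2.
by apply/funext => x; rewrite mxE.
Qed.

Lemma test_function_bounded f : bounded_set Omega -> smooth f ->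
  exists B : R, forall x, Omega x -> `|f x| <= B /\ enorm (grad f x) <= B.
Proof.
move=> bO sf; have cO := compact_closure_bounded bO.
have bc h : continuous h -> exists B, 0 <= B /\ forall x, Omega x -> `|h x| <= B.
  move=> ch; have [B B0 hB] := compact_bound_rV cO (continuous_subspaceT ch).
  by exists B; split=> // x Ox; apply: hB; exact: subset_closure.
have [B [B0 hB]] := bc _ (sf 0%N).
have /choice[C hC] : forall i : 'I_N, exists C, 0 <= C /\
    forall x, Omega x -> `|'D_(delta_mx ord0 i) f x| <= C.
  by move=> i; apply: bc; exact: (sf 1%N).2.
have C0 : 0 <= \sum_i C i by apply: sumr_ge0 => i _; exact: (hC i).1.
exists (B + \sum_i C i) => x Ox; split; first by rewrite (le_trans (hB x Ox))// lerDl.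
apply: (le_trans (enorm_le_sum _)); apply: (@le_trans _ _ (\sum_i C i)); last by rewrite lerDr.
by apply: ler_sum => i _; rewrite mxE; exact: (hC i).2.
Qed.

(** Compose [expinv] with (r / 2)^2 - |x - x0|^2, which is a polynomial for the Euclidean norm. The
    result vanishes off a cube of half side r / 2, which lies inside the sup-norm ball of radius r;
    c is half the value at x0. *)
Lemma bump_function x0 : open Omega -> Omega x0 ->
  exists f (c e : R), [/\ test_function Omega f, 0 < c, 0 < e,
    ball x0 e `<=` Omega & forall x, ball x0 e x -> c <= f x].
Proof.
move=> oO Ox0.
have /nbhs_ballP[r /= r0 rO] : nbhs x0 Omega by exact: open_nbhs_nbhs.
have r2 : 0 < r / 2 by rewrite divr_gt0.
pose s x : R := \sum_(i < N) (x ord0 i + - x0 ord0 i) * (x ord0 i + - x0 ord0 i).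
have ss : smooth s.
  by apply: smooth_sum => i k; apply: CkM; apply: CkD; first [exact: Ck_coord|exact: Ck_cst].
pose g x : R := (-1) * s x + 1 * (r / 2) ^+ 2.
have sg : smooth g by apply: smooth_lin => // k; exact: Ck_cst.
pose f x := expinv (g x).
have sf : smooth f by exact: smooth_comp sg smooth1_expinv.
pose K : set 'rV[R]_N := [set x | forall i, `[x0 ord0 i - r / 2, x0 ord0 i + r / 2]%classic (x ord0 i)].
have cK : compact K.
  apply: (@rV_compact _ _ (fun i => `[x0 ord0 i - r / 2, x0 ord0 i + r / 2]%classic)) => i.
  exact: segment_compact.
have KO : K `<=` Omega.
  move=> x Kx; apply: rO; apply: ball_rV => // i.
  have := Kx i; rewrite /= in_itv /= => /andP[h1 h2].
  by rewrite -ball_normE /= ltr_distlC; apply/andP; split; lra.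
have tf : test_function Omega f.
  apply: test_function_of_compact sf cK KO _ => x fx i.
  have gx : 0 < g x by move: fx; rewrite /f /expinv; case: ifP => //; rewrite eqxx.
  have : (x ord0 i - x0 ord0 i) ^+ 2 <= (r / 2) ^+ 2.
    apply: (@le_trans _ _ (s x)); last by move: gx; rewrite /g; lra.
    by rewrite /s (bigD1 i)//= -expr2 lerDl sumr_ge0// => j _; rewrite -expr2 sqr_ge0.
  rewrite -[leLHS]real_normK ?num_real// ler_pXn2r ?nnegrE//; last exact: ltW.
  by rewrite ler_norml /= in_itv /= => /andP[h1 h2]; apply/andP; split; lra.
have f0 : 0 < f x0.
  have -> : f x0 = expinv ((r / 2) ^+ 2).
    rewrite /f /g /s big1 ?mulr0 ?add0r ?mul1r// => i _.
    by rewrite subrr mulr0.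
  by rewrite /expinv exprn_gt0// expR_gt0.
have f2 : f x0 / 2 < f x0 by rewrite gtr_pMr// invf_lt1// ltr1n.
have /nbhs_ballP[e /= e0 he] : nbhs x0 [set x | f x0 / 2 < f x].
  exact: (cvgr_gt _ (sf 0%N x0)) f2.
exists f, (f x0 / 2), (Num.min r e); split=> //.
- by rewrite divr_gt0.
- by rewrite lt_min r0.
- by move=> x xr; apply: rO; apply: le_ball xr; rewrite ge_min lexx.
- move=> x xe; apply/ltW/he; apply: le_ball xe; rewrite ge_min lexx orbT//.
Qed.

End test_functions.

(** * The Luxemburg norm *)

Section ereal_limits.
Context {R : realType}.

Lemma cvge0P (X : (\bar R)^nat) : (forall n, 0 <= X n)%E ->
  X n @[n --> \oo] --> 0%E <->
  forall e : R, 0 < e -> exists n0, forall n, (n0 <= n)%N -> (X n <= e%:E)%E.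
Proof.
move=> X0; split=> [/fine_cvgP[Xfin Xcvg] e e0|h].
  move/cvgrPdist_le: Xcvg => /(_ _ e0) Xcvg; have [n0 _ h] := filterI Xfin Xcvg.
  exists n0 => n /h[/= Xn]; rewrite sub0r normrN => fXn.
  by rewrite -(fineK Xn) lee_fin (le_trans (ler_norm _)).
have Xfin n e : (X n <= e%:E)%E -> X n \is a fin_num.
  by move=> Xe; rewrite ge0_fin_numE// (le_lt_trans Xe)// ltry.
apply/fine_cvgP; split.
  by have [n0 hn0] := h _ ltr01; exists n0 => // n /hn0; exact: Xfin.
apply/cvgrPdist_le => e e0; have [n0 hn0] := h _ e0.
exists n0 => // n /hn0 Xe; rewrite /= sub0r normrN ger0_norm ?fine_ge0//.
by rewrite -lee_fin fineK// (Xfin _ _ Xe).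
Qed.

End ereal_limits.

Section luxemburg_norm.
Context {R : realType} {N : nat}.
Variables (Omega : set 'rV[R]_N) (h : 'rV[R]_N -> R) (P : R).
Hypotheses (mO : measurable Omega) (mh : measurable_fun Omega h).
Hypothesis h1P : forall x, Omega x -> 1 < h x <= P.
Implicit Types u : 'rV[R]_N -> R.

Lemma luxemburg_ge0 u : (0 <= luxemburg Omega h u)%E.
Proof.
by apply: le_ereal_inf_tmp => _ [mu [mu0 _] <-]; rewrite lee_fin ltW.
Qed.

Lemma modular_scale u (a b : R) : measurable_fun Omega u -> 0 <= b ->
  (forall x, Omega x -> `|a * u x| `^ h x <= b * `|u x| `^ h x) ->
  (modular Omega h (fun x => a * u x)%R <= b%:E * modular Omega h u)%E.
Proof.
move=> mu b0 hb; have mod_ge0 x : Omega x -> (0 <= (`|u x| `^ h x)%:E)%E.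
  by rewrite lee_fin powR_ge0.
rewrite /modular -(ge0_integralZl _ mO (measurable_modular mO mu mh) mod_ge0)//.
apply: ge0_le_integral => //.
- by apply: (measurable_modular mO _ mh); exact: measurable_funM.
- by apply: measurable_funeM; exact: (measurable_modular mO mu mh).
Qed.

(** t itself is admissible: dividing by t <= 1 multiplies the modular by at most [t ^ (- P)]. *)
Lemma luxemburg_le u (t : R) : measurable_fun Omega u -> 0 < t <= 1 ->
  (modular Omega h u <= (t `^ P)%:E)%E -> (luxemburg Omega h u <= t%:E)%E.
Proof.
move=> mu /andP[t0 t1] ut; apply: ereal_inf_lbound; exists t => //; split=> //.
have b0 : 0 <= t `^ (- P) by exact: powR_ge0.
have t0' := ltW t0.
have hb x : Omega x -> `|t^-1 * u x| `^ h x <= t `^ (- P) * `|u x| `^ h x.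
  move=> /h1P/andP[h1 hP]; rewrite normrM powRM// ler_wpM2r ?powR_ge0//.
  rewrite ger0_norm ?invr_ge0// -powR_inv1// -powRrM mulN1r.
  by rewrite ger_powR ?t0// lerN2.
rewrite (_ : (fun x => u x / t) = (fun x => t^-1 * u x)); last first.
  by apply/funext => x; rewrite mulrC.
apply: (le_trans (modular_scale mu b0 hb)).
apply: (le_trans (lee_wpmul2l _ ut)); first by rewrite lee_fin.
rewrite -EFinM -powRD; last by rewrite (gt_eqF t0) implybT.
by rewrite addNr powRr0.
Qed.

(** For an admissible s < t, write u = s (u / s); since s <= 1, the modular is at most s times that
    of u / s. *)
Lemma modular_le u (t : R) : measurable_fun Omega u -> 0 < t <= 1 ->
  (luxemburg Omega h u < t%:E)%E -> (modular Omega h u <= t%:E)%E.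
Proof.
move=> mu /andP[t0 t1] /ereal_inf_lt[_ [s [s0 us] <-]]; rewrite lte_fin => st.
have s1 : s <= 1 by rewrite (le_trans (ltW st)).
have hb x : Omega x -> `|s * (u x / s)| `^ h x <= s * `|u x / s| `^ h x.
  move=> /h1P/andP[h1 hP]; rewrite normrM powRM// ler_wpM2r ?powR_ge0//.
  by rewrite gtr0_norm// -[leRHS]powRr1 ?(ltW s0)// ger_powR ?s0// ltW.
have msu : measurable_fun Omega (fun x => u x / s) by exact: measurable_funM.
have := modular_scale msu (ltW s0) hb.
rewrite (_ : (fun x => s * (u x / s)) = u); last first.
  by apply/funext => x; rewrite mulrC divfK// gt_eqF.
move=> /le_trans; apply; apply: (@le_trans _ _ (s%:E * 1)%E).
  by apply: lee_wpmul2l us; rewrite lee_fin ltW.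
by rewrite mule1 lee_fin ltW.
Qed.

(** The bridge between [W01], which is stated with norms, and the variational part, which works with
    modulars; boundedness of the exponent makes the two agree. *)
Lemma luxemburg_cvg0P (un : nat -> 'rV[R]_N -> R) :
  (forall n, measurable_fun Omega (un n)) ->
  luxemburg Omega h (un n) @[n --> \oo] --> 0%E <->
  forall r : R, 0 < r -> exists n0, forall n, (n0 <= n)%N ->
    (modular Omega h (un n) <= r%:E)%E.
Proof.
move=> mun; rewrite cvge0P; last by move=> n; exact: luxemburg_ge0.
split=> hc r r0.
  pose t := Num.min (r / 2) 2^-1.
  have t0 : 0 < t by rewrite lt_min invr_gt0 ltr0n divr_gt0.
  have [n0 hn0] := hc _ t0; exists n0 => n /hn0 unt.
  (* The factor 2 provides the strict inequality in [modular_le]. *)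
  have t2 : 0 < 2 * t <= 1.
    rewrite mulr_gt0//= -ler_pdivlMl// mulr1.
    by rewrite ge_min lexx orbT.
  apply: (@le_trans _ _ (2 * t)%:E).
    apply: modular_le => //; apply: (le_lt_trans unt).
    by rewrite lte_fin ltr_pMl// ltr1n.
  by rewrite lee_fin -ler_pdivlMl// mulrC ge_min lexx.
pose t := Num.min r 1.
have t0 : 0 < t by rewrite lt_min r0 ltr01.
have [n0 hn0] := hc _ (powR_gt0 P t0); exists n0 => n /hn0 unt.
apply: (@le_trans _ _ t%:E); last by rewrite lee_fin ge_min lexx.
by apply: luxemburg_le => //; rewrite t0 ge_min lexx orbT.
Qed.

End luxemburg_norm.

Lemma measurable_fun_rV_coord (R : realType) d (T : measurableType d) N (D : set T)
    (G : T -> 'rV[R]_N) : measurable D ->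
  measurable_fun D G <-> coord_measurable D G.
Proof.
move=> mD; split=> [mG i|mG].
  exact: (measurableT_comp (measurable_coord i) mG).
(* [measurable_fun_rVP] concerns functions measurable on the whole space, so G is replaced by 0 off
   D. *)
pose G' x : 'rV[R]_N := \row_i ((fun x => G x ord0 i) \_ D) x.
have mG' : measurable_fun setT G'.
  apply: measurable_fun_rVP => i; rewrite (_ : (fun x => _) = (fun x => G x ord0 i) \_ D).
    exact/(measurable_restrictT _ mD).
  by apply/funext => x; rewrite mxE.
apply: (eq_measurable_fun G' _ (measurable_funTS mG')) => x.
by rewrite inE => Dx; apply/rowP => i; rewrite mxE patchE mem_set.
Qed.

(** * Existence of a nontrivial weak solution *)

Section exponents.
Context {R : realType} {N : nat}.
Variable Omega : set 'rV[R]_N.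
Hypothesis bO : bounded_set Omega.
Implicit Types h : 'rV[R]_N -> R.

Lemma exponent_ub h : exponent Omega h -> exists B, forall x, Omega x -> h x <= B.
Proof.
move=> [ch _]; have [B _ hB] := compact_bound_rV (compact_closure_bounded bO) ch.
exists B => x Ox; apply: (le_trans (ler_norm _)).
by apply: hB; exact: subset_closure.
Qed.

(** 1 / (h - 1) is continuous on the compact closure, hence bounded, which keeps h uniformly away
    from 1. *)
Lemma exponent_lb h : exponent Omega h ->
  exists2 p0, 1 < p0 & forall x, Omega x -> p0 <= h x.
Proof.
move=> [ch h1]; have ci : {within closure Omega, continuous (fun x => (h x - 1)^-1)}.
  move/subspace_continuousP: ch => ch; apply/subspace_continuousP => x Ox.
  apply: cvgV; first by rewrite subr_eq0 gt_eqF// h1.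
  by apply: cvgB; [exact: ch|exact: cvg_cst].
have [B B0 hB] := compact_bound_rV (compact_closure_bounded bO) ci.
exists (1 + (B + 1)^-1); first by rewrite ltrDl invr_gt0 ltr_wpDl.
move=> x Ox; have Ox' := @subset_closure _ Omega _ Ox.
have hx : 0 < h x - 1 by rewrite subr_gt0 h1.
have hi : 0 < (h x - 1)^-1 by rewrite invr_gt0.
have B1 : 0 < B + 1 by rewrite ltr_wpDl.
rewrite -lerBrDl -[leRHS]invrK lef_pV2//.
by apply: (le_trans (ler_norm _)); apply: (le_trans (hB _ Ox')); rewrite lerDl.
Qed.

Lemma exponent_measurable h : open Omega -> exponent Omega h -> measurable_fun Omega h.
Proof.
by move=> oO [ch _]; apply: within_continuous_measurable_rV ch => //; exact: subset_closure.
Qed.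

(** The bounds on q and m ensure that [inf] and [sup] do not take their default values. *)
Lemma exp_gap (m q : 'rV[R]_N -> R) (B x : _) :
  (forall x, Omega x -> 0 <= q x) -> (forall x, Omega x -> m x <= B) ->
  Omega x -> exp_inf Omega q - exp_sup Omega m <= q x - m x.
Proof.
move=> q0 mB Ox; apply: lerB.
  apply: ge_inf; last by exists x.
  by exists 0 => _ [y Oy <-]; exact: q0.
apply: sup_ubound; last by exists x.
by exists B => _ [y Oy <-]; exact: mB.
Qed.

End exponents.

(** * Test functions as an instance of the abstract class, and negative energy *)

Section test_function_energy.
Context {R : realType} {N : nat}.
Variable Omega : set 'rV[R]_N.
Hypotheses (oO : open Omega) (bO : bounded_set Omega).
Variables (p1 p2 q : 'rV[R]_N -> R) (p0 P : R).
Hypotheses (mp1 : measurable_fun Omega p1) (mp2 : measurable_fun Omega p2)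
  (mq : measurable_fun Omega q).
Hypotheses (p01 : 1 < p0).

Let m x := Num.max (p1 x) (p2 x).

Hypothesis exponent_bounds : forall x, Omega x ->
  [/\ p0 <= p1 x <= P, p0 <= p2 x <= P, p0 <= q x <= P & m x <= q x].

Local Notation leb := (lebesgue_rV N).

Definition test_pair (f : 'rV[R]_N -> R) (F : 'rV[R]_N -> 'rV[R]_N) :=
  test_function Omega f /\ F = grad f.

Lemma test_pair_lin (a b : R) f F g G : test_pair f F -> test_pair g G ->
  test_pair (fun x => a * f x + b * g x) (fun x => a *: F x + b *: G x).
Proof.
move=> [tf ->] [tg ->]; split; first exact: test_function_lin.
have [sf _ _] := tf; have [sg _ _] := tg.
by apply/funext => x; rewrite grad_lin.
Qed.

Lemma test_pair_smabs (c e : R) f F : 0 < e -> test_pair f F ->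
  test_pair (fun x => smabs e (f x + c) - smabs e c)
    (fun x => ((f x + c) / smabs e (f x + c)) *: F x).
Proof.
move=> e0 [tf ->]; split.
  apply: (test_function_comp tf (smooth1_smabs c e0)).
  by rewrite add0r subrr.
have [sf _ _] := tf; apply/funext => x.
by rewrite (grad_comp x sf (fun t => is_derive_smabs_shift c t e0)).
Qed.

Lemma test_pair_measurable f F : test_pair f F ->
  measurable_fun Omega f /\ coord_measurable Omega F.
Proof. by move=> [[sf _ _] ->]; exact: test_function_measurable. Qed.

Lemma test_pair_bounded f F : test_pair f F ->
  exists B : R, forall x, Omega x -> `|f x| <= B /\ enorm (F x) <= B.
Proof. by move=> [[sf _ _] ->]; exact: test_function_bounded. Qed.

Let mO : measurable Omega := open_measurable_rV oO.

Lemma itg_norm_powR_div (h f : 'rV[R]_N -> R) F : measurable_fun Omega h ->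
  (forall x, Omega x -> 1 < h x <= P) -> test_pair f F ->
  itg leb Omega (fun x => `|f x| `^ h x / h x).
Proof.
move=> mh h1P tf; have [B hB] := test_pair_bounded tf.
have [mf _] := test_pair_measurable tf.
apply: (itg_bounded mO (lebesgue_rV_bounded mO bO) (C := (1 + `|B|) `^ P)).
  apply: (measurable_powR_div mO) => //; last exact: measurableT_comp.
  by move=> x /h1P/andP[h1 _]; rewrite ltW// (lt_trans ltr01).
move=> x Ox; have /andP[h1 hP] := h1P _ Ox; have [fB _] := hB _ Ox.
have h0 : 0 <= h x by rewrite ltW// (lt_trans ltr01).
have B1 : 1 <= 1 + `|B| by rewrite lerDl.
have fB1 : `|f x| <= 1 + `|B|.
  by rewrite (le_trans fB)// (le_trans (ler_norm _))// lerDr.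
rewrite ger0_norm ?divr_ge0 ?powR_ge0//.
apply: (le_trans (powR_div_le (powR_ge0 _ _) (ltW h1))).
apply: (@le_trans _ _ ((1 + `|B|) `^ h x)); last by rewrite ler_powR.
by rewrite ge0_ler_powR ?nnegrE// (le_trans ler01).
Qed.

Lemma bump_energy_gt0 (h f : 'rV[R]_N -> R) F (c e : R) x0 : measurable_fun Omega h ->
  (forall x, Omega x -> 1 < h x <= P) -> test_pair f F -> 0 < c -> 0 < e ->
  ball x0 e `<=` Omega -> (forall x, ball x0 e x -> c <= f x) ->
  0 < \int[leb]_(x in Omega) (`|f x| `^ h x / h x).
Proof.
move=> mh h1P tf c0 e0 eO cf; have ip := itg_norm_powR_div mh h1P tf.
have mb : measurable (ball x0 e) by apply: open_measurable_rV; exact: ball_open.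
have Ox0 : Omega x0 by apply: eO; exact: ballxx.
have P0 : 0 < P by have /andP[a b] := h1P _ Ox0; rewrite (lt_le_trans _ b)// (lt_trans ltr01).
(* As [Num.min c 1] is at most 1, its power h x is at least its power P. *)
pose k := Num.min c 1 `^ P / P.
have c10 : 0 < Num.min c 1 by rewrite lt_min c0 ltr01.
have c11 : Num.min c 1 <= 1 by rewrite ge_min lexx orbT.
have k0 : 0 < k by rewrite divr_gt0// powR_gt0.
rewrite -lte_fin -(integral_itg mO ip).
apply: (@lt_le_trans _ _ (\int[leb]_(x in ball x0 e) k%:E)%E).
  by rewrite integral_cst// lebesgue_rV_ball// -EFinM lte_fin mulr_gt0// exprn_gt0// pmulrn_lgt0.
apply: (@le_trans _ _ (\int[leb]_(x in ball x0 e) (`|f x| `^ h x / h x)%:E)%E).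
  apply: ge0_le_integral => //.
  - by move=> x _; rewrite lee_fin ltW.
  - by apply/measurable_EFinP; exact: measurable_funS mO eO (itg_measurable ip).
  - move=> x xe; have /andP[h1 hP] := h1P _ (eO _ xe); rewrite lee_fin.
    have h0 : 0 < h x by rewrite (lt_trans ltr01).
    have fx : Num.min c 1 <= `|f x|.
      by rewrite (le_trans _ (ler_norm _))// (le_trans _ (cf _ xe))// ge_min lexx.
    apply: ler_pM; rewrite ?powR_ge0 ?invr_ge0 ?(ltW P0)//; last by rewrite lef_pV2.
    apply: (@le_trans _ _ (Num.min c 1 `^ h x)).
      by rewrite ger_powR ?c10.
    by rewrite ge0_ler_powR ?nnegrE ?normr_ge0 ?(ltW h0) ?(ltW c10).
apply: ge0_subset_integral => //.
- exact: measurable_int ip.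
- move=> x Ox; have /andP[h1 hP] := h1P _ Ox.
  by rewrite lee_fin divr_ge0 ?powR_ge0// ltW// (lt_trans ltr01).
Qed.

(** For a fixed bump the energy is A - lam B, affine in lam with B > 0, and every lam above A / B
    makes it negative. *)
Lemma negative_energy : Omega !=set0 -> exists2 lambda_star : R, 0 < lambda_star &
  forall lam : R, lambda_star <= lam -> exists f F, test_pair f F /\ en leb Omega p1 p2 q lam f F < 0.
Proof.
move=> [x0 Ox0]; have [f [c [e [tf c0 e0 eO cf]]]] := bump_function oO Ox0.
have tp : test_pair f (grad f) by split.
have m1P x : Omega x -> 1 < m x <= P.
  by move=> Ox; have [] := exps p01 exponent_bounds Ox.
have q1P x : Omega x -> 1 < q x <= P.
  by move=> Ox; have [] := exps p01 exponent_bounds Ox.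
have mm : measurable_fun Omega m by exact: measurable_m.
have im := itg_norm_powR_div mm m1P tp; have iq := itg_norm_powR_div mq q1P tp.
have B0 := bump_energy_gt0 mm m1P tp c0 e0 eO cf.
set B := \int[leb]_(x in Omega) (`|f x| `^ m x / m x) in B0.
pose A := Phi leb Omega p1 p2 (grad f) + \int[leb]_(x in Omega) (`|f x| `^ q x / q x).
have A0 : 0 <= A.
  apply: addr_ge0; first exact: (Phi_ge0 _ p01 exponent_bounds).
  apply: Rintegral_ge0 => x /q1P/andP[h1 _].
  by rewrite divr_ge0 ?powR_ge0// ltW// (lt_trans ltr01).
exists (A / B + 1) => [|lam hlam]; first by rewrite ltr_wpDl// divr_ge0// ltW.
exists f, (grad f); split=> //.
have -> : en leb Omega p1 p2 q lam f (grad f) = A - lam * B.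
  rewrite /en /Lo (_ : \int[leb]_(x in Omega) pot p1 p2 q lam x (f x) =
      - lam * B + \int[leb]_(x in Omega) (`|f x| `^ q x / q x)).
    by rewrite /A mulNr addrCA addrC.
  rewrite -(integralZ_itg mO (- lam) im) -integralD_itg//; exact: itgZ.
rewrite subr_lt0 -ltr_pdivrMr// (lt_le_trans _ hlam)// ltrDl//.
Qed.

Lemma modular_enorm (F : 'rV[R]_N -> 'rV[R]_N) :
  modular Omega m (fun x => enorm (F x)) =
  (\int[leb]_(x in Omega) (enorm (F x) `^ m x)%:E)%E.
Proof. by apply: eq_integral => x _; rewrite ger0_norm// enorm_ge0. Qed.

Lemma integral_itg_lty (g : 'rV[R]_N -> R) : itg leb Omega g ->
  (\int[leb]_(x in Omega) (g x)%:E < +oo)%E.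
Proof. by move=> ig; rewrite (integral_itg mO ig) ltry. Qed.

Lemma itg_of_lty (g : 'rV[R]_N -> R) : measurable_fun Omega g ->
  (forall x, Omega x -> 0 <= g x) ->
  (\int[leb]_(x in Omega) (g x)%:E < +oo)%E -> itg leb Omega g.
Proof.
move=> mg g0 gfin.
have g_fin : (\int[leb]_(x in Omega) (g x)%:E)%E \is a fin_num.
  by rewrite ge0_fin_numE//; apply: integral_ge0 => x Ox; rewrite lee_fin g0.
have ge : (\int[leb]_(x in Omega) (g x)%:E <=
    (fine (\int[leb]_(x in Omega) (g x)%:E)%E)%:E)%E by rewrite fineK.
by have [] := itg_ge0 mO mg g0 ge.
Qed.

Lemma modular_limit_luxemburg (f : nat -> 'rV[R]_N -> R) (u : 'rV[R]_N -> R)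
    (H : 'rV[R]_N -> 'rV[R]_N) : (forall n, test_function Omega (f n)) ->
  measurable_fun Omega u -> coord_measurable Omega H ->
  (luxemburg Omega m (fun x => f n x - u x) @[n --> \oo] --> 0%E /\
   luxemburg Omega m (fun x => enorm (grad (f n) x - H x)) @[n --> \oo] --> 0%E) <->
  modular_limit leb Omega p1 p2 f (fun n => grad (f n)) u H.
Proof.
move=> tf mu mH; have mf n : measurable_fun Omega (f n) /\ coord_measurable Omega (grad (f n)).
  exact: (test_pair_measurable (conj (tf n) erefl)).
have mm : measurable_fun Omega m by exact: measurable_m.
have m1P x : Omega x -> 1 < m x <= P.
  by move=> Ox; have [] := exps p01 exponent_bounds Ox.
have mD n : measurable_fun Omega (fun x => enorm (grad (f n) x - H x)).
  by apply: (measurable_enorm mO); apply: coord_measurableB mH; exact: (mf n).2.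
have md n : measurable_fun Omega (fun x => f n x - u x).
  by apply: measurable_funB mu; exact: (mf n).1.
have lf := luxemburg_cvg0P mO mm m1P md; have lF := luxemburg_cvg0P mO mm m1P mD.
have mE n := modular_enorm (fun x => grad (f n) x - H x).
split=> [[/lf hf /lF hF] r r0|hfF].
  have [n0 h0] := hf _ r0; have [n1 h1] := hF _ r0.
  exists (maxn n0 n1) => n; rewrite geq_max => /andP[n0n n1n]; split.
    exact: (h0 _ n0n).
  by have := h1 _ n1n; rewrite mE; exact: id.
split; [apply/lf|apply/lF] => r r0; have [n0 h0] := hfF _ r0; exists n0 => n n0n.
  exact: (h0 _ n0n).1.
by rewrite mE; exact: (h0 _ n0n).2.
Qed.

End test_function_energy.

Theorem theorem2 (R : realType) (N : nat) (Omega : set 'rV[R]_N)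
    (p1 p2 q : 'rV[R]_N -> R) :
  let m := fun x => Num.max (p1 x) (p2 x) in
  (3 <= N)%N ->
  smooth_bounded_domain Omega ->
  exponent Omega p1 -> exponent Omega p2 -> exponent Omega q ->
  (forall x, closure Omega x ->
     m x < q x /\ ((q x)%:E < sobolev_conj N (m x))%E) ->
  exp_sup Omega m < exp_inf Omega q ->
  ((exp_sup Omega q)%:E < sobolev_conj N (exp_inf Omega m))%E ->
  exists2 lambda_star : R, 0 < lambda_star &
    forall lambda : R, lambda_star <= lambda ->
      exists2 u : 'rV[R]_N -> R,
        weak_solution Omega p1 p2 q lambda u & nontrivial Omega u.
Proof.
move=> m _ [oO _ nO bO _] ep1 ep2 eq mq gap _.
have mO := open_measurable_rV oO; have Ofin := lebesgue_rV_bounded mO bO.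
have [l1 l1_gt1 hl1] := exponent_lb bO ep1; have [u1 hu1] := exponent_ub bO ep1.
have [l2 l2_gt1 hl2] := exponent_lb bO ep2; have [u2 hu2] := exponent_ub bO ep2.
have [l3 l3_gt1 hl3] := exponent_lb bO eq; have [u3 hu3] := exponent_ub bO eq.
pose p0 := Num.min l1 (Num.min l2 l3); pose P := Num.max u1 (Num.max u2 u3).
have p01 : 1 < p0 by rewrite !lt_min l1_gt1 l2_gt1.
have eb x : Omega x -> [/\ p0 <= p1 x <= P, p0 <= p2 x <= P, p0 <= q x <= P & m x <= q x].
  move=> Ox; split; rewrite ?ge_min ?le_max ?hl1 ?hl2 ?hl3 ?hu1 ?hu2 ?hu3 ?orbT//.
  by have [/ltW] := mq _ (@subset_closure _ Omega _ Ox).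
have p0P : p0 <= P.
  by have [x Ox] := nO; have [/andP[h1 h2] _ _ _] := eb _ Ox; exact: le_trans h2.
have mp1 := exponent_measurable oO ep1; have mp2 := exponent_measurable oO ep2.
have mq' := exponent_measurable oO eq.
have mm : measurable_fun Omega m := measurable_m mp1 mp2.
have m1P x : Omega x -> 1 < m x <= P by move=> Ox; have [] := exps p01 eb Ox.
have [ls ls0 hls] := negative_energy oO bO mp1 mp2 mq' p01 eb nO.
exists ls => // lam lsl; have lam_gt0 := lt_le_trans ls0 lsl.
have lam0 := ltW lam_gt0.
have [f0 [F0 [V0 en0]]] := hls _ lsl.
pose delta := exp_inf Omega q - exp_sup Omega m.
have delta0 : 0 < delta by rewrite subr_gt0.
(* Then M^(q - m) >= M^delta = max(1, lam) at every point: the gap delta between the exponents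
   yields one level for all of Omega, and the 1 in the maximum ensures 1 <= M. *)
pose M := Num.max 1 lam `^ delta^-1.
have max1 : 1 <= Num.max 1 lam by rewrite le_max lexx.
have M1 : 1 <= M.
  by rewrite -(powRr0 (Num.max 1 lam)) ler_powR// invr_ge0 ltW.
have hM x : Omega x -> lam <= M `^ (q x - m x).
  move=> Ox; have gx : delta <= q x - m x.
    apply: (@exp_gap _ _ Omega m q P) => // y Oy.
      by have [_ _ /andP[h _] _] := eb _ Oy; rewrite (le_trans _ h)// ltW// (lt_trans ltr01).
    by have /andP[] := m1P _ Oy.
  apply: (@le_trans _ _ (M `^ delta)); last by rewrite ler_powR.
  by rewrite /M -powRrM mulVf ?gt_eqF// powRr1 ?le_max ?lexx ?orbT ?ler01.
have [w [G [z [Z [[mw wM] [mG iG] enG [Vz zw] crit]]]]] :=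
  critical_point mO Ofin mp1 mp2 mq' p01 p0P lam0 eb (@test_pair_lin _ _ Omega)
    (@test_pair_smabs _ _ Omega) (@test_pair_measurable _ _ Omega)
    (test_pair_bounded bO) M1 hM V0 en0.
have lux_lim := modular_limit_luxemburg oO mp1 mp2 p01 eb.
have modE := modular_enorm Omega p1 p2.
have modular_lty := integral_itg_lty oO.
exists w; last first.
  (* If w vanished almost everywhere, only the nonnegative gradient part of the energy would
     remain. *)
  move=> w0; suff : 0 <= en (lebesgue_rV N) Omega p1 p2 q lam w G by rewrite leNgt enG.
  rewrite /en (_ : Lo _ _ _ _ _ _ _ = 0); first by rewrite addr0 (Phi_ge0 _ p01 eb).
  rewrite /Lo /Rintegral (ae_eq_integral (cst 0%E)) ?integral0//.
    by apply/measurable_EFinP; exact: (measurable_pot mO lam mp1 mp2 mq' p01 eb mw).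
  by apply: filterS w0 => x w0 Ox; rewrite w0// (pot0 _ p01 eb).
exists G.
  have Zz : Z = (fun n => grad (z n)) by apply/funext => n; have [] := Vz n.
  rewrite {}Zz in zw.
  have tz n : test_function Omega (z n) by have [] := Vz n.
  have [lz lZ] : luxemburg Omega m (fun x => z n x - w x) @[n --> \oo] --> 0%E /\
     luxemburg Omega m (fun x => enorm (grad (z n) x - G x)) @[n --> \oo] --> 0%E.
    exact: (lux_lim _ _ _ tz mw mG).2 zw.
  split.
  - split=> //; apply: modular_lty.
    apply: (itg_bounded mO Ofin (C := M `^ P)).
      by apply: measurable_fun_powR => //; exact: measurableT_comp.
    move=> x Ox; have /andP[m1 mP] := m1P _ Ox; rewrite ger0_norm ?powR_ge0//.
    apply: (@le_trans _ _ (M `^ m x)); last by rewrite ler_powR.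
    have m0 : 0 <= m x by rewrite ltW// (lt_trans ltr01).
    by rewrite ge0_ler_powR ?nnegrE// ?wM// (le_trans ler01).
  - exact: (measurable_fun_rV_coord G mO).2 mG.
  - split; first exact: (measurable_enorm mO mG).
    by rewrite modE; exact: (modular_lty _ iG).
  - by exists z; split; [exact: tz|exact: lz|exact: lZ].
move=> v H [[mv fv] mH [_ fH] [f [tf fv0 fH0]]].
have mH' := (measurable_fun_rV_coord H mO).1 mH.
have iv : itg (lebesgue_rV N) Omega (fun x => `|v x| `^ m x).
  apply: (itg_of_lty oO _ (fun x _ => powR_ge0 _ _) fv).
  by apply: measurable_fun_powR => //; exact: measurableT_comp.
have iH : itg (lebesgue_rV N) Omega (fun x => enorm (H x) `^ m x).
  rewrite modE in fH; apply: (itg_of_lty oO _ (fun x _ => powR_ge0 _ _) fH).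
  by apply: measurable_fun_powR => //; exact: measurable_enorm.
have [i1 i2 i3 pE] := crit v H f (fun n => grad (f n)) mv iv (conj mH' iH)
  (fun n => conj (tf n) erefl) ((lux_lim _ _ _ tf mv mH').1 (conj fv0 fH0)).
(* All three integrals are finite, so that the extended-real equation is the real one for
   [pairing]. *)
rewrite /weak_eq (integral_itg mO i1) (integral_itg mO i2) (integral_itg mO i3).
by rewrite -EFinM -EFinB -EFinD; congr EFin; exact: pE.
Qed.
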